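(* Let $N\ge 1$, $m\ge 0$, $0<s<N/2$, $0<\gamma<2s$, and let $V\in C^\infty(\mathbb{R}^N)$ be real-valued such that there is a constant $c_1>0$ with $V(x)\ge c_1$ for all $x$, and $V(x)\to\infty$ as $|x|\to\infty$. Suppose $\{v_n\}_{n=1}^\infty\subset\Sigma^s$ converges weakly to $U$ in $\Sigma^s$. Then there exists a subsequence (still denoted by $\{v_n\}$) such that, as $n\to\infty$, $$\|v_n\|_2^2\to\|U\|_2^2$$ and $$\iint\frac{|v_n(x)|^2|v_n(y)|^2}{|x-y|^\gamma}\,dx\,dy\ \to\ \iint\frac{|U(x)|^2|U(y)|^2}{|x-y|^\gamma}\,dx\,dy.$$
   Context: All functions are complex-valued on $\mathbb{R}^N$; $\|\cdot\|_2$ is the norm of $L^2(\mathbb{R}^N)$. The operator $(-\Delta+m^2)^s$ is the Fourier multiplier $(-\Delta+m^2)^s u=\mathcal{F}^{-1}[(|\xi|^2+m^2)^s\mathcal{F}u]$, with $\mathcal{F}$ the Fourier transform normalized to be unitary on $L^2$. The energy space is the Hilbert space $$\Sigma^s=\Big\{v\in L^2(\mathbb{R}^N):\ \int\overline{v}(-\Delta+m^2)^s v\,dx+\int V|v|^2\,dx<\infty\Big\},\qquad \|v\|_{\Sigma^s}=\Big(\int\overline{v}(-\Delta+m^2)^s v\,dx+\int V|v|^2\,dx\Big)^{1/2},$$ where $\int\overline{v}(-\Delta+m^2)^s v\,dx$ is understood as the quadratic form $\|(-\Delta+m^2)^{s/2}v\|_2^2=\int(|\xi|^2+m^2)^s|\mathcal{F}v(\xi)|^2\,d\xi$.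 *)

(* Defs.v *)
From HB Require Import structures.
From mathcomp Require Import all_boot all_order all_algebra.
From mathcomp Require Import complex.
From mathcomp Require Import all_classical all_reals all_analysis.

Set Implicit Arguments.
Unset Strict Implicit.
Unset Printing Implicit Defensive.

Import Order.TTheory GRing.Theory Num.Theory.
Import numFieldNormedType.Exports.
Import ComplexField.

Local Open Scope classical_set_scope.
Local Open Scope ring_scope.
Local Open Scope complex_scope.

(* The library puts a sigma-algebra on n.-tuple R but not on 'rV[R]_n; this is
   the same construction (generated by the coordinates), i.e. the Borel sets. *)

Definition rV_display : measure_display.
Proof. exact: default_measure_display. Qed.

Section measurable_rV.
Context {R : realType} {n : nat}.

Definition rV_coord (i : 'I_n) (x : 'rV[R]_n) : measurableTypeR R := x ord0 i.

Let rV_set0 : g_sigma_preimage rV_coord set0.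
Proof. exact: sigma_algebra0. Qed.

Let rV_setC A : g_sigma_preimage rV_coord A -> g_sigma_preimage rV_coord (~` A).
Proof. exact: sigma_algebraC. Qed.

Let rV_bigcup (F : _^nat) : (forall i, g_sigma_preimage rV_coord (F i)) ->
  g_sigma_preimage rV_coord (\bigcup_i (F i)).
Proof. exact: sigma_algebra_bigcup. Qed.

HB.instance Definition _ := @isMeasurable.Build rV_display 'rV[R]_n
  (g_sigma_preimage rV_coord) rV_set0 rV_setC rV_bigcup.

End measurable_rV.

Section measurable_rV_theory.
Context {R : realType} (n : nat).

Lemma measurable_rV_coord (i : 'I_n) :
  measurable_fun [set: 'rV[R]_n] (@rV_coord R n i).
Proof.
move=> _ Y mY; rewrite setTI; apply: sub_sigma_algebra => /=.
rewrite -bigcup_seq/=; exists i => /=; first by rewrite mem_index_enum.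
by exists Y => //; rewrite setTI.
Qed.

Lemma measurable_fun_rVP d (T : measurableType d) (f : T -> 'rV[R]_n) :
  (forall i, measurable_fun [set: T] (rV_coord i \o f)) ->
  measurable_fun [set: T] f.
Proof.
move=> mf; suff H : g_sigma_preimage (fun i => rV_coord i \o f) `<=` measurable.
  by move=> _ A mA; apply: H; rewrite g_sigma_preimage_comp; exists A.
apply: smallest_sub; first exact: sigma_algebra_measurable.
case: n f mf => [|k] f mf; first by rewrite big_ord0.
rewrite -bigcup_mkord_ord; apply: bigcup_sub => i Ii.
by move=> A [B mB <-]; exact: mf.
Qed.

End measurable_rV_theory.

(* Lebesgue measure on R^n, by recursion on n: lambda_0 is the unit mass on the
   point R^0, and lambda_{n+1} is lambda_1 (x) lambda_n transported by
   R * R^n ~ R^{n+1}. *)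

Lemma product_sigma_finite d1 d2 (T1 : measurableType d1)
    (T2 : measurableType d2) (R : realType)
    (m1 : {sigma_finite_measure set T1 -> \bar R})
    (m2 : {sigma_finite_measure set T2 -> \bar R}) :
  sigma_finite setT (m1 \x m2)%E.
Proof.
have /sigma_finiteP[F [TF ndF Foo]] := sigma_finiteT m1.
have /sigma_finiteP[G [TG ndG Goo]] := sigma_finiteT m2.
exists (fun n => F n `*` G n).
  rewrite -setXTT TF TG predeqE => -[x y]; split.
    move=> [/= [n _ Fnx] [k _ Gky]]; exists (maxn n k) => //; split.
    - by move: x Fnx; exact/subsetPset/ndF/leq_maxl.
    - by move: y Gky; exact/subsetPset/ndG/leq_maxr.
  by move=> [n _ []/= ? ?]; split; exists n.
move=> k; have [? ?] := Foo k; have [? ?] := Goo k.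
split; first exact: measurableX.
by rewrite product_measure1E// lte_mul_pinfty// ge0_fin_numE.
Qed.

Section lebesgue_step.
Context {R : realType} (n : nat).

Definition rV_cons (p : measurableTypeR R * 'rV[R]_n) : 'rV[R]_n.+1 :=
  \row_i (if unlift ord0 i is Some j then p.2 ord0 j else p.1).

Definition rV_uncons (x : 'rV[R]_n.+1) : measurableTypeR R * 'rV[R]_n :=
  (x ord0 ord0, \row_j x ord0 (lift ord0 j)).

Lemma rV_consK : cancel rV_cons rV_uncons.
Proof.
case=> a x; congr pair; first by rewrite mxE unlift_none.
by apply/rowP => j; rewrite !mxE liftK.
Qed.

Lemma measurable_rV_cons : measurable_fun setT rV_cons.
Proof.
apply: measurable_fun_rVP => i; case: (unliftP ord0 i) => [j|] ->.
  rewrite (_ : _ \o _ = rV_coord j \o snd).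
    by apply: measurableT_comp => //; exact: measurable_rV_coord.
  by apply/funext => p; rewrite /= /rV_coord mxE liftK.
rewrite (_ : _ \o _ = fst)//.
by apply/funext => p; rewrite /= /rV_coord mxE unlift_none.
Qed.

Lemma measurable_rV_uncons : measurable_fun setT rV_uncons.
Proof.
apply/measurable_fun_pairP; split; first exact: measurable_rV_coord.
apply: measurable_fun_rVP => j.
rewrite (_ : _ \o _ = rV_coord (lift ord0 j)).
  exact: measurable_rV_coord.
by apply/funext => x; rewrite /= /rV_coord mxE.
Qed.

Variable mu : {sigma_finite_measure set 'rV[R]_n -> \bar R}.

Definition lebesgue_step : set 'rV[R]_n.+1 -> \bar R :=
  pushforward (lebesgue_measure \x mu)%E rV_cons.

Let lebesgue_step0 : lebesgue_step set0 = 0%E.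
Proof. by rewrite /lebesgue_step /pushforward preimage_set0 measure0. Qed.

Let lebesgue_step_ge0 A : (0 <= lebesgue_step A)%E.
Proof. rewrite /lebesgue_step /pushforward; exact: measure_ge0. Qed.

Let lebesgue_step_additive : semi_sigma_additive lebesgue_step.
Proof.
move=> F mF tF mUF; rewrite /lebesgue_step /pushforward preimage_bigcup.
apply: measure_semi_sigma_additive.
- by move=> k; rewrite -[X in measurable X]setTI; exact: measurable_rV_cons.
- apply/trivIsetP => /= i j _ _ ij; rewrite -preimage_setI.
  by move/trivIsetP : tF => /(_ _ _ _ _ ij) ->//; rewrite preimage_set0.
- by rewrite -preimage_bigcup -[X in measurable X]setTI;
     exact: measurable_rV_cons.
Qed.

HB.instance Definition _ := isMeasure.Build _ _ _
  lebesgue_step lebesgue_step0 lebesgue_step_ge0 lebesgue_step_additive.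

Let lebesgue_step_sigma_finite : sigma_finite setT lebesgue_step.
Proof.
have [F TF Foo] := product_sigma_finite lebesgue_measure mu.
exists (fun k => rV_uncons @^-1` F k).
  by rewrite -preimage_bigcup -TF preimage_setT.
move=> k; have [mF Fk] := Foo k; split.
  by rewrite -[X in measurable X]setTI; exact: measurable_rV_uncons.
rewrite /lebesgue_step /pushforward -comp_preimage.
rewrite (_ : rV_uncons \o rV_cons = id) ?preimage_id//.
by apply/funext => p; exact: rV_consK.
Qed.

HB.instance Definition _ := Measure_isSigmaFinite.Build _ _ _
  lebesgue_step lebesgue_step_sigma_finite.

End lebesgue_step.

Fixpoint leb {R : realType} (n : nat) :
    {sigma_finite_measure set 'rV[R]_n -> \bar R} :=
  if n is k.+1 then lebesgue_step (leb k) else dirac (0 : 'rV[R]_0).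

Section definitions.
Context {R : realType} {N : nat}.
Local Notation E := 'rV[R]_N.
Local Notation C := R[i].

(* The library norm on 'rV[R]_N is the sup norm, hence: *)
Definition dotv (x y : E) : R := \sum_(i < N) x ord0 i * y ord0 i.
Definition enorm (x : E) : R := Num.sqrt (dotv x x).

Definition iter_partial (l : seq 'I_N) (f : E -> R) : E -> R :=
  foldr (fun i g => derive g ^~ (delta_mx ord0 i)) f l.

Definition smooth (f : E -> R) : Prop :=
  forall l : seq 'I_N, continuous (iter_partial l f) /\
    forall (i : 'I_N) x, derivable (iter_partial l f) x (delta_mx ord0 i).

Definition cmeasurable (u : E -> C) : Prop :=
  measurable_fun setT (fun x => complex.Re (u x)) /\
  measurable_fun setT (fun x => complex.Im (u x)).

Definition L2norm (u : E -> C) : \bar R :=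
  Lnorm (leb N) 2%:E (fun x => (Normc.normc (u x))%:E).

(* L^2 is handled through Borel representatives; Sigma, its norm, its dual and
   the energies below do not distinguish a.e. equal ones. *)
Definition inL2 (u : E -> C) : Prop := cmeasurable u /\ (L2norm u < +oo)%E.

Definition Cintegral (u : E -> C) : C :=
  (\int[leb N]_x complex.Re (u x)) +i* (\int[leb N]_x complex.Im (u x)).

Definition expi (t : R) : C := cos t +i* sin t.

Definition fourierL1 (u : E -> C) (xi : E) : C :=
  (((2 * pi) `^ (- (N%:R / 2)))%:C) *
  Cintegral (fun x => expi (- dotv x xi) * u x).

Definition truncate (k : nat) (u : E -> C) (x : E) : C :=
  if enorm x <= k%:R then u x else 0.

(* The unitary (Plancherel) transform: for u in L^2 the truncations are in
   L^1 and in L^2, and F u is the L^2-limit of their integral transforms. *)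
Definition is_fourier (u g : E -> C) : Prop :=
  inL2 g /\
  L2norm (fun xi => fourierL1 (truncate k u) xi - g xi) @[k --> \oo] --> 0%E.

Definition fourier (u : E -> C) : E -> C :=
  xget (fun=> 0) [set g | is_fourier u g].

Definition kinetic (m s : R) (v : E -> C) : \bar R :=
  (\int[leb N]_xi
     ((enorm xi ^+ 2 + m ^+ 2) `^ s * Normc.normc (fourier v xi) ^+ 2)%:E)%E.

Definition potential (V : E -> R) (v : E -> C) : \bar R :=
  (\int[leb N]_x (V x * Normc.normc (v x) ^+ 2)%:E)%E.

Definition Sigma (m s : R) (V : E -> R) : set (E -> C) :=
  [set v | inL2 v /\ (kinetic m s v + potential V v < +oo)%E].

Definition Sigma_norm (m s : R) (V : E -> R) (v : E -> C) : R :=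
  Num.sqrt (fine (kinetic m s v + potential V v)%E).

(* Elements of the dual of Sigma. Boundedness makes l constant on classes of
   a.e. equal functions; values of l outside Sigma are irrelevant. *)
Definition Sigma_dual (m s : R) (V : E -> R) : set ((E -> C) -> C) :=
  [set l | (forall (a : C) v w, Sigma m s V v -> Sigma m s V w ->
              l (fun x => a * v x + w x) = a * l v + l w) /\
           (exists K : R, forall v, Sigma m s V v ->
              Normc.normc (l v) <= K * Sigma_norm m s V v)].

Definition weakly_cvg (m s : R) (V : E -> R) (v : nat -> E -> C) (U : E -> C)
    : Prop :=
  forall l, Sigma_dual m s V l ->
    Normc.normc (l (v n) - l U) @[n --> \oo] --> (0 : R).

(* On the null set x = y the integrand is 0, since / 0 = 0. *)
Definition riesz_energy (gamma : R) (v : E -> C) : \bar R :=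
  (\int[leb N]_x \int[leb N]_y
     (Normc.normc (v x) ^+ 2 * Normc.normc (v y) ^+ 2
        / enorm (x - y) `^ gamma)%:E)%E.

End definitions.

(* Main.v *)
Require Import Defs.
From HB Require Import structures.
From mathcomp Require Import all_boot all_order all_algebra.
From mathcomp Require Import complex.
From mathcomp Require Import ring lra.
From mathcomp Require Import all_classical all_reals all_analysis.
From mathcomp Require Import measurable_realfun.

(** Put w_n = v_n - U. Everything rests on the convergence of w_n to 0 in L^2,
    which holds along the whole sequence, so the subsequence may be taken to
    be the sequence itself.

    Strong convergence ([Sigma_compact]). A weakly null sequence is bounded in
    the energy space ([weakly_null_bounded]); this instance of the uniform
    boundedness principle is proved by a gliding hump, in which a limit of
    sums of norming functionals would otherwise fail to tend to 0 along the
    sequence. Boundedness has two consequences, uniform in n: since V tends to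
    infinity, little mass of w_n lies outside a large ball, and since (|xi|^2 + m^2)^s tends to infinity,
    little mass of the transform of w_n lies at high frequency. What remains is
    the transform of w_n cut off to a ball, on a bounded set of frequencies.
    For fixed xi, sending v to the value at xi of the transform of its
    truncation is itself an element of the dual, so this remainder tends to 0
    pointwise; it is also uniformly bounded, hence tends to 0 in L^2 by
    dominated convergence.

    Coulomb energy. If the kinetic energy of v is k, then the mass of v in a
    box of radius r is at most C r^(2s) k ([local_bound]): the piece f of v in
    the box has a transform bounded by a multiple of r^(N/2) times its norm, so
    it has little mass at frequencies below 1/r, and at frequencies above 1/r
    the kinetic energy controls the mass. Summing over dyadic shells around x,
    which converges because gamma < 2s, bounds the potential of |v|^2 at x
    uniformly in x ([coulomb_bound]). On bounded sets of the energy space, the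
    energy is therefore Lipschitz in |v|^2 for the L^1 norm
    ([riesz_energy_le]), and |v_n|^2 tends to |U|^2 in L^1 because v_n tends to U in L^2.

    Plancherel. The transform is defined as the L^2 limit of the transforms of
    truncations, so its isometry has to be established first. For u in L^1 and
    L^2, Fubini's theorem gives the regularised identity
      int exp(-e |xi|_1) |Fu(xi)|^2 dxi
        + 1/2 iint |u(x) - u(y)|^2 P_e(x - y) dx dy  =  int |u|^2
    in which P_e is a product of one-dimensional Poisson kernels, of mass 1
    ([regularised_parseval]). As e tends to 0 the double integral vanishes: the
    sets whose indicator has this property form a sigma-algebra that contains
    the half-spaces ([regular_measurable]), and simple functions do the rest
    ([kernel_null_complex], [plancherel_bounded]). Completeness of L^2
    ([L2_complete]) extends the isometry from truncations to L^2
    ([fourierP], [L2sq_fourier]). *)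

Set Implicit Arguments.
Unset Strict Implicit.
Unset Printing Implicit Defensive.

Import Order.TTheory GRing.Theory Num.Theory.
Import numFieldNormedType.Exports.

Local Open Scope classical_set_scope.
Local Open Scope ring_scope.

(** * Poisson and two-sided exponential kernels on the line *)

Section cauchy_kernel.
Context {R : realType}.
Local Notation mu := (@lebesgue_measure R).

Lemma ge0_integral_halfline (f F : R -> R) (l : R) :
  (forall x, 0 <= f x) -> continuous f ->
  (forall x : R, is_derive x 1 F (f x)) ->
  F x @[x --> +oo] --> l ->
  (\int[mu]_(x in `[0%R, +oo[) (f x)%:E = (l - F 0)%:E)%E.
Proof.
move=> f0 cf dF Fl; rewrite (ge0_continuous_FTC2y (F := F) (l := l))//.
- exact: continuous_subspaceT.
- apply: cvg_at_right_filter; apply: differentiable_continuous.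
  by apply/derivable1_diffP.
- by move=> x _; rewrite derive1E derive_val.
Qed.

Lemma ge0_integral_line (f : R -> R) :
  (forall x, 0 <= f x) -> measurable_fun setT f ->
  (\int[mu]_x (f x)%:E = \int[mu]_(x in `[0%R, +oo[) (f x)%:E +
   \int[mu]_(x in `[0%R, +oo[) (f (- x))%:E)%E.
Proof.
move=> f0 mf.
have mfN : measurable_fun setT (fun x : R => f (- x)).
  by apply: measurableT_comp => //; exact: measurable_funN.
rewrite (ge0_integration_by_substitution0 (f := EFin \o (fun x => f (- x)))); last 2 first.
- exact/measurable_EFinP.
- by move=> r; rewrite lee_fin.
under [X in (_ + X)%E]eq_integral do rewrite /= opprK.
have -> : [set: R] = `[0%R, +oo[ `|` `]-oo, 0%R[.
  apply/seteqP; split => x //= _; rewrite !in_itv/= andbT.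
  by case: (leP 0 x) => _; [left|right].
rewrite ge0_integral_setU//=.
- congr (_ + _)%E; rewrite -integral_itv_bndo_bndc//.
  by apply/measurable_funTS/measurable_EFinP.
- by apply/measurable_funTS/measurable_EFinP.
- by move=> x _; rewrite lee_fin.
- apply/disj_set2P/seteqP; split => x //=; rewrite !in_itv/= andbT => -[x0].
  by rewrite ltNge x0.
Qed.

(** The Poisson kernel of the half-plane at height [e]. *)
Definition cauchy_pdf (e x : R) : R := e / (pi * (e ^+ 2 + x ^+ 2)).

Lemma cauchy_ge0 e x : 0 < e -> 0 <= cauchy_pdf e x.
Proof.
move=> e0; rewrite /cauchy_pdf divr_ge0 ?(ltW e0)// mulr_ge0 ?pi_ge0//.
by rewrite addr_ge0 ?sqr_ge0.
Qed.

Lemma sqrD_gt0 (e x : R) : 0 < e -> 0 < e ^+ 2 + x ^+ 2.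
Proof. by move=> e0; rewrite ltr_pwDl ?sqr_ge0// exprn_gt0. Qed.

Lemma continuous_cauchy e a : 0 < e -> continuous (fun t => cauchy_pdf e (t - a)).
Proof.
move=> e0 x; apply: cvgM; first exact: cvg_cst.
apply: cvgV; first by rewrite gt_eqF// mulr_gt0 ?pi_gt0 ?sqrD_gt0.
apply: cvgM; first exact: cvg_cst.
apply: cvgD; first exact: cvg_cst.
by apply: (@continuous_comp _ _ _ (fun x => x - a) (fun x => x ^+ 2));
  [apply: cvgB; [exact: cvg_id|exact: cvg_cst]|exact: exprn_continuous].
Qed.

Lemma is_derive_cauchy e a (x : R) : 0 < e ->
  is_derive x 1 (fun t : R => pi^-1 * atan ((t - a) / e)) (cauchy_pdf e (x - a)).
Proof.
move=> e0.
have h : is_derive x 1 (fun t : R => (t - a) / e) e^-1.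
  rewrite (_ : (fun t : R => (t - a) / e) = e^-1 \*: (id - cst a)); last first.
    by apply/funext => t /=; rewrite mulrC.
  by apply: is_derive_eq; rewrite subr0 -[RHS]mulr1.
rewrite (_ : (fun t : R => _) = pi^-1 \*: (@atan R \o (fun t => (t - a) / e)))//.
apply: is_derive_eq; rewrite /cauchy_pdf /GRing.scale /=.
move: (pi) (@pi_gt0 R) => p p0.
by field; rewrite !gt_eqF ?sqrD_gt0.
Qed.

Lemma cvgy_affine (e a : R) : 0 < e -> (x - a) / e @[x --> +oo] --> +oo.
Proof.
move=> e0; apply/cvgryPge => A; near=> x.
rewrite ler_pdivlMr// lerBrDr.
by near: x; apply: nbhs_pinfty_ge; rewrite num_real.
Unshelve. all: by end_near. Qed.

Lemma cauchyN e x : cauchy_pdf e (- x) = cauchy_pdf e x.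
Proof. by rewrite /cauchy_pdf sqrrN. Qed.

Lemma measurable_cauchy e : 0 < e -> measurable_fun setT (cauchy_pdf e).
Proof.
move=> e0; apply: continuous_measurable_fun.
rewrite (_ : cauchy_pdf e = fun t => cauchy_pdf e (t - 0)); first exact: continuous_cauchy.
by apply/funext => t; rewrite subr0.
Qed.

Lemma integral_cauchy_half e a : 0 < e ->
  (\int[mu]_(x in `[0%R, +oo[) (cauchy_pdf e (x - a))%:E =
   (2^-1 + pi^-1 * atan (a / e))%:E)%E.
Proof.
move=> e0; have -> := @ge0_integral_halfline _ _ (pi^-1 * (pi / 2)) _ _
  (fun x => is_derive_cauchy a x e0).
- congr (_%:E); rewrite sub0r mulNr atanN mulrN opprK; congr (_ + _).
  by rewrite mulrA mulVf ?mul1r// gt_eqF// pi_gt0.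
- by move=> x; exact: cauchy_ge0.
- exact: continuous_cauchy.
- apply: cvgM; first exact: cvg_cst.
  by apply: (cvg_comp _ (@atan R) (cvgy_affine a e0)); exact: cvgy_atan.
Qed.

Lemma integral_cauchy e a : 0 < e ->
  (\int[mu]_x (cauchy_pdf e (x - a))%:E = 1)%E.
Proof.
move=> e0; rewrite ge0_integral_line; first last.
- by apply: continuous_measurable_fun; exact: continuous_cauchy.
- by move=> x; exact: cauchy_ge0.
rewrite integral_cauchy_half//.
under [X in (_ + X)%E]eq_integral.
  move=> x _; rewrite (_ : - x - a = - (x - - a)) ?cauchyN; last by ring.
  over.
rewrite integral_cauchy_half// -EFinD mulNr atanN; congr (_%:E).
by rewrite mulrN addrACA subrr addr0; lra.
Qed.

End cauchy_kernel.

Section laplace_kernel.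
Context {R : realType}.
Local Notation mu := (@lebesgue_measure R).

Definition lexp (e t : R) : R := expR (- (e * `|t|)).

Lemma lexp_ge0 e t : 0 <= lexp e t. Proof. exact: expR_ge0. Qed.

Lemma continuous_expRN (e : R) : continuous (fun t : R => expR (- (e * t))).
Proof.
move=> x; apply: (@continuous_comp _ _ _ (fun t : R => - (e * t)) expR);
  last exact: continuous_expR.
by apply: cvgN; apply: cvgM; [exact: cvg_cst|exact: cvg_id].
Qed.

Lemma continuous_cos_affine (x th : R) : continuous (fun t : R => cos (t * x + th)).
Proof.
move=> t; apply: (@continuous_comp _ _ _ (fun t : R => t * x + th) (@cos R));
  last exact: continuous_cos.
by apply: cvgD; [apply: cvgM; [exact: cvg_id|exact: cvg_cst]|exact: cvg_cst].
Qed.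

Lemma measurable_lexp e : measurable_fun setT (lexp e).
Proof.
apply: (@measurableT_comp _ _ _ _ _ _ (fun t : R => expR (- (e * t))) _ (@Num.norm R R)).
  by apply: continuous_measurable_fun; exact: continuous_expRN.
exact: normr_measurable.
Qed.

Lemma measurable_cos_affine (x th : R) : measurable_fun setT (fun t : R => cos (t * x + th)).
Proof. by apply: continuous_measurable_fun; exact: continuous_cos_affine. Qed.

Lemma cosD1_ge0 (t : R) : 0 <= 1 + cos t.
Proof. by have := cos_geN1 t; lra. Qed.

(** Primitive of [expR (- (e * t)) * (1 + cos (t * x + th))]. The constant [1]
    is there to keep this integrand nonnegative. *)
Let primitive (e x th t : R) : R := expR (- (e * t)) *
  ((x * sin (t * x + th) - e * cos (t * x + th)) / (e ^+ 2 + x ^+ 2) - e^-1).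

Lemma is_derive_primitive e x th (t : R) : 0 < e ->
  is_derive t 1 (primitive e x th) (expR (- (e * t)) * (1 + cos (t * x + th))).
Proof.
move=> e0.
have d1 : is_derive t 1 (fun t : R => - (e * t)) (- e).
  rewrite (_ : (fun t : R => _) = - (e \*: id))//.
  by apply: is_derive_eq; rewrite /GRing.scale/= mulr1.
have d2 : is_derive t 1 (fun t : R => t * x + th) x.
  rewrite (_ : (fun t : R => _) = (x \*: id + cst th)); last first.
    by apply/funext => s /=; rewrite mulrC.
  by apply: is_derive_eq; rewrite /GRing.scale/= mulr1 addr0.
pose D := e ^+ 2 + x ^+ 2.
rewrite (_ : primitive e x th = (@expR R \o (fun t : R => - (e * t))) *
   (D^-1 \*: (x \*: (@sin R \o (fun t : R => t * x + th))
      - e \*: (@cos R \o (fun t : R => t * x + th))) - cst e^-1)); last first.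
  by apply/funext => s /=; rewrite /primitive -/D [in LHS](mulrC _ D^-1).
apply: is_derive_eq; rewrite /GRing.scale /=.
have D0 : D != 0 by rewrite gt_eqF// sqrD_gt0.
rewrite subr0 [X in _ + X * _](_ : _ = D^-1 * (x * sin (t * x + th) -
  e * cos (t * x + th)) - e^-1)//.
rewrite /D in D0 *. move: (expR _) (cos _) (sin _) => E c' s'; field; rewrite D0 (gt_eqF e0)//.
Qed.

Lemma cvgy_primitive e x th : 0 < e -> primitive e x th t @[t --> +oo] --> 0.
Proof.
move=> e0; pose D := e ^+ 2 + x ^+ 2.
pose C := (`|x| + e) / D + e^-1.
have D0 : 0 < D by rewrite sqrD_gt0.
have h : expR (- (e * t)) * C @[t --> +oo] --> 0 * C.
  apply: cvgM; last exact: cvg_cst.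
  apply: (cvg_comp (fun t => e * t) (fun t => expR (- t))); last exact: cvgr_expR.
  apply/cvgryPge => A; near=> t; rewrite mulrC -ler_pdivrMr//.
rewrite mul0r in h.
apply/norm_cvg0P; apply: (@squeeze_cvgr _ _ _ _ (cst 0) _ _ _ 0 _ h); last exact: cvg_cst.
near=> t; rewrite normr_ge0/= /primitive normrM (ger0_norm (expR_ge0 _)) ler_wpM2l ?expR_ge0//.
rewrite (le_trans (ler_normB _ _))// lerD//; last by rewrite gtr0_norm ?invr_gt0.
rewrite normrM normfV (gtr0_norm D0) ler_wpM2r ?invr_ge0 ?(ltW D0)//.
rewrite (le_trans (ler_normB _ _))// !normrM (gtr0_norm e0) lerD//.
  by rewrite ler_piMr// ler_norml sin_geN1 sin_le1.
by rewrite ler_piMr ?(ltW e0)// ler_norml cos_geN1 cos_le1.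
Unshelve. all: by end_near. Qed.

Lemma integral_lexp_cos_half e x th : 0 < e ->
  (\int[mu]_(t in `[0%R, +oo[) (lexp e t * (1 + cos (t * x + th)))%:E =
   (e^-1 + (e * cos th - x * sin th) / (e ^+ 2 + x ^+ 2))%:E)%E.
Proof.
move=> e0.
under eq_integral => t.
  rewrite inE/= in_itv/= andbT => t0; rewrite /lexp ger0_norm//; over.
rewrite (ge0_integral_halfline (l := 0) _ _ (fun t => is_derive_primitive x th t e0)).
- rewrite /primitive mulr0 oppr0 expR0 mul0r add0r; congr (_%:E).
  rewrite add0r mul1r opprB; congr (_ + _); rewrite -mulNr opprB.
  by [].
- by move=> t; rewrite mulr_ge0 ?expR_ge0 ?cosD1_ge0.
- move=> t; apply: cvgM; first exact: continuous_expRN.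
  by apply: cvgD; [exact: cvg_cst|exact: continuous_cos_affine].
- exact: cvgy_primitive.
Qed.

(** The transform of a two-sided exponential is a Poisson kernel. With [1 + cos]
    in place of [cos] the integrand is nonnegative, so each half-line is covered
    by the fundamental theorem of calculus for nonnegative functions; the mass
    of [lexp] itself ([integral_lexp]) is the instance in which the cosine
    vanishes identically. *)
Lemma integral_lexp_cos e x th : 0 < e ->
  (\int[mu]_t (lexp e t * (1 + cos (t * x + th)))%:E =
   (2 / e + 2 * pi * cauchy_pdf e x * cos th)%:E)%E.
Proof.
move=> e0; rewrite ge0_integral_line; first last.
- apply: measurable_funM; first exact: measurable_lexp.
  by apply: measurable_funD => //; exact: measurable_cos_affine.
- by move=> t; rewrite mulr_ge0 ?lexp_ge0 ?cosD1_ge0.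
rewrite integral_lexp_cos_half//.
under [X in (_ + X)%E]eq_integral.
  move=> t _; rewrite /lexp normrN mulNr -mulrN -/(lexp e t); over.
rewrite integral_lexp_cos_half// -EFinD sqrrN; congr (_%:E).
rewrite /cauchy_pdf; move: pi (@pi_gt0 R) => p p0.
by field; rewrite !gt_eqF ?sqrD_gt0.
Qed.

Lemma integral_lexp e : 0 < e -> (\int[mu]_t (lexp e t)%:E = (2 / e)%:E)%E.
Proof.
move=> e0; have := integral_lexp_cos 0 (pi / 2) e0.
under eq_integral do rewrite mulr0 add0r cos_pihalf addr0 mulr1.
by rewrite cos_pihalf mulr0 addr0.
Qed.

End laplace_kernel.

(** * Lebesgue measure on R^n and product kernels *)

Section leb_product.
Context {R : realType}.
Local Notation mu := (@lebesgue_measure R).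

Lemma integral_leb0 (f : 'rV[R]_0 -> \bar R) : measurable_fun setT f ->
  (\int[leb 0]_x f x = f 0%R)%E.
Proof.
by move=> mf; rewrite /leb integral_dirac//= diracT mul1e.
Qed.

Lemma ge0_integral_lebS n (f : 'rV[R]_n.+1 -> \bar R) :
  measurable_fun setT f -> (forall x, 0 <= f x)%E ->
  (\int[leb n.+1]_x f x = \int[mu]_t \int[leb n]_y f (rV_cons (t, y)))%E.
Proof.
move=> mf f0.
transitivity (\int[pushforward (lebesgue_measure \x leb n)%E (@rV_cons R n)]_x f x)%E.
  by [].
rewrite ge0_integral_pushforward//; last exact: measurable_rV_cons.
transitivity (\int[(lebesgue_measure \x leb n)%E]_z f (rV_cons z))%E; first by [].
rewrite fubini_tonelli1//=.
exact: (measurableT_comp mf (@measurable_rV_cons R n)).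
Qed.

Lemma rV_cons0 n (t : R) (y : 'rV[R]_n) : rV_cons (t, y) ord0 ord0 = t.
Proof. by rewrite mxE unlift_none. Qed.

Lemma rV_consS n (t : R) (y : 'rV[R]_n) i : rV_cons (t, y) ord0 (lift ord0 i) = y ord0 i.
Proof. by rewrite mxE liftK. Qed.

Lemma measurable_coord n (i : 'I_n) : measurable_fun setT (fun x : 'rV[R]_n => x ord0 i).
Proof. exact: measurable_rV_coord. Qed.

Lemma measurable_prod_coord n (g : 'I_n -> R -> R) :
  (forall i, measurable_fun setT (g i)) ->
  measurable_fun setT (fun x : 'rV[R]_n => \prod_i g i (x ord0 i)).
Proof.
move=> mg; apply: measurable_prod => i _.
exact: (measurableT_comp (mg i) (measurable_coord i)).
Qed.

(** Induction on the recursive definition of [leb]: Tonelli's theorem separates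
    the first coordinate from the others. *)
Lemma integral_leb_prod n (g : 'I_n -> R -> R) (c : 'I_n -> R) :
  (forall i, measurable_fun setT (g i)) -> (forall i t, 0 <= g i t) ->
  (forall i, \int[mu]_t (g i t)%:E = (c i)%:E)%E ->
  (\int[leb n]_x (\prod_i g i (x ord0 i))%:E = (\prod_i c i)%:E)%E.
Proof.
elim: n g c => [|n IH] g c mg g0 gc.
  rewrite integral_leb0 ?big_ord0//.
  by apply/measurable_EFinP; exact: measurable_prod_coord.
rewrite ge0_integral_lebS; first last.
- by move=> x; rewrite lee_fin prodr_ge0.
- by apply/measurable_EFinP; exact: measurable_prod_coord.
under eq_integral => t _.
  under eq_integral => y _.
    rewrite big_ord_recl rV_cons0.
    under eq_bigr do rewrite rV_consS.
    rewrite EFinM; over.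
  rewrite ge0_integralZl//; first last.
  - by rewrite lee_fin.
  - by move=> y _; rewrite lee_fin prodr_ge0.
  - apply/measurable_EFinP; exact: (measurable_prod_coord (fun i => mg (lift ord0 i))).
  rewrite (IH (fun i => g (lift ord0 i)) (fun i => c (lift ord0 i)))//.
  over.
rewrite ge0_integralZr//; first last.
- rewrite lee_fin prodr_ge0// => i _; rewrite -lee_fin -gc integral_ge0// => t _.
  by rewrite lee_fin.
- by move=> t _; rewrite lee_fin.
- by apply/measurable_EFinP; exact: mg.
by rewrite gc -EFinM big_ord_recl.
Qed.

Definition box n (a : 'rV[R]_n) (r : R) : set 'rV[R]_n :=
  [set x | forall i, `|x ord0 i - a ord0 i| <= r].

Lemma indic_box n (a : 'rV[R]_n) r x :
  \1_(box a r) x = \prod_i \1_(`[a ord0 i - r, a ord0 i + r]%classic) (x ord0 i) :> R.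
Proof.
rewrite indicE; case: (asboolP (box a r x)) => h.
  rewrite mem_set// big1// => i _; rewrite indicE mem_set//=.
  by rewrite in_itv/= -ler_distl; exact: h.
rewrite memNset//; move/existsNP : h => [i hi].
rewrite (bigD1 i)//= indicE memNset ?mul0r//=.
by rewrite in_itv/= -ler_distl.
Qed.

Lemma measurable_box n (a : 'rV[R]_n) r : measurable (box a r).
Proof.
apply/(@measurable_indicP _ _ R).
rewrite (_ : \1_ _ = fun x : 'rV[R]_n =>
   \prod_i \1_(`[a ord0 i - r, a ord0 i + r]%classic) (x ord0 i)); last first.
  by apply/funext => x; rewrite indic_box.
by apply: (measurable_prod_coord (g := fun i => \1_(`[a ord0 i - r, a ord0 i + r]%classic))) => i.
Qed.

Lemma leb_box n (a : 'rV[R]_n) r : 0 <= r -> leb n (box a r) = ((2 * r) ^+ n)%:E.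
Proof.
move=> r0; have mb := measurable_box a r.
have -> : leb n (box a r) = (\int[leb n]_x (\1_(box a r) x)%:E)%E by rewrite integral_indic// setIT.
under eq_integral do rewrite indic_box.
rewrite (integral_leb_prod (g := fun i => \1_(`[a ord0 i - r, a ord0 i + r]%classic))
  (c := fun=> 2 * r)).
- by rewrite prodr_const card_ord.
- by move=> i; exact: measurable_indic.
- by [].
- move=> i; transitivity (lebesgue_measure (`[a ord0 i - r, a ord0 i + r]%classic)).
    by rewrite integral_indic// setIT.
  rewrite lebesgue_measure_itv/= lte_fin.
  case: ltP => h; last first.
    have -> : r = 0 by lra.
    by rewrite mulr0.
  by rewrite -EFinD; congr (_%:E); ring.
Qed.

Definition plexp n (e : R) (x : 'rV[R]_n) : R := \prod_i lexp e (x ord0 i).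

(** Products of one-dimensional kernels stand in for radial ones: by
    [integral_leb_prod] all their integrals reduce to the line. *)
Definition pcauchy n (e : R) (x : 'rV[R]_n) : R := \prod_i cauchy_pdf e (x ord0 i).

Lemma dotv_cons n (t u : R) (x y : 'rV[R]_n) :
  dotv (rV_cons (t, x)) (rV_cons (u, y)) = t * u + dotv x y.
Proof.
rewrite /dotv big_ord_recl !rV_cons0; congr (_ + _).
by apply: eq_bigr => i _; rewrite !rV_consS.
Qed.

Lemma measurable_dotv n (z : 'rV[R]_n) : measurable_fun setT (dotv ^~ z).
Proof.
apply: measurable_sum => i; apply: measurable_funM => //; exact: measurable_coord.
Qed.

Lemma measurable_plexp n e : measurable_fun setT (@plexp n e).
Proof. by apply: (measurable_prod_coord (g := fun=> lexp e)) => i; exact: measurable_lexp. Qed.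

Lemma plexp_ge0 n e (x : 'rV[R]_n) : 0 <= plexp e x.
Proof. by apply: prodr_ge0 => i _; exact: lexp_ge0. Qed.

Lemma integral_plexp n e : 0 < e -> (\int[leb n]_x (plexp e x)%:E = ((2 / e) ^+ n)%:E)%E.
Proof.
move=> e0; rewrite (integral_leb_prod (g := fun=> lexp e) (c := fun=> 2 / e)).
- by rewrite prodr_const card_ord.
- by move=> i; exact: measurable_lexp.
- by move=> i t; exact: lexp_ge0.
- by move=> i; exact: integral_lexp.
Qed.

Lemma pcauchy_ge0 n e (x : 'rV[R]_n) : 0 < e -> 0 <= pcauchy e x.
Proof. by move=> e0; apply: prodr_ge0 => i _; exact: cauchy_ge0. Qed.

Lemma measurable_pcauchy n e : 0 < e -> measurable_fun setT (@pcauchy n e).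
Proof. by move=> e0; apply: (measurable_prod_coord (g := fun=> cauchy_pdf e)) => i;
  exact: measurable_cauchy. Qed.

Lemma integral_pcauchy n e (a : 'rV[R]_n) : 0 < e ->
  (\int[leb n]_x (pcauchy e (x - a))%:E = 1)%E.
Proof.
move=> e0.
under eq_integral => x _.
  rewrite /pcauchy; under eq_bigr do rewrite !mxE; over.
rewrite (integral_leb_prod (g := fun i t => cauchy_pdf e (t - a ord0 i)) (c := fun=> 1)).
- by rewrite prodr_const expr1n.
- by move=> i; apply: continuous_measurable_fun; exact: continuous_cauchy.
- by move=> i t; exact: cauchy_ge0.
- by move=> i; exact: integral_cauchy.
Qed.

Lemma pcauchyN n e (x : 'rV[R]_n) : pcauchy e (- x) = pcauchy e x.
Proof. by apply: eq_bigr => i _; rewrite mxE cauchyN. Qed.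

(** The left side is the value at [z] of the transform of [plexp e], the right
    side its value at 0, which is the integral of [plexp e]. *)
Lemma pcauchy_le n e (z : 'rV[R]_n) : 0 < e ->
  (2 * pi) ^+ n * pcauchy e z <= (2 / e) ^+ n.
Proof.
move=> e0; rewrite -[X in _ ^+ X]card_ord -[X in _ <= _ ^+ X]card_ord -!prodr_const.
rewrite -big_split; apply: ler_prod => i _.
apply/andP; split.
  by apply: mulr_ge0; [rewrite mulr_ge0 ?pi_ge0|exact: cauchy_ge0].
rewrite /cauchy_pdf; move: (pi) (@pi_gt0 R) (z ord0 i) => p p0 y.
have D0 := sqrD_gt0 y e0.
rewrite /= (_ : 2 * p * (e / _) = 2 * e / (e ^+ 2 + y ^+ 2)); last first.
  by field; rewrite !gt_eqF.
rewrite ler_pdivrMr// mulrAC ler_pdivlMr//.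
by rewrite -mulrA ler_wpM2l// -expr2 lerDl sqr_ge0.
Qed.

Lemma measurable_cos_dotv n (z : 'rV[R]_n) th :
  measurable_fun setT (fun x => cos (dotv x z + th)).
Proof.
apply: (@measurableT_comp _ _ _ _ _ _ (@cos R)).
  by apply: continuous_measurable_fun; exact: continuous_cos.
by apply: measurable_funD => //; exact: measurable_dotv.
Qed.

(** Induction on the dimension. The phase [th] absorbs the term that the first
    coordinate contributes to the inner product, and [pcauchy_le] makes the
    coefficient of [lexp e t] nonnegative once the other coordinates are
    integrated, so additivity for nonnegative functions is enough. *)
Lemma integral_plexp_cosD1 n e (z : 'rV[R]_n) th : 0 < e ->
  (\int[leb n]_x (plexp e x * (1 + cos (dotv x z + th)))%:E =
   ((2 / e) ^+ n + (2 * pi) ^+ n * pcauchy e z * cos th)%:E)%E.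
Proof.
move=> e0; have mplc m (y : 'rV[R]_m) (t : R) :
    measurable_fun setT (fun x => (plexp e x * (1 + cos (dotv x y + t)))%:E).
  apply/measurable_EFinP; apply: measurable_funM; first exact: measurable_plexp.
  by apply: measurable_funD => //; exact: measurable_cos_dotv.
elim: n z th => [|n IH] z th.
  rewrite integral_leb0 ?mplc// /plexp /pcauchy /dotv !big_ord0 !expr0 add0r.
  by rewrite !mul1r.
rewrite ge0_integral_lebS//; last first.
  by move=> x; rewrite lee_fin mulr_ge0 ?plexp_ge0 ?cosD1_ge0.
have [t0 [z' ->]] : exists t0 z', z = rV_cons (t0, z').
  exists (rV_uncons z).1, (rV_uncons z).2; apply/rowP => i; rewrite !mxE.
  by case: (unliftP ord0 i) => [j|] -> //=; rewrite !mxE.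
set c := (2 * pi) ^+ n * pcauchy e z'.
have c0 : 0 <= (2 / e) ^+ n - c by rewrite subr_ge0 pcauchy_le.
have cp : 0 <= c by rewrite mulr_ge0 ?exprn_ge0 ?mulr_ge0 ?pi_ge0 ?pcauchy_ge0.
under eq_integral => t _.
  under eq_integral => y _.
    rewrite dotv_cons (addrC (t * t0)) -addrA /plexp big_ord_recl rV_cons0.
    under eq_bigr do rewrite rV_consS.
    rewrite -/(plexp e y) -mulrA EFinM; over.
  rewrite ge0_integralZl//; first last.
  - by rewrite lee_fin lexp_ge0.
  - by move=> y _; rewrite lee_fin mulr_ge0 ?plexp_ge0 ?cosD1_ge0.
  - exact: mplc.
  rewrite IH -/c -EFinM.
  rewrite (_ : lexp e t * _ = ((2 / e) ^+ n - c) * lexp e t +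
     c * (lexp e t * (1 + cos (t * t0 + th)))); last by ring.
  rewrite EFinD (EFinM _ (lexp e t)) (EFinM c); over.
have ml : measurable_fun setT (EFin \o lexp e).
  by apply/measurable_EFinP; exact: measurable_lexp.
have mc : measurable_fun setT (fun t => (lexp e t * (1 + cos (t * t0 + th)))%:E).
  apply/measurable_EFinP; apply: measurable_funM; first exact: measurable_lexp.
  by apply: measurable_funD => //; exact: measurable_cos_affine.
rewrite ge0_integralD//; first last.
- exact: measurable_funeM.
- move=> t _; apply: mule_ge0; first by rewrite lee_fin.
  by rewrite lee_fin; apply: mulr_ge0; [exact: lexp_ge0|exact: cosD1_ge0].
- exact: measurable_funeM.
- by move=> t _; apply: mule_ge0; rewrite lee_fin// lexp_ge0.
rewrite !ge0_integralZl//; last 2 first.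
- by move=> t _; rewrite lee_fin mulr_ge0 ?lexp_ge0 ?cosD1_ge0.
- by move=> t _; rewrite lee_fin lexp_ge0.
rewrite integral_lexp// integral_lexp_cos// -!EFinM -EFinD; congr (_%:E).
rewrite /pcauchy big_ord_recl rV_cons0.
under eq_bigr do rewrite rV_consS.
rewrite -/(pcauchy e z') !exprS /c; ring.
Qed.

Lemma integrable_plexp n e : 0 < e -> (leb n).-integrable setT (EFin \o @plexp n e).
Proof.
move=> e0; apply/integrableP; split; first by apply/measurable_EFinP; exact: measurable_plexp.
under eq_integral do rewrite /= ger0_norm ?plexp_ge0//.
by rewrite integral_plexp// ltry.
Qed.

Lemma integral_plexp_cos n e (z : 'rV[R]_n) th : 0 < e ->
  (\int[leb n]_x (plexp e x * cos (dotv x z + th))%:E =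
   ((2 * pi) ^+ n * pcauchy e z * cos th)%:E)%E.
Proof.
move=> e0.
have mc : measurable_fun setT (fun x => (plexp e x * cos (dotv x z + th))%:E).
  apply/measurable_EFinP; apply: measurable_funM; first exact: measurable_plexp.
  exact: measurable_cos_dotv.
have ic : (leb n).-integrable setT (fun x => (plexp e x * cos (dotv x z + th))%:E).
  apply: (le_integrable _ _ _ (integrable_plexp n e0)) => //= x _.
  rewrite lee_fin normrM ler_piMr//.
  by rewrite ler_norml cos_geN1 cos_le1.
have := integral_plexp_cosD1 z th e0.
under eq_integral do rewrite mulrDr mulr1 EFinD.
rewrite integralD//; last exact: integrable_plexp.
rewrite integral_plexp// EFinD => h.
by rewrite -[LHS](addeK (x := ((2 / e) ^+ n)%:E))// (addeC _ (_ ^+ n)%:E) h addeC addeA (addeC (- _)%E) subee// add0e.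
Qed.

End leb_product.

(** * The regularised Parseval identity *)

Lemma integrable_measurable d (T : measurableType d) (R : realType)
    (m : {measure set T -> \bar R}) (g : T -> R) :
  m.-integrable setT (EFin \o g) -> measurable_fun setT g.
Proof. by case/integrableP => /measurable_EFinP. Qed.

Section real_integrable.
Context d (T : measurableType d) (R : realType) (m : {measure set T -> \bar R}).
Local Notation rintegrable f := (m.-integrable setT (fun x => (f x)%:E)).

Lemma rintegrable_dominated (f g : T -> R) : measurable_fun setT f ->
  rintegrable g -> (forall x, `|f x| <= g x) -> rintegrable f.
Proof.
move=> mf ig fg; apply: le_integrable ig => //; first exact/measurable_EFinP.
by move=> x _ /=; rewrite lee_fin (le_trans (fg x))// ler_norm.
Qed.

Lemma rintegrableD (f g : T -> R) :
  rintegrable f -> rintegrable g -> rintegrable (fun x => f x + g x).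
Proof.
move=> fi gi; have := integrableD measurableT fi gi.
by apply: eq_integrable => // x _ /=; rewrite EFinD.
Qed.

Lemma rintegrableB (f g : T -> R) :
  rintegrable f -> rintegrable g -> rintegrable (fun x => f x - g x).
Proof.
move=> fi gi; have := integrableB measurableT fi gi.
by apply: eq_integrable => // x _ /=; rewrite EFinB.
Qed.

Lemma rintegrableZl (k : R) (f : T -> R) :
  rintegrable f -> rintegrable (fun x => k * f x).
Proof.
move=> fi; have := integrableZl measurableT k fi.
by apply: eq_integrable => // x _ /=; rewrite EFinM.
Qed.

Lemma rintegrableZr (k : R) (f : T -> R) :
  rintegrable f -> rintegrable (fun x => f x * k).
Proof. by move=> /(rintegrableZl k); under eq_fun do rewrite mulrC. Qed.

End real_integrable.

Section real_fubini.
Context d1 d2 (T1 : measurableType d1) (T2 : measurableType d2) (R : realType).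
Variable m1 : {sigma_finite_measure set T1 -> \bar R}.
Variable m2 : {sigma_finite_measure set T2 -> \bar R}.

Lemma integrable_prod_dominated (f : T1 * T2 -> R) (g : T1 -> R) (h : T2 -> R) :
  measurable_fun setT f ->
  m1.-integrable setT (EFin \o g) -> m2.-integrable setT (EFin \o h) ->
  (forall x y, `|f (x, y)| <= g x * h y) ->
  (m1 \x m2)%E.-integrable setT (EFin \o f).
Proof.
move=> mf ig ih fgh; apply/integrable12ltyP; first exact/measurable_EFinP.
have mg : measurable_fun setT (fun x => `|g x|).
  by apply: measurableT_comp => //; exact: integrable_measurable ig.
have mh : measurable_fun setT (fun x => `|h x|).
  by apply: measurableT_comp => //; exact: integrable_measurable ih.
have mgh : measurable_fun setT (fun z : T1 * T2 => (`|g z.1| * `|h z.2|)%:E).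
  apply/measurable_EFinP; apply: measurable_funM.
    exact: (measurableT_comp mg).
  exact: (measurableT_comp mh).
apply: (@le_lt_trans _ _ (\int[m1]_x \int[m2]_y (`|g x| * `|h y|)%:E)%E).
  apply: ge0_le_integral => //=.
  - by move=> x _; apply: integral_ge0.
  - apply: (measurable_fun_fubini_tonelli_F (fun z => `|(f z)%:E|%E)) => //.
    by apply: measurableT_comp => //; exact/measurable_EFinP.
  - apply: (measurable_fun_fubini_tonelli_F (fun z => (`|g z.1| * `|h z.2|)%:E)) => //.
  - move=> x _; apply: ge0_le_integral => //=.
    + apply/measurable_EFinP; apply: measurableT_comp => //.
      exact: (measurableT_comp mf (measurable_pair1 x)).
    + by apply/measurable_EFinP; apply: measurable_funM.
    + by move=> y _; rewrite lee_fin (le_trans (fgh x y))// -normrM ler_norm.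
under eq_integral => x _.
  under eq_integral do rewrite EFinM.
  rewrite ge0_integralZl//; last exact/measurable_EFinP.
  over.
rewrite ge0_integralZr//.
- rewrite lte_mul_pinfty//.
  + exact: integral_ge0.
  + by rewrite ge0_fin_numE ?integral_ge0//; case/integrableP : ig.
  + by case/integrableP : ih.
- exact/measurable_EFinP.
- exact: integral_ge0.
Qed.

Lemma real_Fubini (f : T1 * T2 -> R) (g : T1 -> R) (h : T2 -> R) :
  measurable_fun setT f ->
  m1.-integrable setT (EFin \o g) -> m2.-integrable setT (EFin \o h) ->
  (forall x y, `|f (x, y)| <= g x * h y) ->
  (\int[m1]_x (\int[m2]_y f (x, y))%:E = \int[m2]_y (\int[m1]_x f (x, y))%:E)%E.
Proof.
move=> mf ig ih fgh.
have := Fubini (integrable_prod_dominated mf ig ih fgh).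
rewrite /Rintegral/= => H.
have f1 x : m2.-integrable setT (fun y => (f (x, y))%:E).
  apply: (rintegrable_dominated _ (rintegrableZl (g x) ih) (fgh x)).
  exact: (measurableT_comp mf (measurable_pair1 x)).
have f2 y : m1.-integrable setT (fun x => (f (x, y))%:E).
  apply: (rintegrable_dominated _ (rintegrableZr (h y) ig) (fgh^~ y)).
  exact: (measurableT_comp mf (measurable_pair2 y)).
transitivity (\int[m1]_x \int[m2]_y (f (x, y))%:E)%E.
  by apply: eq_integral => x _; rewrite fineK// integrable_fin_num.
by rewrite H; apply: eq_integral => y _; rewrite fineK// integrable_fin_num.
Qed.

End real_fubini.

Section regularised_parseval.
Context {R : realType} {n : nat}.
Local Notation E := 'rV[R]_n.
Local Notation L := (@leb R n).
Variables (a b : E -> R).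
Hypothesis ia : L.-integrable setT (EFin \o a).
Hypothesis ib : L.-integrable setT (EFin \o b).

Let g x : R := `|a x| + `|b x|.
Let G := \int[L]_x g x.

Definition trig_re (x xi : E) := a x * cos (dotv x xi) + b x * sin (dotv x xi).
Definition trig_im (x xi : E) := b x * cos (dotv x xi) - a x * sin (dotv x xi).
(** Real and imaginary part of the Fourier integral of [a + i b], without the
    normalising constant. *)
Definition four_re (xi : E) := \int[L]_x trig_re x xi.
Definition four_im (xi : E) := \int[L]_x trig_im x xi.

Let ma : measurable_fun setT a. Proof. exact: integrable_measurable ia. Qed.
Let mb : measurable_fun setT b. Proof. exact: integrable_measurable ib. Qed.

Let ig : L.-integrable setT (EFin \o g).
Proof.
rewrite (_ : EFin \o g = (EFin \o (@Num.norm R R \o a)) \+ (EFin \o (@Num.norm R R \o b)))//.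
by apply: integrableD => //; apply: integrable_norm.
Qed.

Let g0 x : 0 <= g x. Proof. by rewrite addr_ge0. Qed.

Let G0 : 0 <= G. Proof. by apply: Rintegral_ge0. Qed.

Lemma abs_cos_le1 (t : R) : `|cos t| <= 1.
Proof. by rewrite ler_norml cos_geN1 cos_le1. Qed.

Lemma abs_sin_le1 (t : R) : `|sin t| <= 1.
Proof. by rewrite ler_norml sin_geN1 sin_le1. Qed.

Lemma abs_trig_re x xi : `|trig_re x xi| <= g x.
Proof.
rewrite (le_trans (ler_normD _ _))// !normrM lerD// ler_piMr//.
  exact: abs_cos_le1.
exact: abs_sin_le1.
Qed.

Lemma abs_trig_im x xi : `|trig_im x xi| <= g x.
Proof.
rewrite (le_trans (ler_normB _ _))// !normrM addrC lerD// ler_piMr//.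
  exact: abs_sin_le1.
exact: abs_cos_le1.
Qed.

Lemma measurable_dotv2 : measurable_fun setT (fun z : E * E => dotv z.1 z.2).
Proof.
apply: measurable_sum => i; apply: measurable_funM.
  exact: (measurableT_comp (measurable_coord i)).
exact: (measurableT_comp (measurable_coord i)).
Qed.

Lemma measurable_cos : measurable_fun setT (@cos R).
Proof. by apply: continuous_measurable_fun; exact: continuous_cos. Qed.

Lemma measurable_sin : measurable_fun setT (@sin R).
Proof. by apply: continuous_measurable_fun; exact: continuous_sin. Qed.

Lemma measurable_trig_re : measurable_fun setT (fun z : E * E => trig_re z.1 z.2).
Proof.
apply: measurable_funD; apply: measurable_funM.
- exact: (measurableT_comp ma).
- exact: (measurableT_comp measurable_cos measurable_dotv2).
- exact: (measurableT_comp mb).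
- exact: (measurableT_comp measurable_sin measurable_dotv2).
Qed.

Lemma measurable_trig_im : measurable_fun setT (fun z : E * E => trig_im z.1 z.2).
Proof.
apply: measurable_funB; apply: measurable_funM.
- exact: (measurableT_comp mb).
- exact: (measurableT_comp measurable_cos measurable_dotv2).
- exact: (measurableT_comp ma).
- exact: (measurableT_comp measurable_sin measurable_dotv2).
Qed.

Lemma integrable_trig_re xi : L.-integrable setT (fun x => (trig_re x xi)%:E).
Proof.
apply: (le_integrable _ _ _ ig) => //=.
  apply/measurable_EFinP.
  exact: (measurableT_comp measurable_trig_re (measurable_pair2 xi)).
by move=> x _; rewrite lee_fin (ger0_norm (g0 x)) abs_trig_re.
Qed.

Lemma integrable_trig_im xi : L.-integrable setT (fun x => (trig_im x xi)%:E).
Proof.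
apply: (le_integrable _ _ _ ig) => //=.
  apply/measurable_EFinP.
  exact: (measurableT_comp measurable_trig_im (measurable_pair2 xi)).
by move=> x _; rewrite lee_fin (ger0_norm (g0 x)) abs_trig_im.
Qed.

Lemma abs_four_re xi : `|four_re xi| <= G.
Proof.
rewrite (le_trans (le_normr_Rintegral _ (integrable_trig_re xi)))//.
apply: le_Rintegral => //; first exact: integrable_norm (integrable_trig_re xi).
by move=> x _; exact: abs_trig_re.
Qed.

Lemma abs_four_im xi : `|four_im xi| <= G.
Proof.
rewrite (le_trans (le_normr_Rintegral _ (integrable_trig_im xi)))//.
apply: le_Rintegral => //; first exact: integrable_norm (integrable_trig_im xi).
by move=> x _; exact: abs_trig_im.
Qed.

Let w := @plexp R n 1.

(** [t] need not be integrable in [xi]. Fubini's measurability statement is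
    applied to [w xi * t x xi], and the positive weight is divided out. *)
Let measurable_four (t : E -> E -> R) :
  (forall xi, L.-integrable setT (fun x => (t x xi)%:E)) ->
  measurable_fun setT (fun z : E * E => t z.1 z.2) ->
  (forall x xi, `|t x xi| <= g x) ->
  measurable_fun setT (fun xi => \int[L]_x t x xi).
Proof.
move=> it mt tg.
have w0 xi : 0 < w xi by apply: prodr_gt0 => i _; exact: expR_gt0.
have iwt : (L \x L)%E.-integrable setT (EFin \o (fun z : E * E => w z.1 * t z.2 z.1)).
  apply: (@integrable_prod_dominated _ _ _ _ _ _ _ _ w g) => //.
  - apply: measurable_funM.
      exact: (measurableT_comp (measurable_plexp 1)).
    rewrite (_ : (fun _ => _) = (fun z : E * E => t z.1 z.2) \o (fun z => (z.2, z.1)))//.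
    by apply: measurableT_comp => //; exact: measurable_fun_pair.
  - exact: integrable_plexp.
  - by move=> x y /=; rewrite normrM (gtr0_norm (w0 x)) ler_wpM2l ?(ltW (w0 x)).
rewrite (_ : (fun xi => _) =
    fun xi => (w xi)^-1 * fine (\int[L]_x (w xi * t x xi)%:E)); last first.
  apply/funext => xi; have := RintegralZl (w xi) measurableT (it xi).
  rewrite {1}/Rintegral => ->.
  by rewrite mulrA mulVf ?mul1r// gt_eqF.
apply: measurable_funM.
  rewrite (_ : (fun x => _) = plexp (-1)); first exact: measurable_plexp.
  apply/funext => x; rewrite /plexp -prodfV; apply: eq_bigr => i _.
  by rewrite /lexp -expRN mulN1r mul1r.
exact: (measurableT_comp (fine_measurable measurableT) (measurable_fubini_F iwt)).
Qed.

Lemma measurable_four_re : measurable_fun setT four_re.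
Proof.
exact: (measurable_four integrable_trig_re measurable_trig_re abs_trig_re).
Qed.

Lemma measurable_four_im : measurable_fun setT four_im.
Proof.
exact: (measurable_four integrable_trig_im measurable_trig_im abs_trig_im).
Qed.

Lemma trig_products x y xi :
  trig_re x xi * trig_re y xi + trig_im x xi * trig_im y xi =
  (a x * a y + b x * b y) * cos (dotv xi (x - y) + 0) +
  (b x * a y - a x * b y) * cos (dotv xi (x - y) + - (pi / 2)).
Proof.
have -> : dotv xi (x - y) = dotv x xi - dotv y xi.
  by rewrite /dotv -sumrB; apply: eq_bigr => i _; rewrite !mxE; ring.
rewrite addr0.
rewrite (_ : dotv x xi - dotv y xi - pi / 2 = - (pi / 2 - (dotv x xi - dotv y xi))); last by ring.
rewrite cosN.
rewrite (cosB (pi / 2)) cos_pihalf sin_pihalf mul0r mul1r add0r.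
rewrite /trig_re /trig_im cosB sinB; ring.
Qed.

(** The squares are double integrals. Exchanging them with the integral in [xi]
    leaves, by [integral_plexp_cos], the kernel [pcauchy] at [x - y]; the sine
    terms disappear because they carry the phase [pi / 2]. *)
Lemma regularised_four e : 0 < e ->
  (\int[L]_xi (plexp e xi * (four_re xi ^+ 2 + four_im xi ^+ 2))%:E =
   \int[L]_x (\int[L]_y ((2 * pi) ^+ n * ((a x * a y + b x * b y) * pcauchy e (x - y))))%:E)%E.
Proof.
move=> e0.
pose k (z : E * E) : R := plexp e z.1 * (trig_re z.2 z.1 * four_re z.1 + trig_im z.2 z.1 * four_im z.1).
have mswap (t : E -> E -> R) : measurable_fun setT (fun z : E * E => t z.1 z.2) ->
    measurable_fun setT (fun z : E * E => t z.2 z.1).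
  move=> mt; rewrite (_ : (fun _ => _) = (fun z : E * E => t z.1 z.2) \o (fun z => (z.2, z.1)))//.
  by apply: measurableT_comp => //; exact: measurable_fun_pair.
have mk : measurable_fun setT k.
  apply: measurable_funM; first exact: (measurableT_comp (measurable_plexp e)).
  apply: measurable_funD; apply: measurable_funM.
  - exact: mswap measurable_trig_re.
  - exact: (measurableT_comp measurable_four_re).
  - exact: mswap measurable_trig_im.
  - exact: (measurableT_comp measurable_four_im).
have kb xi x : `|k (xi, x)| <= (plexp e xi * (2 * G)) * g x.
  rewrite /k/= normrM ger0_norm ?plexp_ge0// -mulrA ler_wpM2l ?plexp_ge0//.
  rewrite (le_trans (ler_normD _ _))// !normrM.
  rewrite (_ : 2 * G * g x = g x * G + g x * G); last by ring.
  by rewrite lerD// ler_pM ?abs_trig_re ?abs_trig_im ?abs_four_re ?abs_four_im.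
have ipl := integrable_plexp n e0.
have iplG : L.-integrable setT (EFin \o (fun xi => plexp e xi * (2 * G))).
  exact: rintegrableZr.
transitivity (\int[L]_xi (\int[L]_x k (xi, x))%:E)%E.
  apply: eq_integral => xi _; congr (_%:E).
  rewrite /k/= RintegralZl//; last first.
    exact: (rintegrableD (rintegrableZr _ (integrable_trig_re xi)) (rintegrableZr _ (integrable_trig_im xi))).
  rewrite RintegralD//; last 2 first.
    exact: (rintegrableZr _ (integrable_trig_re xi)).
    exact: (rintegrableZr _ (integrable_trig_im xi)).
  by rewrite !RintegralZr ?integrable_trig_re ?integrable_trig_im.
rewrite (real_Fubini mk iplG ig kb).
apply: eq_integral => x _.
pose h (z : E * E) : R := plexp e z.1 * (trig_re x z.1 * trig_re z.2 z.1 + trig_im x z.1 * trig_im z.2 z.1).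
have mh : measurable_fun setT h.
  have mt1 (t : E -> E -> R) : measurable_fun setT (fun z : E * E => t z.1 z.2) ->
    measurable_fun setT (fun z : E * E => t x z.1).
    move=> mt; rewrite (_ : (fun _ => _) = (fun z : E * E => t z.1 z.2) \o (fun z => (x, z.1)))//.
    by apply: measurableT_comp => //; exact: measurable_fun_pair.
  apply: measurable_funM; first exact: (measurableT_comp (measurable_plexp e)).
  apply: measurable_funD; apply: measurable_funM.
  - exact: mt1 measurable_trig_re.
  - exact: mswap measurable_trig_re.
  - exact: mt1 measurable_trig_im.
  - exact: mswap measurable_trig_im.
have hb xi y : `|h (xi, y)| <= (plexp e xi * (2 * g x)) * g y.
  rewrite /h/= normrM ger0_norm ?plexp_ge0// -mulrA ler_wpM2l ?plexp_ge0//.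
  rewrite (le_trans (ler_normD _ _))// !normrM.
  rewrite (_ : 2 * g x * g y = g x * g y + g x * g y); last by ring.
  by rewrite lerD// ler_pM ?abs_trig_re ?abs_trig_im.
have iplg : L.-integrable setT (EFin \o (fun xi => plexp e xi * (2 * g x))).
  exact: rintegrableZr.
have -> : \int[L]_xi k (xi, x) = fine (\int[L]_xi (\int[L]_y h (xi, y))%:E)%E.
  congr fine; apply: eq_integral => xi _; congr (_%:E).
  rewrite /k /h /= RintegralZl//; last first.
    exact: (rintegrableD (rintegrableZl _ (integrable_trig_re xi)) (rintegrableZl _ (integrable_trig_im xi))).
  rewrite RintegralD//; last 2 first.
    exact: (rintegrableZl _ (integrable_trig_re xi)).
    exact: (rintegrableZl _ (integrable_trig_im xi)).
  by rewrite !RintegralZl ?integrable_trig_re ?integrable_trig_im.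
rewrite (real_Fubini mh iplg ig hb); congr ((fine _)%:E).
apply: eq_integral => y _; congr (_%:E); rewrite /h/=.
under eq_Rintegral do rewrite trig_products mulrDr !mulrA !(mulrC (plexp _ _)) -!mulrA.
have iplc th : L.-integrable setT (fun xi => (plexp e xi * cos (dotv xi (x - y) + th))%:E).
  apply: (rintegrable_dominated _ ipl).
    apply: measurable_funM; first exact: measurable_plexp.
    exact: measurable_cos_dotv.
  by move=> xi; rewrite normrM ger0_norm ?plexp_ge0// ler_piMr ?plexp_ge0 ?abs_cos_le1.
have iplc' (c : R) th : L.-integrable setT (fun xi => (c * (plexp e xi * cos (dotv xi (x - y) + th)))%:E).
  exact: rintegrableZl.
rewrite RintegralD; [|exact: measurableT|exact: iplc'|exact: iplc'].
rewrite (RintegralZl _ measurableT (iplc 0)) (RintegralZl _ measurableT (iplc (- (pi / 2)))).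
rewrite /Rintegral !integral_plexp_cos//=.
by rewrite cos0 cosN cos_pihalf; ring.
Qed.

End regularised_parseval.

Local Open Scope complex_scope.

Section sqn.
Context {R : realType}.
Implicit Types z w : R[i].

Definition sqn z : R := complex.Re z ^+ 2 + complex.Im z ^+ 2.

Lemma sqn_ge0 z : 0 <= sqn z. Proof. by rewrite addr_ge0 ?sqr_ge0. Qed.

Lemma sqr_normc z : Normc.normc z ^+ 2 = sqn z.
Proof. by case: z => x y; rewrite /sqn /= sqr_sqrtr// addr_ge0 ?sqr_ge0. Qed.

Lemma normc_sqn z : Normc.normc z = Num.sqrt (sqn z).
Proof. by case: z. Qed.

Lemma abs_Re_le_normc z : `|complex.Re z| <= Normc.normc z.
Proof. by rewrite normc_sqn -sqrtr_sqr ler_sqrt ?sqn_ge0// lerDl sqr_ge0. Qed.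

Lemma abs_Im_le_normc z : `|complex.Im z| <= Normc.normc z.
Proof. by rewrite normc_sqn -sqrtr_sqr ler_sqrt ?sqn_ge0// lerDr sqr_ge0. Qed.

Lemma normc_ge0 z : 0 <= Normc.normc z.
Proof. by rewrite normc_sqn sqrtr_ge0. Qed.

Lemma sqn0 : sqn 0 = 0. Proof. by rewrite /sqn /= expr0n /= addr0. Qed.

Lemma sqnN z : sqn (- z) = sqn z.
Proof. by case: z => x y; rewrite /sqn /= !sqrrN. Qed.

Lemma sqnM z w : sqn (z * w) = sqn z * sqn w.
Proof. by case: z => a b; case: w => c d; rewrite /sqn /=; ring. Qed.

Lemma sqn_real (x : R) : sqn (x%:C) = x ^+ 2.
Proof. by rewrite /sqn /= expr0n /= addr0. Qed.

Lemma sqnD_le t z w : 0 < t -> sqn (z + w) <= (1 + t) * sqn z + (1 + t^-1) * sqn w.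
Proof.
case: z => a b; case: w => c d t0; rewrite /sqn /= -subr_ge0.
rewrite (_ : _ - _ = t^-1 * ((t * a - c) ^+ 2 + (t * b - d) ^+ 2)); last first.
  by field; rewrite gt_eqF.
by rewrite mulr_ge0 ?invr_ge0 ?(ltW t0)// addr_ge0 ?sqr_ge0.
Qed.

Lemma sqnD_le2 z w : sqn (z + w) <= 2 * sqn z + 2 * sqn w.
Proof. by have := sqnD_le z w ltr01; rewrite invr1. Qed.

Lemma sqnB_le2 z w : sqn (z - w) <= 2 * sqn z + 2 * sqn w.
Proof. by rewrite -(sqnN w) sqnD_le2. Qed.

End sqn.

Section complex_measurable.
Context d (T : measurableType d) {R : realType}.
Implicit Types u v : T -> R[i].

(** [cmeasurable] over an arbitrary measurable space, where the L^2 theory below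
    is developed. *)
Definition cmeas u := measurable_fun setT (fun x => complex.Re (u x)) /\
  measurable_fun setT (fun x => complex.Im (u x)).

Lemma measurable_sqn u : cmeas u -> measurable_fun setT (fun x => sqn (u x)).
Proof. by case=> mr mi; apply: measurable_funD; exact: measurable_funX. Qed.

Lemma cmeasN u : cmeas u -> cmeas (fun x => - u x).
Proof.
case=> mr mi; split.
- rewrite (_ : (fun x => _) = fun x => - complex.Re (u x)); last first.
    by apply/funext => x; case: (u x).
  exact: measurableT_comp.
- rewrite (_ : (fun x => _) = fun x => - complex.Im (u x)); last first.
    by apply/funext => x; case: (u x).
  exact: measurableT_comp.
Qed.

Lemma cmeasD u v : cmeas u -> cmeas v -> cmeas (fun x => u x + v x).
Proof.
case=> mr mi [nr ni]; split.
- rewrite (_ : (fun x => _) = fun x => complex.Re (u x) + complex.Re (v x)); last first.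
    by apply/funext => x; case: (u x); case: (v x).
  exact: measurable_funD.
- rewrite (_ : (fun x => _) = fun x => complex.Im (u x) + complex.Im (v x)); last first.
    by apply/funext => x; case: (u x); case: (v x).
  exact: measurable_funD.
Qed.

Lemma cmeasB u v : cmeas u -> cmeas v -> cmeas (fun x => u x - v x).
Proof. by move=> mu mv; apply: cmeasD => //; exact: cmeasN. Qed.

Lemma cmeasM u v : cmeas u -> cmeas v -> cmeas (fun x => u x * v x).
Proof.
case=> mr mi [nr ni]; split.
- rewrite (_ : (fun x => _) = fun x => complex.Re (u x) * complex.Re (v x)
      - complex.Im (u x) * complex.Im (v x)); last first.
    by apply/funext => x; case: (u x); case: (v x).
  by apply: measurable_funB; exact: measurable_funM.
- rewrite (_ : (fun x => _) = fun x => complex.Re (u x) * complex.Im (v x)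
      + complex.Im (u x) * complex.Re (v x)); last first.
    by apply/funext => x; case: (u x); case: (v x).
  by apply: measurable_funD; exact: measurable_funM.
Qed.

Lemma cmeas_cst (c : R[i]) : cmeas (fun=> c).
Proof. by split; exact: measurable_cst. Qed.

Lemma cmeas_real (f : T -> R) : measurable_fun setT f -> cmeas (fun x => (f x)%:C).
Proof. by move=> mf; split => //=; exact: measurable_cst. Qed.

Variable mu : {measure set T -> \bar R}.

Definition L2sq u : \bar R := (\int[mu]_x (sqn (u x))%:E)%E.

Lemma L2sq_ge0 u : (0 <= L2sq u)%E.
Proof. by apply: integral_ge0 => x _; rewrite lee_fin sqn_ge0. Qed.

Lemma integral_EFinD (f g : T -> R) : measurable_fun setT f -> measurable_fun setT g ->
  (forall x, 0 <= f x) -> (forall x, 0 <= g x) ->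
  (\int[mu]_x (f x + g x)%:E = \int[mu]_x (f x)%:E + \int[mu]_x (g x)%:E)%E.
Proof.
move=> mf mg f0 g0; under eq_integral do rewrite EFinD.
rewrite ge0_integralD//; try exact/measurable_EFinP; by move=> x _; rewrite lee_fin.
Qed.

Lemma integral_EFinZ (k : R) (f : T -> R) : measurable_fun setT f -> 0 <= k ->
  (forall x, 0 <= f x) ->
  (\int[mu]_x (k * f x)%:E = k%:E * \int[mu]_x (f x)%:E)%E.
Proof.
move=> mf k0 f0; under eq_integral do rewrite EFinM.
by rewrite ge0_integralZl//; [exact/measurable_EFinP|move=> x _; rewrite lee_fin].
Qed.

Lemma le_integral_EFin (f g : T -> R) : measurable_fun setT f -> measurable_fun setT g ->
  (forall x, 0 <= f x) -> (forall x, f x <= g x) ->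
  (\int[mu]_x (f x)%:E <= \int[mu]_x (g x)%:E)%E.
Proof.
move=> mf mg f0 fg; apply: ge0_le_integral => //.
- by move=> x _; rewrite lee_fin.
- exact/measurable_EFinP.
- exact/measurable_EFinP.
- by move=> x _; rewrite lee_fin.
Qed.

Lemma L2sqD_le t u v : cmeas u -> cmeas v -> 0 < t ->
  (L2sq (fun x => u x + v x)%R <= (1 + t)%:E * L2sq u + (1 + t^-1)%:E * L2sq v)%E.
Proof.
move=> mu' mv t0; have su := measurable_sqn mu'; have sv := measurable_sqn mv.
have ht : 0 <= 1 + t by rewrite addr_ge0 ?(ltW t0).
have hv : 0 <= 1 + t^-1 by rewrite addr_ge0 ?invr_ge0 ?(ltW t0).
rewrite /L2sq -!integral_EFinZ//; try (by move=> x; exact: sqn_ge0).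
rewrite -integral_EFinD; try (by apply: measurable_funM);
  try (by move=> x; rewrite mulr_ge0 ?sqn_ge0).
apply: le_integral_EFin => //.
- exact/measurable_sqn/cmeasD.
- by apply: measurable_funD; exact: measurable_funM.
- by move=> x; exact: sqn_ge0.
- by move=> x; exact: sqnD_le.
Qed.

Lemma L2sqN u : L2sq (fun x => - u x) = L2sq u.
Proof. by apply: eq_integral => x _; rewrite sqnN. Qed.

Lemma L2sqD_le2 u v : cmeas u -> cmeas v ->
  (L2sq (fun x => u x + v x)%R <= 2%:E * L2sq u + 2%:E * L2sq v)%E.
Proof. by move=> mu' mv; have := L2sqD_le mu' mv ltr01; rewrite invr1. Qed.

Lemma L2sqZ (c : R[i]) u : cmeas u -> L2sq (fun x => c * u x)%R = ((sqn c)%:E * L2sq u)%E.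
Proof.
move=> mu'; rewrite /L2sq -integral_EFinZ ?sqn_ge0//.
- by apply: eq_integral => x _; rewrite sqnM.
- exact: measurable_sqn.
- by move=> x; exact: sqn_ge0.
Qed.

Lemma L2sq_le u v : cmeas u -> cmeas v -> (forall x, sqn (u x) <= sqn (v x)) ->
  (L2sq u <= L2sq v)%E.
Proof.
move=> mu' mv uv; apply: le_integral_EFin => //.
- exact: measurable_sqn.
- exact: measurable_sqn.
- by move=> x; exact: sqn_ge0.
Qed.

End complex_measurable.

Section fourier_norm.
Context {R : realType} {n : nat}.
Local Notation E := 'rV[R]_n.
Local Notation L := (@leb R n).
Local Notation re u := (fun x => complex.Re (u x)).
Local Notation im u := (fun x => complex.Im (u x)).

Lemma fourierL1E (u : E -> R[i]) xi : fourierL1 u xi =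
  ((2 * pi) `^ (- (n%:R / 2)))%:C * (four_re (re u) (im u) xi +i* four_im (re u) (im u) xi).
Proof.
rewrite /fourierL1; congr (_ * _); rewrite /Cintegral; congr (_ +i* _);
  apply: eq_Rintegral => x _; rewrite /trig_re /trig_im /expi cosN sinN.
- by case: (u x) => p q /=; ring.
- by case: (u x) => p q /=; ring.
Qed.

Lemma sqn_fourierL1 (u : E -> R[i]) xi : sqn (fourierL1 u xi) =
  ((2 * pi) ^+ n)^-1 * (four_re (re u) (im u) xi ^+ 2 + four_im (re u) (im u) xi ^+ 2).
Proof.
rewrite fourierL1E sqnM sqn_real; congr (_ * _).
have p0 : 0 <= 2 * pi :> R by rewrite mulr_ge0 ?pi_ge0.
rewrite -powR_mulrn ?powR_ge0// -powRrM -powR_mulrn// -powRN; congr (_ `^ _).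
by rewrite mulNr divfK.
Qed.

Lemma measurable_sub2 : measurable_fun setT (fun z : E * E => z.1 - z.2).
Proof.
apply: measurable_fun_rVP => i.
rewrite (_ : _ \o _ = fun z : E * E => z.1 ord0 i - z.2 ord0 i); last first.
  by apply/funext => z; rewrite /= /rV_coord !mxE.
apply: measurable_funB; exact: (measurableT_comp (measurable_coord i)).
Qed.

Variable u : E -> R[i].
Hypothesis mu : cmeas u.
Hypothesis iu : L.-integrable setT (fun x => (complex.Re (u x))%:E).
Hypothesis ju : L.-integrable setT (fun x => (complex.Im (u x))%:E).
Hypothesis u2 : (L2sq L u < +oo)%E.
Variable e : R.
Hypothesis e0 : 0 < e.

Let kc (x y : E) := pcauchy e (x - y).
Let kc0 x y : 0 <= kc x y. Proof. exact: pcauchy_ge0. Qed.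
Let mkc : measurable_fun setT (fun z : E * E => kc z.1 z.2).
Proof. exact: (measurableT_comp (measurable_pcauchy e0) measurable_sub2). Qed.
Let kcC x y : kc x y = kc y x. Proof. by rewrite /kc -pcauchyN opprB. Qed.
Let intkc y : (\int[L]_x (kc x y)%:E = 1)%E. Proof. exact: integral_pcauchy. Qed.

Let p1 (z : E * E) : R := (complex.Re (u z.1) * complex.Re (u z.2) + complex.Im (u z.1) * complex.Im (u z.2)) * kc z.1 z.2.
Let p2 (z : E * E) : R := 2^-1 * sqn (u z.1 - u z.2) * kc z.1 z.2.
Let p3 (z : E * E) : R := 2^-1 * (sqn (u z.1) * kc z.1 z.2) + 2^-1 * (sqn (u z.2) * kc z.1 z.2).

Let m1 : measurable_fun setT (fun z : E * E => sqn (u z.1)).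
Proof. exact: (measurableT_comp (measurable_sqn mu)). Qed.
Let m2 : measurable_fun setT (fun z : E * E => sqn (u z.2)).
Proof. exact: (measurableT_comp (measurable_sqn mu)). Qed.

Let mp1 : measurable_fun setT p1.
Proof.
case: mu => mr mi; apply: measurable_funM => //.
apply: measurable_funD; apply: measurable_funM.
- exact: (measurableT_comp mr).
- exact: (measurableT_comp mr).
- exact: (measurableT_comp mi).
- exact: (measurableT_comp mi).
Qed.

Let p12 z : p1 z + p2 z = p3 z.
Proof.
rewrite /p1 /p2 /p3 /sqn; case: (u z.1) => a b; case: (u z.2) => c d /=.
by field.
Qed.

Let p30 z : 0 <= p3 z.
Proof. by rewrite addr_ge0// mulr_ge0// mulr_ge0 ?sqn_ge0. Qed.

Let p20 z : 0 <= p2 z.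
Proof. by rewrite mulr_ge0// mulr_ge0 ?sqn_ge0. Qed.

Let mp3 : measurable_fun setT p3.
Proof. by apply: measurable_funD; apply: measurable_funM => //; apply: measurable_funM. Qed.

Let mp2 : measurable_fun setT p2.
Proof.
rewrite (_ : p2 = fun z => p3 z - p1 z); first exact: measurable_funB.
by apply/funext => z; rewrite -p12 addrAC subrr add0r.
Qed.

Let int_sqn_kc : (\int[(L \x L)%E]_z (sqn (u z.1) * kc z.1 z.2)%:E = L2sq L u)%E.
Proof.
rewrite fubini_tonelli1//=; last 2 first.
- by apply/measurable_EFinP; exact: measurable_funM.
- by move=> z; rewrite lee_fin mulr_ge0 ?sqn_ge0.
apply: eq_integral => x _; rewrite /fubini_F/=.
rewrite integral_EFinZ ?sqn_ge0//; last first.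
  exact: (measurableT_comp mkc (measurable_pair1 x)).
by under eq_integral do rewrite kcC; rewrite intkc mule1.
Qed.

Let int_sqn_kc2 : (\int[(L \x L)%E]_z (sqn (u z.2) * kc z.1 z.2)%:E = L2sq L u)%E.
Proof.
have mm : measurable_fun setT (fun z : E * E => (sqn (u z.2) * kc z.1 z.2)%:E).
  by apply/measurable_EFinP; exact: measurable_funM.
have m0 (z : E * E) : (0 <= (sqn (u z.2) * kc z.1 z.2)%:E)%E.
  by rewrite lee_fin mulr_ge0 ?sqn_ge0.
rewrite fubini_tonelli1//= /fubini_F (fubini_tonelli _ mm m0)/=.
apply: eq_integral => y _.
rewrite integral_EFinZ ?sqn_ge0//; last first.
  exact: (measurableT_comp mkc (measurable_pair2 y)).
by rewrite intkc mule1.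
Qed.

Let int_p3 : (\int[(L \x L)%E]_z (p3 z)%:E = L2sq L u)%E.
Proof.
have h0 (i : E * E -> E) (z : E * E) : 0 <= sqn (u (i z)) * kc z.1 z.2.
  by rewrite mulr_ge0 ?sqn_ge0.
rewrite integral_EFinD; first last.
- by move=> z; rewrite mulr_ge0// (h0 snd).
- by move=> z; rewrite mulr_ge0// (h0 fst).
- by apply: measurable_funM => //; apply: measurable_funM.
- by apply: measurable_funM => //; apply: measurable_funM.
rewrite !integral_EFinZ//; try (by apply: measurable_funM).
rewrite int_sqn_kc int_sqn_kc2 -ge0_muleDl ?lee_fin// -EFinD.
by rewrite (_ : 2^-1 + 2^-1 = 1 :> R) ?mul1e//; lra.
Qed.

(** From [regularised_four] and the identity
    2 Re (u(x) conj u(y)) = |u(x)|^2 + |u(y)|^2 - |u(x) - u(y)|^2,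
    the kernel having mass 1 in each variable. The functions [p1], [p2], [p3]
    above are the three terms of this identity times half the kernel. *)
Lemma regularised_parseval :
  (\int[L]_xi (plexp e xi * sqn (fourierL1 u xi))%:E +
   \int[L]_x \int[L]_y (2^-1 * sqn (u x - u y) * pcauchy e (x - y))%:E = L2sq L u)%E.
Proof.
have ip3 : (L \x L)%E.-integrable setT (EFin \o p3).
  apply/integrableP; split; first exact/measurable_EFinP.
  by under eq_integral do rewrite /= ger0_norm//; rewrite int_p3.
have ip2 : (L \x L)%E.-integrable setT (EFin \o p2).
  apply: (rintegrable_dominated mp2 (rintegrableZl 2 ip3)) => z.
  rewrite ger0_norm// /p2 /p3 -!mulrDr -mulrDl !mulrA ler_wpM2r//.
  rewrite mulfV// mul1r ler_pdivrMl// mulrDr; exact: sqnB_le2.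
have ip1 : (L \x L)%E.-integrable setT (EFin \o p1).
  have := rintegrableB ip3 ip2; apply: eq_integrable => // z _ /=.
  by rewrite -p12 addrK.
transitivity (\int[(L \x L)%E]_z (p1 z)%:E + \int[(L \x L)%E]_z (p2 z)%:E)%E; last first.
  rewrite -int_p3 -integralD//; apply: eq_integral => z _.
  by rewrite /= -EFinD p12.
congr (_ + _)%E; last first.
  by rewrite [RHS]fubini_tonelli1//; exact/measurable_EFinP.
have cpos : 0 < (2 * pi) ^+ n :> R by rewrite exprn_gt0// mulr_gt0 ?pi_gt0.
transitivity ((((2 * pi) ^+ n)^-1)%:E * \int[L]_xi (plexp e xi *
   (four_re (re u) (im u) xi ^+ 2 + four_im (re u) (im u) xi ^+ 2))%:E)%E.
  rewrite -integral_EFinZ//.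
  - by apply: eq_integral => xi _; rewrite sqn_fourierL1; congr (_%:E); ring.
  - apply: measurable_funM; first exact: measurable_plexp.
    by apply: measurable_funD; apply: measurable_funX;
      [exact: measurable_four_re|exact: measurable_four_im].
  - by rewrite invr_ge0 ltW.
  - by move=> xi; rewrite mulr_ge0 ?plexp_ge0// addr_ge0 ?sqr_ge0.
have kcb x y : kc x y <= ((2 * pi) ^+ n)^-1 * (2 / e) ^+ n.
  by rewrite ler_pdivlMl// pcauchy_le.
pose g x : R := `|complex.Re (u x)| + `|complex.Im (u x)|.
have ig : L.-integrable setT (EFin \o g).
  by apply: rintegrableD; apply: integrable_norm.
have ip1x x : L.-integrable setT (fun y => (p1 (x, y))%:E).
  apply: (rintegrable_dominated _ (rintegrableZl (((2 * pi) ^+ n)^-1 * (2 / e) ^+ n * g x) ig)).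
    exact: (measurableT_comp mp1 (measurable_pair1 x)).
  move=> y; rewrite /p1/= normrM (ger0_norm (kc0 _ _)) mulrC -(mulrA _ (g x)) ler_pM//.
  rewrite (le_trans (ler_normD _ _))// !normrM /g mulrDl !mulrDr.
  by rewrite lerD// ?lerDl ?lerDr ?mulr_ge0.
rewrite regularised_four// -integral12_prod_meas1//=.
under [X in (_ * X)%E]eq_integral => x _.
  rewrite RintegralZl//; last exact: ip1x.
  rewrite EFinM; over.
rewrite /=.
rewrite integralZl//; last first.
  have := integrable_fubini_F ip1; apply: eq_integrable => // x _ /=.
  by rewrite /fubini_F fineK// integrable_fin_num//; exact: ip1x.
rewrite muleA -EFinM mulVf ?gt_eqF// mul1e.
apply: eq_integral => x _.
by rewrite fineK// integrable_fin_num//; exact: ip1x.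
Qed.

End fourier_norm.

(** * Vanishing of the modulus of continuity in mean square *)

Section vanishing.
Context {R : realType}.
Implicit Types u v : nat -> \bar R.

Lemma cvge0P u : (forall n, (0 <= u n)%E) ->
  (u n @[n --> \oo] --> 0%E) <->
  (forall eta : R, 0 < eta -> \forall n \near \oo, (u n <= eta%:E)%E).
Proof.
move=> u0; split.
  move=> /fine_cvgP[ufin /cvgrPdist_le u_0] eta eta0.
  near=> n; have fn : u n \is a fin_num by near: n.
  rewrite -(fineK fn) lee_fin.
  have : `|0 - fine (u n)| <= eta by near: n; exact: u_0.
  by rewrite sub0r normrN ger0_norm// fine_ge0.
move=> h; apply/fine_cvgP; split.
  have := h _ ltr01; apply: filterS => n un1.
  by rewrite ge0_fin_numE// (le_lt_trans un1)// ltry.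
apply/cvgrPdist_le => eta eta0; have := h _ eta0; apply: filterS => n un.
rewrite sub0r normrN ger0_norm ?fine_ge0// -lee_fin fineK//.
by rewrite ge0_fin_numE// (le_lt_trans un)// ltry.
Unshelve. all: by end_near. Qed.

Lemma cvge0_le u v : (forall n, (0 <= u n)%E) -> (forall n, (u n <= v n)%E) ->
  v n @[n --> \oo] --> 0%E -> u n @[n --> \oo] --> 0%E.
Proof.
move=> u0 uv v_0; apply: (@squeeze_cvge _ _ _ _ (cst 0%E) _ v) => //; last exact: cvg_cst.
by apply: nearW => n; rewrite u0 uv.
Qed.

Lemma cvge0D u v : u n @[n --> \oo] --> 0%E -> v n @[n --> \oo] --> 0%E ->
  (u n + v n)%E @[n --> \oo] --> 0%E.
Proof. by move=> ? ?; rewrite -[0%E in X in _ --> X](adde0 0%E); apply: cvgeD. Qed.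

Lemma cvge0Z (c : R) u : u n @[n --> \oo] --> 0%E -> (c%:E * u n)%E @[n --> \oo] --> 0%E.
Proof. by move=> ?; rewrite -[0%E in X in _ --> X](mule0 c%:E); apply: cvgeZl. Qed.

Lemma cvge0_approx u : (forall n, (0 <= u n)%E) ->
  (forall eta : R, 0 < eta -> exists2 v : nat -> \bar R,
     v n @[n --> \oo] --> 0%E & forall n, (u n <= v n + eta%:E)%E) ->
  u n @[n --> \oo] --> 0%E.
Proof.
move=> u0 h; apply/cvge0P => // eta eta0.
have eta2 : 0 < eta / 2 by rewrite divr_gt0.
have [v v_0 uv] := h _ eta2.
have /fine_cvgP[vfin /cvgrPdist_le/(_ _ eta2) v0] := v_0.
near=> n; have fn : v n \is a fin_num by near: n.
rewrite (le_trans (uv n))// [in leRHS](splitr eta) EFinD leeD2r// -(fineK fn) lee_fin.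
rewrite (le_trans (ler_norm _))// -normrN -sub0r.
by near: n.
Unshelve. all: by end_near. Qed.

Lemma cvg_invS : (n.+1%:R^-1 : R) @[n --> \oo] --> (0 : R).
Proof. exact: cvg_harmonic. Qed.

Lemma cvge_near (u : nat -> \bar R) (A : \bar R) : A \is a fin_num ->
  (forall k, (0 <= u k)%E) ->
  (forall eta : R, 0 < eta ->
     \forall k \near \oo, (u k <= A + eta%:E)%E /\ (A <= u k + eta%:E)%E) ->
  u k @[k --> \oo] --> A.
Proof.
move=> Afin u0 h; rewrite -[X in _ --> X](fineK Afin).
have ufin k eta : (u k <= A + eta%:E)%E -> u k \is a fin_num.
  by move=> hk; rewrite ge0_fin_numE// (le_lt_trans hk)// -(fineK Afin) -EFinD ltry.
apply/fine_cvgP; split.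
  by have := h _ ltr01; apply: filterS => k [/ufin].
apply/cvgrPdist_le => eta eta0; have := h _ eta0; apply: filterS => k [h1 h2].
have fk := ufin _ _ h1; move: h1 h2.
rewrite /= -(fineK Afin) -(fineK fk) -!EFinD !lee_fin => h1 h2.
by rewrite ler_norml /=; lra.
Qed.

End vanishing.

Section dominated.
Context d (T : measurableType d) {R : realType} (mu : {measure set T -> \bar R}).

Lemma dominated_cvg0 (f : nat -> T -> R) (g : T -> R) :
  (forall k, measurable_fun setT (f k)) -> measurable_fun setT g ->
  (forall k x, 0 <= f k x) -> (forall k x, f k x <= g x) ->
  (\int[mu]_x (g x)%:E < +oo)%E -> (forall x, f k x @[k --> \oo] --> (0 : R)) ->
  (\int[mu]_x (f k x)%:E)%E @[k --> \oo] --> 0%E.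
Proof.
move=> mf mg f0 fg ig fx.
have g0 x : 0 <= g x by rewrite (le_trans (f0 0%N x)).
rewrite [X in _ --> X](_ : _ = \int[mu]_x (cst 0%E x))%E; last by rewrite integral0.
apply: (@dominated_cvg _ _ _ _ _ measurableT _ _ (EFin \o g)) => //.
- by move=> k; apply/measurable_EFinP; exact: mf.
- by move=> x _; apply: cvg_EFin; [exact: nearW|exact: fx].
- apply/integrableP; split; first exact/measurable_EFinP.
  by under eq_integral do rewrite /= ger0_norm//.
- by move=> k x _; rewrite /= lee_fin ger0_norm.
Qed.

End dominated.

Lemma integral_prod_swap d (T : measurableType d) {R : realType}
    (m : {sigma_finite_measure set T -> \bar R}) (f : T * T -> R) :
  measurable_fun setT f -> (forall z, 0 <= f z) ->
  (\int[(m \x m)%E]_z (f (z.2, z.1))%:E = \int[(m \x m)%E]_z (f z)%:E)%E.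
Proof.
move=> mf f0.
have mf' : measurable_fun setT (fun z : T * T => f (z.2, z.1)).
  by apply: (measurableT_comp mf); exact: measurable_fun_pair.
have mE : measurable_fun setT (EFin \o f) by exact/measurable_EFinP.
have f0E z : (0 <= (EFin \o f) z)%E by rewrite lee_fin.
have e1 := fubini_tonelli1 _ mE f0E; have e2 := fubini_tonelli _ mE f0E.
rewrite fubini_tonelli1; last 2 first.
- exact/measurable_EFinP.
- by move=> z; rewrite lee_fin.
by apply: (etrans _ (esym (etrans (e1 m m) (e2 m m)))).
Qed.

Lemma measurable_gap {R : realType} {n : nat} (i : 'I_n) (d : R) :
  measurable_fun setT
    (fun z : 'rV[R]_n * 'rV[R]_n => (d < `|z.1 ord0 i - z.2 ord0 i|)%R%:R : R).
Proof.
apply: (measurableT_comp (f := fun b : bool => b%:R : R)) => //.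
apply: measurable_fun_ltr => //; apply: measurableT_comp => //.
by apply: measurable_funB; exact: (measurableT_comp (measurable_coord i)).
Qed.

Section concentration.
Context {R : realType} {n : nat}.
Local Notation E := 'rV[R]_n.
Local Notation L := (@leb R n).
Local Notation LL := (L \x L)%E.

Variable K : set E.
Hypothesis mK : measurable K.
Hypothesis Kfin : (L K < +oo)%E.

Let ep (m : nat) : R := m.+1%:R^-1.
Let ep0 m : 0 < ep m. Proof. by rewrite invr_gt0. Qed.

Let ka m (z : E * E) : R := \1_K z.1 * \1_K z.2 * pcauchy (ep m) (z.1 - z.2).

Let ka0 m z : 0 <= ka m z.
Proof. by rewrite mulr_ge0 ?pcauchy_ge0. Qed.

Let mpc m : measurable_fun setT (fun z : E * E => pcauchy (ep m) (z.1 - z.2)).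
Proof. exact: (measurableT_comp (measurable_pcauchy (ep0 m)) measurable_sub2). Qed.

Let mka m : measurable_fun setT (ka m).
Proof.
apply: measurable_funM => //; apply: measurable_funM.
- by apply: measurableT_comp => //; exact: measurable_indic.
- by apply: measurableT_comp => //; exact: measurable_indic.
Qed.

(** The cut-off to [K * K], of finite measure, lets the measures of decreasing
    sets with empty intersection tend to 0, also when the sets arise from
    complements. *)
Definition kernel_mass (h : E * E -> R) m : \bar R := (\int[LL]_z (h z * ka m z)%:E)%E.

Definition kernel_null (h : E * E -> R) := kernel_mass h m @[m --> \oo] --> 0%E.

Implicit Types (h : E * E -> R) (m : nat) (c : R).
Local Notation pos h := (forall z, 0 <= h z).
Local Notation meas h := (measurable_fun setT h).

Lemma kernel_mass_ge0 h m : pos h -> (0 <= kernel_mass h m)%E.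
Proof. by move=> h0; apply: integral_ge0 => z _; rewrite lee_fin mulr_ge0. Qed.

Lemma kernel_mass_le h h' m : meas h -> meas h' -> pos h -> (forall z, h z <= h' z) ->
  (kernel_mass h m <= kernel_mass h' m)%E.
Proof.
move=> mh mh' h0 hh'; apply: le_integral_EFin.
- exact: measurable_funM.
- exact: measurable_funM.
- by move=> z; rewrite mulr_ge0.
- by move=> z; rewrite ler_wpM2r.
Qed.

Lemma kernel_massD h h' m : meas h -> meas h' -> pos h -> pos h' ->
  kernel_mass (fun z => h z + h' z) m = (kernel_mass h m + kernel_mass h' m)%E.
Proof.
move=> mh mh' h0 h'0; rewrite /kernel_mass -integral_EFinD.
- by apply: eq_integral => z _; rewrite mulrDl.
- exact: measurable_funM.
- exact: measurable_funM.
- by move=> z; rewrite mulr_ge0.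
- by move=> z; rewrite mulr_ge0.
Qed.

Lemma kernel_massZ c h m : meas h -> 0 <= c -> pos h ->
  kernel_mass (fun z => c * h z) m = (c%:E * kernel_mass h m)%E.
Proof.
move=> mh c0 h0; rewrite /kernel_mass -integral_EFinZ//.
- by apply: eq_integral => z _; rewrite mulrA.
- exact: measurable_funM.
- by move=> z; rewrite mulr_ge0.
Qed.

Lemma intpc m y : (\int[L]_x (pcauchy (ep m) (x - y))%:E = 1)%E.
Proof. exact: integral_pcauchy. Qed.

Lemma kernel_mass_fst (f : E -> R) m : measurable_fun setT f -> (forall x, 0 <= f x) ->
  (kernel_mass (fun z => f z.1) m <= \int[L]_x (\1_K x * f x)%:E)%E.
Proof.
move=> mf f0; rewrite /kernel_mass fubini_tonelli1; last 2 first.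
- apply/measurable_EFinP; apply: measurable_funM => //.
  exact: (measurableT_comp mf).
- by move=> z; rewrite lee_fin mulr_ge0.
have mx x : measurable_fun setT (fun y : E => pcauchy (ep m) (x - y)).
  exact: (measurableT_comp (mpc m) (measurable_pair1 x)).
apply: ge0_le_integral => //.
- by move=> x _; apply: integral_ge0 => y _; rewrite lee_fin mulr_ge0.
- apply: measurable_fun_fubini_tonelli_F => //.
  + by apply/measurable_EFinP; apply: measurable_funM => //; exact: (measurableT_comp mf).
  + by move=> z; rewrite lee_fin mulr_ge0.
- by apply/measurable_EFinP; apply: measurable_funM => //; exact: measurable_indic.
move=> x _; rewrite /fubini_F/=.
apply: (@le_trans _ _ (\int[L]_y (\1_K x * f x * pcauchy (ep m) (x - y))%:E)%E).
  apply: le_integral_EFin.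
  - apply: measurable_funM => //; exact: (measurableT_comp (mka m) (measurable_pair1 x)).
  - exact: measurable_funM.
  - by move=> y; rewrite mulr_ge0.
  - move=> y; rewrite /ka/= !mulrA (mulrC (f x)) ler_wpM2r ?pcauchy_ge0//.
    by rewrite ler_piMr ?mulr_ge0// indicE; case: (_ \in _).
rewrite integral_EFinZ//; last 2 first.
- by rewrite mulr_ge0.
- by move=> y; rewrite pcauchy_ge0.
under eq_integral do rewrite -pcauchyN opprB.
by rewrite intpc mule1.
Qed.

Let kaC m x y : ka m (x, y) = ka m (y, x).
Proof. by rewrite /ka/= -(pcauchyN _ (x - y)) opprB (mulrC (\1_K x)). Qed.

Lemma kernel_mass_swap (h : E * E -> R) m : meas h -> pos h ->
  kernel_mass (fun z => h (z.2, z.1)) m = kernel_mass h m.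
Proof.
move=> mh h0.
rewrite /kernel_mass -(@integral_prod_swap _ _ _ L (fun z => h z * ka m z)).
- by apply: eq_integral => -[x y] _ /=; rewrite kaC.
- exact: measurable_funM.
- by move=> z; rewrite mulr_ge0.
Qed.

Lemma kernel_mass_snd (f : E -> R) m : measurable_fun setT f -> (forall x, 0 <= f x) ->
  (kernel_mass (fun z => f z.2) m <= \int[L]_x (\1_K x * f x)%:E)%E.
Proof.
move=> mf f0; rewrite (@kernel_mass_swap (fun z => f z.1))//; first exact: kernel_mass_fst.
exact: (measurableT_comp mf).
Qed.

Lemma kernel_null_le h h' : meas h -> meas h' -> pos h -> (forall z, h z <= h' z) ->
  kernel_null h' -> kernel_null h.
Proof.
move=> mh mh' h0 hh'; apply: cvge0_le => m; first exact: kernel_mass_ge0.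
exact: kernel_mass_le.
Qed.

Lemma kernel_nullD h h' : meas h -> meas h' -> pos h -> pos h' -> kernel_null h -> kernel_null h' ->
  kernel_null (fun z => h z + h' z).
Proof.
move=> mh mh' h0 h'0 nh nh'; rewrite /kernel_null.
by under eq_fun do rewrite kernel_massD//; exact: cvge0D.
Qed.

Lemma kernel_nullZ c h : meas h -> 0 <= c -> pos h -> kernel_null h -> kernel_null (fun z => c * h z).
Proof.
by move=> mh c0 h0 nh; rewrite /kernel_null; under eq_fun do rewrite kernel_massZ//; exact: cvge0Z.
Qed.

Lemma kernel_null_sum (I : Type) (s : seq I) (h : I -> E * E -> R) :
  (forall i, meas (h i)) -> (forall i, pos (h i)) -> (forall i, kernel_null (h i)) ->
  kernel_null (fun z => \sum_(i <- s) h i z).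
Proof.
move=> mh h0 nh; elim: s => [|i s IH].
  rewrite /kernel_null /kernel_mass; under eq_fun do under eq_integral do rewrite big_nil mul0r.
  by under eq_fun do rewrite integral0; exact: cvg_cst.
under [X in kernel_null X]eq_fun do rewrite big_cons.
apply: kernel_nullD => //.
- exact: measurable_sum.
- by move=> z; apply: sumr_ge0.
Qed.

Let dist_set (A : set E) (z : E * E) : R := `|\1_A z.1 - \1_A z.2|.

Let mfst (A : set E) : measurable A -> meas (fun z : E * E => \1_A z.1 : R).
Proof. by move=> mA; apply: measurableT_comp => //; exact: measurable_indic. Qed.

Let msnd (A : set E) : measurable A -> meas (fun z : E * E => \1_A z.2 : R).
Proof. by move=> mA; apply: measurableT_comp => //; exact: measurable_indic. Qed.

Let mdist (A : set E) : measurable A -> meas (dist_set A).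
Proof.
by move=> mA; apply: measurableT_comp => //; apply: measurable_funB; [exact: mfst|exact: msnd].
Qed.

Let dist0 A : pos (dist_set A). Proof. by move=> z; exact: normr_ge0. Qed.

Definition regular_set (A : set E) := measurable A /\ kernel_null (dist_set A).

Lemma kernel_mass_indic1 (A : set E) m : measurable A ->
  (kernel_mass (fun z => \1_A z.1 + \1_A z.2)%R m <= 2%:E * L (K `&` A))%E.
Proof.
move=> mA; have i0 (f : E * E -> E) z : 0 <= \1_A (f z) :> R by [].
rewrite kernel_massD//; [|exact: mfst|exact: msnd].
have e1 : (\int[L]_x (\1_K x * \1_A x)%:E = L (K `&` A))%E.
  under eq_integral do rewrite -[_ * _]/((\1_K \* \1_A) _) -indicI.
  by rewrite integral_indic ?setIT//; exact: measurableI.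
rewrite (_ : 2%:E = 1 + 1)%E; last by rewrite -EFinD.
rewrite ge0_muleDl// !mul1e -e1; apply: leeD.
- by apply: kernel_mass_fst => //; exact: measurable_indic.
- by apply: kernel_mass_snd => //; exact: measurable_indic.
Qed.

Lemma regular_set0 : regular_set set0.
Proof.
split => //; rewrite /kernel_null /kernel_mass /dist_set.
under eq_fun do under eq_integral do rewrite !indic0 subrr normr0 mul0r.
by under eq_fun do rewrite integral0; exact: cvg_cst.
Qed.

Lemma regular_setC A : regular_set A -> regular_set (~` A).
Proof.
case=> mA nA; split; first exact: measurableC.
rewrite (_ : dist_set _ = dist_set A)//; apply/funext => z.
rewrite /dist_set !indicE !in_setC -normrN.
by congr `|_|; case: (_ \in A); case: (_ \in A); rewrite /=; ring.
Qed.

Let in_indic (A : set E) x : (\1_A x : R) = (x \in A)%:R. Proof. by []. Qed.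

Let dist_set_le A h z : 0 <= h z -> (A z.1 -> ~ A z.2 -> 1 <= h z) ->
  (~ A z.1 -> A z.2 -> 1 <= h z) -> dist_set A z <= h z.
Proof.
move=> h0 h1 h2; rewrite /dist_set !in_indic.
case: (asboolP (A z.1)) => a1; case: (asboolP (A z.2)) => a2.
- by rewrite !mem_set// subrr normr0.
- by rewrite mem_set// memNset// subr0 normr1 h1.
- by rewrite memNset// mem_set// sub0r normrN normr1 h2.
- by rewrite !memNset// subrr normr0.
Qed.

Let dist_set1 A x y : A x -> ~ A y -> dist_set A (x, y) = 1.
Proof. by move=> ax ay; rewrite /dist_set !in_indic/= mem_set// memNset// subr0 normr1. Qed.

Let dist_setC A x y : dist_set A (x, y) = dist_set A (y, x).
Proof. by rewrite /dist_set/= distrC. Qed.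

(** [h] accounts for the pairs separated by [A] whose point in [A] lies outside
    [B k]. The remaining pairs have mass at most twice the measure of [K] meets
    [B k], by [kernel_mass_indic1], and this tends to 0. *)
Lemma regular_approx (A : set E) (B : (set E)^nat) : measurable A ->
  (forall k, measurable (B k)) -> {homo B : k l / (k <= l)%N >-> l `<=` k} ->
  \bigcap_k B k = set0 ->
  (forall k, exists h : E * E -> R,
     [/\ meas h, pos h, forall x y, h (x, y) = h (y, x), kernel_null h &
      forall x y, A x -> ~ A y -> 1 <= h (x, y) + \1_(B k) x]) ->
  regular_set A.
Proof.
move=> mA mB decB B0 hB; split => //.
apply: cvge0_approx => [m|eta eta0]; first exact: kernel_mass_ge0.
have eta2 : 0 < eta / 2 by rewrite divr_gt0.
have LB : (L (K `&` B k))%E @[k --> \oo] --> 0%E.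
  have -> : 0%E = L (\bigcap_k (K `&` B k)).
    by rewrite bigcapIr// B0 setI0 measure0.
  apply: nonincreasing_cvg_mu.
  - apply: (le_lt_trans _ Kfin); apply: le_measure; rewrite ?inE;
      [exact: measurableI|exact: mK|exact: subIsetl].
  - by move=> k; exact: measurableI.
  - by apply: bigcap_measurable => // k _; exact: measurableI.
  - by move=> k l kl; apply/subsetPset; apply: setIS; exact: decB.
have [k _ /(_ _ (leqnn k)) hk] := (cvge0P (fun k => measure_ge0 _ _)).1 LB _ eta2.
have [h [mh h0 hC nh key]] := hB k.
exists (kernel_mass h) => // m.
have mi : meas (fun z : E * E => \1_(B k) z.1 + \1_(B k) z.2 : R).
  by apply: measurable_funD; [exact: mfst|exact: msnd].
have i0 : pos (fun z : E * E => \1_(B k) z.1 + \1_(B k) z.2 : R).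
  by move=> z; rewrite addr_ge0.
apply: (@le_trans _ _ (kernel_mass h m + kernel_mass (fun z => \1_(B k) z.1 + \1_(B k) z.2)%R m)%E); last first.
  rewrite leeD2l// (le_trans (kernel_mass_indic1 _ (mB k)))//.
  by rewrite (le_trans (lee_wpmul2l _ hk))// -EFinM mulrC divfK.
rewrite -kernel_massD//; apply: kernel_mass_le => //.
- exact: mdist.
- exact: measurable_funD.
move=> z; apply: (@dist_set_le A (fun z => h z + (\1_(B k) z.1 + \1_(B k) z.2))).
- by rewrite addr_ge0 ?i0.
- by case: z => x y /= Ax Ay; rewrite addrA (le_trans (key _ _ Ax Ay))// lerDl.
- by case: z => x y /= Ax Ay; rewrite addrCA hC (le_trans (key _ _ Ay Ax))// lerDr.
Qed.

Lemma regular_bigcup (F : (set E)^nat) : (forall k, regular_set (F k)) ->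
  regular_set (\bigcup_k F k).
Proof.
move=> rF; have mF k := (rF k).1.
pose Ak k := \bigcup_(j < k) F j.
have mAk k : measurable (Ak k) by apply: bigcup_measurable => j _.
have mA : measurable (\bigcup_k F k) by exact: bigcupT_measurable.
apply: (regular_approx (B := fun k => \bigcup_k F k `\` Ak k)) => //.
- by move=> k; exact: measurableD.
- by move=> k l kl; apply: setDS => x [j /= jk Fj]; exists j => //=; exact: leq_trans kl.
- apply/seteqP; split => // x h; have [[j _ Fj] _] := h 0%N I.
  by have [_] := h j.+1 I; apply; exists j => /=.
move=> k; pose s := iota 0 k.
have s0 : pos (fun z => \sum_(j <- s) dist_set (F j) z) by move=> z; apply: sumr_ge0.
exists (fun z => \sum_(j <- s) dist_set (F j) z); split => //.
- by apply: measurable_sum => j; exact: mdist.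
- by move=> x y; apply: eq_bigr => j _; exact: dist_setC.
- by apply: kernel_null_sum => [j|j|j]; [exact: mdist|exact: dist0|exact: (rF j).2].
move=> x y Ax Ay; case: (asboolP (Ak k x)) => [[j /= jk Fjx]|Akx].
  rewrite -[leLHS]addr0 lerD//; have js : j \in s by rewrite mem_iota.
  rewrite (bigD1_seq j) ?iota_uniq//= dist_set1//; last by move=> Fy; apply: Ay; exists j.
  by rewrite lerDl sumr_ge0.
by rewrite in_indic mem_set ?lerDr ?s0//; split.
Qed.

Let tail_factor (d : R) := 1 + (d ^+ 2)^-1.

Lemma cauchy_tail (d e t : R) : 0 < d -> 0 < e -> d < `|t| ->
  cauchy_pdf e t <= e * tail_factor d * cauchy_pdf 1 t.
Proof.
move=> d0 e0 dt; rewrite /cauchy_pdf /tail_factor expr1n.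
have t20 : d ^+ 2 < t ^+ 2 by rewrite -(real_normK (num_real t)) ltrXn2r// ltW.
have d20 : 0 < d ^+ 2 by rewrite exprn_gt0.
move: (pi) (@pi_gt0 R) => p p0.
have D1 := sqrD_gt0 t e0.
have D2 : 0 < 1 + t ^+ 2 by rewrite ltr_pwDl// sqr_ge0.
rewrite ler_pdivrMr ?mulr_gt0//.
rewrite [leRHS](_ : _ = e * ((1 + (d ^+ 2)^-1) * (e ^+ 2 + t ^+ 2) / (1 + t ^+ 2))); last first.
  by field; rewrite !gt_eqF.
rewrite -[leLHS]mulr1 ler_wpM2l ?(ltW e0)// ler_pdivlMr// mul1r.
rewrite (@le_trans _ _ ((1 + (d ^+ 2)^-1) * t ^+ 2))//.
  by rewrite mulrDl mul1r addrC lerD2l mulrC ler_pdivlMr// mul1r ltW.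
by rewrite ler_wpM2l ?addr_ge0 ?invr_ge0 ?(ltW d20)// lerDr sqr_ge0.
Qed.

(** Where the [i]-th coordinates differ by more than [d], the [i]-th factor is at
    most [e * tail_factor d] times [cauchy_pdf 1], which again has mass 1. *)
Lemma integral_pcauchy_tail (d e : R) (y : E) i : 0 < d -> 0 < e ->
  (\int[L]_x ((d < `|x ord0 i - y ord0 i|)%R%:R * pcauchy e (x - y))%:E
    <= (e * tail_factor d)%:E)%E.
Proof.
move=> d0 e0.
have c0 : 0 <= e * tail_factor d.
  by rewrite mulr_ge0 ?(ltW e0)// addr_ge0// invr_ge0 sqr_ge0.
pose g (k : 'I_n) (t : R) := cauchy_pdf (if k == i then 1 else e) (t - y ord0 k).
have ek k : 0 < (if k == i then 1 else e) :> R by case: ifP.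
have mg : measurable_fun setT (fun x : E => \prod_k g k (x ord0 k)).
  apply: measurable_prod_coord => k.
  by apply: continuous_measurable_fun; exact: continuous_cauchy.
have g0 k t : 0 <= g k t by exact: cauchy_ge0.
apply: (@le_trans _ _ (\int[L]_x (e * tail_factor d * \prod_k g k (x ord0 k))%:E)%E).
  apply: le_integral_EFin.
  - apply: measurable_funM.
      exact: (measurableT_comp (measurable_gap i d) (measurable_pair2 y)).
    exact: (measurableT_comp (measurableT_comp (measurable_pcauchy e0) measurable_sub2)
      (measurable_pair2 y)).
  - exact: measurable_funM.
  - by move=> x; rewrite mulr_ge0 ?pcauchy_ge0.
  - move=> x; case: ltP => [dx|_]; last by rewrite mul0r mulr_ge0 ?prodr_ge0.
    rewrite mul1r /pcauchy (bigD1 i)//= (bigD1 i (F := fun k => g k (x ord0 k)))//= mulrA ler_pM//.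
    + exact: cauchy_ge0.
    + by apply: prodr_ge0 => k _; exact: cauchy_ge0.
    + rewrite /g eqxx !mxE; exact: cauchy_tail.
    + by apply: ler_prod => k ki; rewrite cauchy_ge0//= /g (negbTE ki) !mxE.
rewrite integral_EFinZ//; last by move=> x; exact: prodr_ge0.
rewrite (integral_leb_prod (c := fun=> 1)).
- by rewrite prodr_const expr1n mule1.
- by move=> k; apply: continuous_measurable_fun; exact: continuous_cauchy.
- by [].
- by move=> k; exact: integral_cauchy.
Qed.

Let inv_ep_cvg (c : R) : (ep m * c)%:E @[m --> \oo] --> 0%E.
Proof.
apply: cvg_EFin; first by apply: nearW.
have h : (ep m * c) @[m --> \oo] --> 0 * c.
  by apply: cvgM; [exact: cvg_invS|exact: cvg_cst].
by rewrite mul0r in h.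
Qed.

Lemma kernel_null_tail d i : 0 < d -> kernel_null (fun z => (d < `|z.1 ord0 i - z.2 ord0 i|)%R%:R).
Proof.
move=> d0.
have mt := @measurable_gap R n i d.
have mt2 : meas (fun z : E * E => (d < `|z.2 ord0 i - z.1 ord0 i|)%R%:R : R).
  by under eq_fun do rewrite distrC.
have LK : L K \is a fin_num by rewrite ge0_fin_numE.
have le1 m : (kernel_mass (fun z => (d < `|z.1 ord0 i - z.2 ord0 i|)%R%:R) m <=
    L K * (ep m * tail_factor d)%:E)%E.
  have t0 : 0 <= ep m * tail_factor d.
    by rewrite mulr_ge0 ?(ltW (ep0 m))// addr_ge0// invr_ge0 sqr_ge0.
  rewrite -(kernel_mass_swap _ mt)// /kernel_mass fubini_tonelli1; last 2 first.
  - apply/measurable_EFinP; exact: measurable_funM.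
  - by move=> z; rewrite lee_fin mulr_ge0.
  apply: (@le_trans _ _ (\int[L]_x ((\1_K x)%:E * (ep m * tail_factor d)%:E))%E).
    apply: ge0_le_integral => //.
    - by move=> x _; apply: integral_ge0 => y _; rewrite lee_fin mulr_ge0.
    - apply: measurable_fun_fubini_tonelli_F => //.
      + apply/measurable_EFinP; exact: measurable_funM.
      + by move=> z; rewrite lee_fin mulr_ge0.
    - by apply: emeasurable_funM => //; apply/measurable_EFinP; exact: measurable_indic.
    move=> x _; rewrite /fubini_F/=.
    apply: (@le_trans _ _ (\int[L]_y (\1_K x * ((d < `|y ord0 i - x ord0 i|)%R%:R * pcauchy (ep m) (y - x)))%:E)%E).
      have my : measurable_fun setT (fun y : E => (d < `|y ord0 i - x ord0 i|)%R%:R : R).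
        exact: (measurableT_comp mt (measurable_pair2 x)).
      apply: le_integral_EFin.
      - apply: measurable_funM => //; exact: (measurableT_comp (mka m) (measurable_pair1 x)).
      - apply: measurable_funM => //; apply: measurable_funM => //.
        exact: (measurableT_comp (mpc m) (measurable_pair2 x)).
      - by move=> y; rewrite mulr_ge0.
      - move=> y; rewrite kaC /ka/= [leLHS](_ : _ = \1_K y * (\1_K x *
          ((d < `|y ord0 i - x ord0 i|)%R%:R * pcauchy (ep m) (y - x)))); last by ring.
        apply: ler_piMl; last by rewrite in_indic lern1 leq_b1.
        by apply: mulr_ge0 => //; apply: mulr_ge0 => //; exact: pcauchy_ge0.
    rewrite integral_EFinZ//; last 2 first.
    - apply: measurable_funM; first exact: (measurableT_comp mt (measurable_pair2 x)).
      exact: (measurableT_comp (mpc m) (measurable_pair2 x)).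
    - by move=> y; rewrite mulr_ge0 ?pcauchy_ge0.
    by rewrite lee_wpmul2l// integral_pcauchy_tail.
  rewrite ge0_integralZr//; last by apply/measurable_EFinP; exact: measurable_indic.
  by rewrite integral_indic// setIT.
have h0 : pos (fun z : E * E => (d < `|z.1 ord0 i - z.2 ord0 i|)%R%:R).
  by move=> z.
apply: (cvge0_le _ le1) => [m|]; first exact: kernel_mass_ge0.
rewrite -(fineK LK); apply: cvge0Z; exact: inv_ep_cvg.
Qed.

(** A point of the half-space outside the slab of width [1 / (k + 1)] along its
    boundary differs from every point of the complement by more than that width
    in the [i]-th coordinate, so [kernel_null_tail] applies. *)
Lemma regular_halfspace i (a : R) : regular_set [set x | x ord0 i < a].
Proof.
have mcoord (B : set R) : measurable B -> measurable ((fun x : E => x ord0 i) @^-1` B).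
  by move=> mB; rewrite -[X in measurable X]setTI; exact: measurable_coord.
have mA : measurable [set x : E | x ord0 i < a].
  rewrite (_ : [set x | _] = (fun x : E => x ord0 i) @^-1` `]-oo, a[%classic); first exact: mcoord.
  by apply/seteqP; split => x /=; rewrite in_itv.
apply: (regular_approx
  (B := fun k => (fun x : E => x ord0 i) @^-1` `[a - k.+1%:R^-1, a[%classic)) => //.
- by move=> k; exact: mcoord.
- move=> k l kl x; rewrite /= !in_itv/= => /andP[h ->].
  by rewrite andbT (le_trans _ h)// lerD2l lerN2 lef_pV2 ?posrE// ler_nat ltnS.
- apply/seteqP; split => // x h.
  have xa : x ord0 i < a by have := h 0%N I; rewrite /= in_itv/= => /andP[].
  have d0 : 0 < a - x ord0 i by rewrite subr_gt0.
  have := cvg_invS (R := R) => /cvgrPdist_lt/(_ _ d0)[k _ /(_ _ (leqnn k))].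
  rewrite /= sub0r normrN ger0_norm// => hk.
  have := h k I; rewrite /= in_itv/= => /andP[+ _].
  by rewrite lerBlDr -lerBlDl leNgt hk.
move=> k; set d : R := k.+1%:R^-1; have d0 : 0 < d by rewrite invr_gt0.
exists (fun z : E * E => (d < `|z.1 ord0 i - z.2 ord0 i|)%R%:R); split => //.
- exact: measurable_gap.
- by move=> x y /=; rewrite distrC.
- exact: kernel_null_tail.
move=> x y /= xa /negP; rewrite -leNgt => ay.
case: ltP => [_|dxy]; first by rewrite lerDl.
rewrite add0r in_indic mem_set//= in_itv/= xa andbT.
by move: dxy; rewrite distrC ler_norml => /andP[_]; lra.
Qed.

(** The regular sets form a sigma-algebra, and the half-spaces generate all
    measurable sets. *)
Lemma regular_measurable (A : set E) : measurable A -> regular_set A.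
Proof.
have sig : sigma_algebra setT regular_set.
  split; first exact: regular_set0.
  - by move=> B rB; rewrite setTD; exact: regular_setC.
  - exact: regular_bigcup.
apply: smallest_sub => //.
rewrite -bigcup_seq/=; apply: bigcup_sub => i _ B [Y mY <-]; rewrite setTI.
move: mY; rewrite RGenInftyO.measurableE.
have sigY : sigma_algebra setT [set Y | regular_set (rV_coord i @^-1` Y)].
  case: sig => s0 sC sU; split => /=.
  - by rewrite preimage_set0.
  - by move=> Z rZ; rewrite setTD -preimage_setC; apply: regular_setC.
  - by move=> F rF; rewrite preimage_bigcup; exact: sU.
move: Y; apply: smallest_sub => // _ [a ->] /=.
rewrite (_ : rV_coord i @^-1` _ = [set x | x ord0 i < a]); first exact: regular_halfspace.
by apply/seteqP; split => x /=; rewrite in_itv.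
Qed.

Let diffsq (f : E -> R) (z : E * E) : R := (f z.1 - f z.2) ^+ 2.

Let mdiffsq f : measurable_fun setT f -> meas (diffsq f).
Proof.
by move=> mf; apply: measurable_funX; apply: measurable_funB; exact: (measurableT_comp mf).
Qed.

Let diffsq0 f : pos (diffsq f). Proof. by move=> z; exact: sqr_ge0. Qed.

Import HBNNSimple.

(** If [f x] and [f y] differ, then [x] and [y] are separated by a level set of
    [f], of which there are finitely many, each of them regular. *)
Lemma kernel_null_simple (f : {nnsfun E >-> R}) : kernel_null (diffsq f).
Proof.
have [M Mf] : exists M : R, forall x, f x <= M.
  have [M [_ /(_ (M + 1))]] := simple_bounded f.
  rewrite ltrDl => /(_ ltr01) h; exists (M + 1) => x.
  exact: le_trans (ler_norm _) (h x I).
have [s0 fs] : exists s0 : seq R, range f = [set` s0].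
  by apply/finite_seqP; exact: fimfunP.
pose s := undup s0.
have mAy y : measurable (f @^-1` [set y]) by exact: measurable_sfunP.
have M0 : 0 <= M by exact: (le_trans _ (Mf 0)).
have ms : meas (fun z => \sum_(y <- s) dist_set (f @^-1` [set y]) z).
  by apply: measurable_sum => y; exact: mdist.
have ds0 : pos (fun z => \sum_(y <- s) dist_set (f @^-1` [set y]) z).
  by move=> z; apply: sumr_ge0.
apply: (@kernel_null_le _ (fun z => M ^+ 2 * \sum_(y <- s) dist_set (f @^-1` [set y]) z)) => //.
- exact: mdiffsq.
- exact: measurable_funM.
- case=> x y; rewrite /diffsq/=; have [->|fxy] := eqVneq (f x) (f y).
    by rewrite subrr expr0n/= mulr_ge0 ?ds0 ?sqr_ge0.
  have x1 : 1 <= \sum_(t <- s) dist_set (f @^-1` [set t]) (x, y).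
    have fxs : f x \in s.
      by rewrite mem_undup; have : [set` s0] (f x) by rewrite -fs; exists x.
    rewrite (bigD1_seq (f x))//=; last exact: undup_uniq.
    rewrite dist_set1//=; first by rewrite lerDl sumr_ge0.
    by apply/eqP; rewrite eq_sym.
  rewrite (@le_trans _ _ (M ^+ 2))//; last by rewrite -[leLHS]mulr1 ler_wpM2l ?sqr_ge0.
  rewrite -(real_normK (num_real (f x - f y))) lerXn2r ?nnegrE//.
  have fx0 : 0 <= f x by []. have fy0 : 0 <= f y by [].
  by have := Mf x; have := Mf y; rewrite ler_norml; lra.
- apply: kernel_nullZ => //; first exact: sqr_ge0.
  by apply: kernel_null_sum => y; [exact: mdist|exact: dist0|exact: (regular_measurable (mAy y)).2].
Qed.

(** Approximation from below by simple functions [g k]; by [kernel_mass_fst] and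
    [kernel_mass_snd] the error costs the L^2 norm of [f - g k], uniformly in the
    parameter of the kernel. *)
Lemma kernel_null_nonneg (f : E -> R) : measurable_fun setT f -> (forall x, 0 <= f x) ->
  (\int[L]_x (f x ^+ 2)%:E < +oo)%E -> kernel_null (diffsq f).
Proof.
move=> mf f0 f2; apply: cvge0_approx => [m|eta eta0]; first exact/kernel_mass_ge0.
have mfE : measurable_fun setT (EFin \o f) by exact/measurable_EFinP.
pose g := nnsfun_approx measurableT mfE.
have gf k x : g k x <= f x.
  rewrite -lee_fin /g nnsfun_approxE; apply: le_approx => // y _.
  by rewrite lee_fin.
have mg k : measurable_fun setT (g k) by exact: measurable_funPT.
have msq k : measurable_fun setT (fun x => (f x - g k x) ^+ 2).
  by apply: measurable_funX; exact: measurable_funB.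
have gcvg : (\int[L]_x ((f x - g k x) ^+ 2)%:E)%E @[k --> \oo] --> 0%E.
  apply: (@dominated_cvg0 _ _ _ _ _ (fun x => f x ^+ 2)) => //.
  - exact: measurable_funX.
  - by move=> k x; exact: sqr_ge0.
  - by move=> k x; rewrite lerXn2r ?nnegrE ?subr_ge0// gerBl fun_ge0.
  - move=> x; have h := cvg_nnsfun_approx measurableT mfE (fun y _ => f0 y) (x := x) I.
    have /fine_cvgP[_ h'] := h.
    rewrite (_ : 0 = (f x - f x) * (f x - f x)); last by rewrite subrr mulr0.
    by under eq_fun do rewrite expr2; apply: cvgM; apply: cvgB => //; exact: cvg_cst.
have eta6 : 0 < eta / 6 by rewrite divr_gt0.
have nn k : (0 <= \int[L]_x ((f x - g k x) ^+ 2)%:E)%E.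
  by apply: integral_ge0 => x _; rewrite lee_fin sqr_ge0.
have [k _ /(_ _ (leqnn k)) hk] := (cvge0P nn).1 gcvg _ eta6.
pose r x := (f x - g k x) ^+ 2.
have mr : measurable_fun setT r by exact: msq.
have r0 x : 0 <= r x by exact: sqr_ge0.
have kr : (\int[L]_x (\1_K x * r x)%:E <= (eta / 6)%:E)%E.
  apply: le_trans hk; apply: le_integral_EFin => //.
  - by apply: measurable_funM => //; exact: measurable_indic.
  - by move=> x; rewrite mulr_ge0.
  - by move=> x; rewrite -/(r x) ler_piMl// in_indic lern1 leq_b1.
exists (fun m => 3%:E * kernel_mass (diffsq (g k)) m)%E; first exact/cvge0Z/kernel_null_simple.
have mr1 : meas (fun z : E * E => r z.1) by exact: (measurableT_comp mr).
have mr2 : meas (fun z : E * E => r z.2) by exact: (measurableT_comp mr).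
have md : meas (diffsq (g k)) by exact: mdiffsq.
have mr12 : meas (fun z : E * E => r z.1 + r z.2) by exact: measurable_funD.
have r120 : pos (fun z : E * E => r z.1 + r z.2) by move=> z; rewrite addr_ge0.
move=> m; apply: (@le_trans _ _ (kernel_mass (fun z => 3 * (diffsq (g k) z + (r z.1 + r z.2)))%R m)).
  apply: kernel_mass_le => //.
  - exact: mdiffsq.
  - by apply: measurable_funM => //; exact: measurable_funD.
  - case=> x y; rewrite /diffsq /r/= -subr_ge0.
    set A := f x; set B := f y; set C := g k x; set D := g k y.
    rewrite (_ : _ - _ = ((C - D) - (A - C)) ^+ 2 + ((C - D) + (B - D)) ^+ 2 + ((A - C) + (B - D)) ^+ 2).
      by rewrite !addr_ge0 ?sqr_ge0.
    by ring.
rewrite kernel_massZ//; last 2 first.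
- exact: measurable_funD.
- by move=> z; rewrite addr_ge0.
rewrite kernel_massD// ge0_muleDr ?kernel_mass_ge0// leeD2l// kernel_massD//.
apply: (@le_trans _ _ (3%:E * ((eta / 6)%:E + (eta / 6)%:E))%E).
  apply: lee_wpmul2l => //; apply: leeD; apply: le_trans kr.
    exact: kernel_mass_fst.
  exact: kernel_mass_snd.
by rewrite -EFinD -EFinM lee_fin; lra.
Qed.

Lemma kernel_null_real (f : E -> R) : measurable_fun setT f ->
  (\int[L]_x (f x ^+ 2)%:E < +oo)%E -> kernel_null (diffsq f).
Proof.
move=> mf f2; pose p x := Num.max (f x) 0; pose q x := Num.max (- f x) 0.
have mp : measurable_fun setT p by apply: measurable_maxr.
have mq : measurable_fun setT q by apply: measurable_maxr => //; exact: measurableT_comp.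
have p0 x : 0 <= p x by rewrite le_max lexx orbT.
have q0 x : 0 <= q x by rewrite le_max lexx orbT.
have pq x : p x ^+ 2 + q x ^+ 2 = f x ^+ 2 /\ p x - q x = f x.
  rewrite /p /q; case: (leP 0 (f x)) => fx.
    by rewrite max_r ?oppr_le0// expr0n/= addr0 subr0.
  by rewrite max_l ?oppr_ge0 ?(ltW fx)// expr0n/= add0r sqrrN sub0r opprK.
have le2 (t : E -> R) : measurable_fun setT t -> (forall x, t x ^+ 2 <= f x ^+ 2) ->
    (\int[L]_x (t x ^+ 2)%:E < +oo)%E.
  move=> mt tf; apply: le_lt_trans f2; apply: le_integral_EFin => //;
    try exact: measurable_funX.
  by move=> x; exact: sqr_ge0.
have np : kernel_null (diffsq p).
  by apply: kernel_null_nonneg => //; apply: le2 => // x; rewrite -(pq x).1 lerDl sqr_ge0.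
have nq : kernel_null (diffsq q).
  by apply: kernel_null_nonneg => //; apply: le2 => // x; rewrite -(pq x).1 lerDr sqr_ge0.
have dp := mdiffsq mp; have dq := mdiffsq mq.
apply: (@kernel_null_le _ (fun z => 2 * (diffsq p z + diffsq q z))) => //.
- exact: mdiffsq.
- by apply: measurable_funM => //; exact: measurable_funD.
- move=> z; rewrite /diffsq -(pq z.1).2 -(pq z.2).2 -subr_ge0.
  rewrite (_ : _ - _ = (p z.1 - p z.2 + (q z.1 - q z.2)) ^+ 2) ?sqr_ge0//.
  by ring.
apply: kernel_nullZ => //; first exact: measurable_funD.
  by move=> z; rewrite addr_ge0.
exact: kernel_nullD.
Qed.

Lemma kernel_null_complex (u : E -> R[i]) : cmeas u -> (L2sq L u < +oo)%E ->
  kernel_null (fun z => sqn (u z.1 - u z.2)).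
Proof.
move=> mu u2; have [mr mi] := mu.
have le2 (t : E -> R) : measurable_fun setT t -> (forall x, t x ^+ 2 <= sqn (u x)) ->
    (\int[L]_x (t x ^+ 2)%:E < +oo)%E.
  move=> mt tf; apply: le_lt_trans u2; apply: le_integral_EFin => //.
  - exact: measurable_funX.
  - exact: measurable_sqn.
  - by move=> x; exact: sqr_ge0.
have nr : kernel_null (diffsq (fun x => complex.Re (u x))).
  by apply: kernel_null_real => //; apply: le2 => // x; rewrite lerDl sqr_ge0.
have ni : kernel_null (diffsq (fun x => complex.Im (u x))).
  by apply: kernel_null_real => //; apply: le2 => // x; rewrite lerDr sqr_ge0.
rewrite (_ : (fun z => _) = (fun z => diffsq (fun x => complex.Re (u x)) z +
   diffsq (fun x => complex.Im (u x)) z)).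
  by apply: kernel_nullD => //; exact: mdiffsq.
by apply/funext => z; rewrite /sqn /diffsq; case: (u z.1); case: (u z.2).
Qed.

End concentration.

(** * Plancherel identity for boundedly supported functions *)

Section plancherel_bounded.
Context {R : realType} {n : nat}.
Local Notation E := 'rV[R]_n.
Local Notation L := (@leb R n).
Local Notation LL := (L \x L)%E.

Lemma plexpE e (x : E) : plexp e x = expR (- (e * \sum_i `|x ord0 i|)).
Proof.
rewrite /plexp /lexp -expR_sum; congr expR.
by rewrite mulr_sumr sumrN.
Qed.

(** Because |t| <= 1 + t^2 on a set of finite measure. *)
Lemma integrable_bounded_support (u : E -> R[i]) (B : set E) : cmeas u ->
  measurable B -> (L B < +oo)%E -> (forall x, ~ B x -> u x = 0) -> (L2sq L u < +oo)%E ->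
  L.-integrable setT (fun x => (complex.Re (u x))%:E) /\
  L.-integrable setT (fun x => (complex.Im (u x))%:E).
Proof.
move=> mu mB Bfin uB u2; have [mr mi] := mu.
have idom : L.-integrable setT (fun x => (\1_B x + sqn (u x))%:E).
  apply: rintegrableD.
    apply/integrableP; split; first by apply/measurable_EFinP; exact: measurable_indic.
    under eq_integral do rewrite /= ger0_norm//.
    by rewrite integral_indic// setIT.
  apply/integrableP; split; first by apply/measurable_EFinP; exact: measurable_sqn.
  by under eq_integral do rewrite /= ger0_norm ?sqn_ge0//.
have key (a : R) (b : R) x : u x = a +i* b -> `|a| <= \1_B x + sqn (u x) /\ `|b| <= \1_B x + sqn (u x).
  move=> uab; case: (asboolP (B x)) => Bx; last first.
    move: (uB _ Bx); rewrite uab => -[-> ->]; rewrite normr0.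
    by split; rewrite addr_ge0// ?sqn_ge0.
  rewrite indicE mem_set// uab /sqn /=.
  have h (t : R) : `|t| <= 1 + t ^+ 2.
    by rewrite ler_norml; apply/andP; split; have := sqr_ge0 (t - 1); have := sqr_ge0 (t + 1); nra.
  by have := h a; have := h b; have := sqr_ge0 a; have := sqr_ge0 b; lra.
split; apply: (rintegrable_dominated _ idom) => // x.
- by apply: (key _ (complex.Im (u x)) _ _).1; case: (u x).
- by apply: (key (complex.Re (u x)) _ _ _).2; case: (u x).
Qed.

Lemma measurable_fourierL1 (u : E -> R[i]) :
  L.-integrable setT (fun x => (complex.Re (u x))%:E) ->
  L.-integrable setT (fun x => (complex.Im (u x))%:E) ->
  cmeas (fourierL1 u).
Proof.
move=> ir ii; rewrite (_ : fourierL1 u = fun xi => ((2 * pi) `^ (- (n%:R / 2)))%:C *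
   (four_re (fun x => complex.Re (u x)) (fun x => complex.Im (u x)) xi +i*
    four_im (fun x => complex.Re (u x)) (fun x => complex.Im (u x)) xi)); last first.
  by apply/funext => xi; rewrite fourierL1E.
apply: cmeasM; first exact: cmeas_cst.
split => /=; [exact: measurable_four_re|exact: measurable_four_im].
Qed.

Let ep (m : nat) : R := m.+1%:R^-1.
Let ep0 m : 0 < ep m. Proof. by rewrite invr_gt0. Qed.

(** At least 1 as soon as one point lies in a box centred at 0 and the other
    outside the box whose radius is larger by 1. *)
Let far (z : E * E) : R := \sum_i (1 < `|z.1 ord0 i - z.2 ord0 i|)%R%:R.

Let mfar : measurable_fun setT far.
Proof.
by apply: measurable_sum => i; exact: measurable_gap.
Qed.

Let far0 z : 0 <= far z. Proof. exact: sumr_ge0. Qed.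

Let mpc m : measurable_fun setT (fun z : E * E => pcauchy (ep m) (z.1 - z.2)).
Proof. exact: (measurableT_comp (measurable_pcauchy (ep0 m)) measurable_sub2). Qed.

Let pc0 m (z : E * E) : 0 <= pcauchy (ep m) (z.1 - z.2).
Proof. exact: pcauchy_ge0. Qed.

Lemma far_small (u : E -> R[i]) m : cmeas u ->
  (\int[LL]_z (sqn (u z.1) * (far z * pcauchy (ep m) (z.1 - z.2)))%:E <=
   L2sq L u * (ep m * (n%:R * 2))%:E)%E.
Proof.
move=> mu.
have ms1 : measurable_fun setT (fun z : E * E => sqn (u z.1)).
  exact: (measurableT_comp (measurable_sqn mu)).
have mm : measurable_fun setT (fun z => (sqn (u z.1) * (far z * pcauchy (ep m) (z.1 - z.2)))%:E).
  by apply/measurable_EFinP; apply: measurable_funM => //; exact: measurable_funM.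
have m0 z : (0 <= (sqn (u z.1) * (far z * pcauchy (ep m) (z.1 - z.2)))%:E)%E.
  by rewrite lee_fin mulr_ge0 ?sqn_ge0// mulr_ge0.
have e0 : 0 <= ep m * (n%:R * 2) by rewrite mulr_ge0 ?(ltW (ep0 m))// mulr_ge0.
rewrite fubini_tonelli1// /L2sq -ge0_integralZr//; last 2 first.
- by apply/measurable_EFinP; exact: measurable_sqn.
- by move=> x _; rewrite lee_fin sqn_ge0.
apply: ge0_le_integral => //.
- by move=> x _; apply: integral_ge0 => y _; exact: m0 (x, y).
- exact: measurable_fun_fubini_tonelli_F.
- by apply: emeasurable_funM => //; apply/measurable_EFinP; exact: measurable_sqn.
move=> x _; rewrite /fubini_F/=.
have mfx : measurable_fun setT (fun y => far (x, y)).
  exact: (measurableT_comp mfar (measurable_pair1 x)).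
have mpx : measurable_fun setT (fun y : E => pcauchy (ep m) (x - y)).
  exact: (measurableT_comp (mpc m) (measurable_pair1 x)).
rewrite integral_EFinZ ?sqn_ge0//; last 2 first.
- exact: measurable_funM.
- by move=> y; rewrite mulr_ge0 ?(pc0 m (x, y)).
rewrite lee_wpmul2l ?lee_fin ?sqn_ge0//.
rewrite /far; under eq_integral do rewrite mulr_suml -sumEFin.
rewrite ge0_integral_sum//; last 2 first.
- move=> i; apply/measurable_EFinP; apply: measurable_funM => //.
  exact: (measurableT_comp (measurable_gap i 1) (measurable_pair1 x)).
- by move=> i y _; rewrite lee_fin mulr_ge0 ?(pc0 m (x, y)).
apply: (@le_trans _ _ (\sum_(i < n) (ep m * (1 + (1 ^+ 2)^-1))%:E)%E).
  apply: lee_sum => i _.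
  under eq_integral do rewrite distrC -pcauchyN opprB.
  exact: integral_pcauchy_tail.
rewrite sumEFin lee_fin sumr_const card_ord expr1n invr1.
by rewrite -[leLHS]mulr_natr -mulrA (mulrC (1 + 1)).
Qed.

(** The limit of [regularised_parseval] as the parameter tends to 0. The
    exponential increases to 1, so the first term tends to the norm of the
    transform; the second one vanishes by [kernel_null_complex] on [K * K], where
    [K] is a neighbourhood of the support, and by [far_small] off it. *)
Lemma plancherel_bounded (u : E -> R[i]) (rho : R) : cmeas u -> (L2sq L u < +oo)%E ->
  0 <= rho -> (forall x, ~ box 0 rho x -> u x = 0) ->
  L2sq L (fourierL1 u) = L2sq L u.
Proof.
move=> mu u2 rho0 uB.
have mB := measurable_box (0 : E) rho.
have Bfin : (L (box 0 rho) < +oo)%E by rewrite leb_box// ltry.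
have [ir ii] := integrable_bounded_support mu mB Bfin uB u2.
have mF := measurable_fourierL1 ir ii.
pose K := box (0 : E) (rho + 1).
have mK : measurable K := measurable_box (0 : E) (rho + 1).
have Kfin : (L K < +oo)%E by rewrite leb_box ?ltry// addr_ge0.
pose I m := (\int[L]_xi (plexp (ep m) xi * sqn (fourierL1 u xi))%:E)%E.
pose D m := (\int[L]_x \int[L]_y (2^-1 * sqn (u x - u y) * pcauchy (ep m) (x - y))%:E)%E.
have ID m : (I m + D m = L2sq L u)%E by exact: regularised_parseval.
have msd : measurable_fun setT (fun z : E * E => sqn (u z.1 - u z.2)).
  have [mr mi] := mu; rewrite (_ : (fun z => _) = fun z : E * E =>
     (complex.Re (u z.1) - complex.Re (u z.2)) ^+ 2 + (complex.Im (u z.1) - complex.Im (u z.2)) ^+ 2).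
    by apply: measurable_funD; apply: measurable_funX; apply: measurable_funB;
      [exact: (measurableT_comp mr)|exact: (measurableT_comp mr)
      |exact: (measurableT_comp mi)|exact: (measurableT_comp mi)].
  by apply/funext => z; rewrite /sqn; case: (u z.1); case: (u z.2).
have ms1 : measurable_fun setT (fun z : E * E => sqn (u z.1)).
  exact: (measurableT_comp (measurable_sqn mu)).
have ms2 : measurable_fun setT (fun z : E * E => sqn (u z.2)).
  exact: (measurableT_comp (measurable_sqn mu)).
have D0 : D m @[m --> \oo] --> 0%E.
  apply: (@cvge0_le _ _ (fun m => kernel_mass K (fun z => sqn (u z.1 - u z.2)%R) m +
      (ep m * (n%:R * 2) * 2)%:E * L2sq L u)%E).
  - move=> m; apply: integral_ge0 => x _; apply: integral_ge0 => y _.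
    by rewrite lee_fin mulr_ge0 ?(pc0 m (x, y))// mulr_ge0 ?sqn_ge0.
  - move=> m.
    have mD : measurable_fun setT (fun z : E * E => 2^-1 * sqn (u z.1 - u z.2) * pcauchy (ep m) (z.1 - z.2)).
      by apply: measurable_funM => //; exact: measurable_funM.
    have D0 z : 0 <= 2^-1 * sqn (u z.1 - u z.2) * pcauchy (ep m) (z.1 - z.2).
      by rewrite mulr_ge0// mulr_ge0 ?sqn_ge0.
    have -> : D m = (\int[LL]_z (2^-1 * sqn (u z.1 - u z.2) * pcauchy (ep m) (z.1 - z.2))%:E)%E.
      rewrite fubini_tonelli1//; exact/measurable_EFinP.
    pose f1 z := sqn (u z.1 - u z.2) * (\1_K z.1 * \1_K z.2 * pcauchy (ep m) (z.1 - z.2)).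
    pose f2 z := sqn (u z.1) * (far z * pcauchy (ep m) (z.1 - z.2)).
    pose f3 z := sqn (u z.2) * (far z * pcauchy (ep m) (z.1 - z.2)).
    have mf1 : measurable_fun setT f1.
      apply: measurable_funM => //; apply: measurable_funM => //; apply: measurable_funM;
      by apply: measurableT_comp => //; exact: measurable_indic.
    have mf2 : measurable_fun setT f2.
      by apply: measurable_funM => //; exact: measurable_funM.
    have mf3 : measurable_fun setT f3.
      by apply: measurable_funM => //; exact: measurable_funM.
    have f10 z : 0 <= f1 z by rewrite mulr_ge0 ?sqn_ge0// mulr_ge0.
    have f20 z : 0 <= f2 z by rewrite mulr_ge0 ?sqn_ge0// mulr_ge0.
    have f30 z : 0 <= f3 z by rewrite mulr_ge0 ?sqn_ge0// mulr_ge0.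
    have farC x y : far (x, y) = far (y, x) by apply: eq_bigr => i _; rewrite /= distrC.
    have If3 : (\int[LL]_z (f3 z)%:E = \int[LL]_z (f2 z)%:E)%E.
      transitivity (\int[LL]_z (f2 (z.2, z.1))%:E)%E; last exact: integral_prod_swap.
      apply: eq_integral => -[x y] _.
      by rewrite /f2 /f3/= farC -(pcauchyN _ (x - y)) opprB.
    apply: (@le_trans _ _ (\int[LL]_z (f1 z + (f2 z + f3 z))%:E)%E).
      apply: le_integral_EFin => //.
      + by apply: measurable_funD => //; exact: measurable_funD.
      + case=> x y; rewrite /f1 /f2 /f3/=.
        set p := pcauchy _ _; have p0 : 0 <= p := pc0 m (x, y).
        rewrite [leRHS](_ : _ = (sqn (u x - u y) * (\1_K x * \1_K y) +
          (sqn (u x) + sqn (u y)) * far (x, y)) * p); last by ring.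
        rewrite ler_wpM2r//.
        have nz (x' y' : E) : ~ K x' -> 2^-1 * sqn (u y') <= sqn (u y') * far (x', y').
          move=> Kx; case: (asboolP (box 0 rho y')) => By; last by rewrite uB// sqn0 mulr0 mul0r.
          have far1 : 1 <= far (x', y').
            move/existsNP : Kx => [i /negP]; rewrite -ltNge mxE subr0 => hi.
            rewrite /far (bigD1 i)//= -[leLHS]addr0 lerD//; last exact: sumr_ge0.
            rewrite ler1n lt0b; have := By i; rewrite mxE subr0 => hy.
            by have := ler_norm (`|x' ord0 i| - `|y' ord0 i|); have := ler_dist_dist (x' ord0 i) (y' ord0 i); lra.
          rewrite (@le_trans _ _ (sqn (u y')))//.
            by rewrite ler_piMl ?sqn_ge0//; lra.
          by rewrite ler_peMr ?sqn_ge0.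
        have KB x' : ~ K x' -> u x' = 0.
          move=> Kx; apply: uB => Bx; apply: Kx => i.
          by rewrite (le_trans (Bx i))// lerDl.
        case: (asboolP (K x)) => Kx; last first.
          rewrite (KB x)// sub0r sqnN sqn0 add0r.
          apply: (le_trans (nz _ _ Kx)); rewrite lerDr mulr_ge0 ?sqn_ge0//.
        case: (asboolP (K y)) => Ky; last first.
          rewrite (KB y)// subr0 sqn0 addr0 farC.
          apply: (le_trans (nz _ _ Ky)); rewrite lerDr mulr_ge0 ?sqn_ge0//.
        rewrite !indicE !mem_set// !mulr1 -[leLHS]addr0 lerD//.
          by rewrite ler_piMl ?sqn_ge0//; lra.
        by rewrite mulr_ge0// addr_ge0 ?sqn_ge0.
    rewrite integral_EFinD//; [|exact: measurable_funD|by move=> z; rewrite addr_ge0].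
    rewrite integral_EFinD// If3; apply: leeD => //.
    have hf2 := far_small m mu.
    apply: (le_trans (leeD hf2 hf2)).
    rewrite muleC -ge0_muleDl ?L2sq_ge0// ?lee_fin; last 2 first.
    + by rewrite mulr_ge0 ?(ltW (ep0 m))// mulr_ge0.
    + by rewrite mulr_ge0 ?(ltW (ep0 m))// mulr_ge0.
    by rewrite -EFinD [X in (X%:E * _)%E](_ : _ = ep m * (n%:R * 2) * 2)//; ring.
  apply: cvge0D; first exact: kernel_null_complex.
  have fN : L2sq L u \is a fin_num by rewrite ge0_fin_numE ?L2sq_ge0.
  rewrite -(fineK fN); under eq_fun do rewrite muleC.
  apply: cvge0Z; apply: cvg_EFin; first exact: nearW.
  have h : (ep m * (n%:R * 2 * 2)) @[m --> \oo] --> (0 : R) * (n%:R * 2 * 2).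
    by apply: cvgM; [exact: cvg_invS|exact: cvg_cst].
  rewrite mul0r in h; rewrite (_ : fine \o _ = fun m => ep m * (n%:R * 2 * 2))//.
  by apply/funext => m /=; rewrite !mulrA.
have Icvg : I m @[m --> \oo] --> L2sq L (fourierL1 u).
  pose g m xi := (plexp (ep m) xi * sqn (fourierL1 u xi))%:E.
  have -> : L2sq L (fourierL1 u) = (\int[L]_xi limn (g^~ xi))%E.
    apply: eq_integral => xi _; apply/esym/cvg_lim => //; apply: cvg_EFin.
      exact: nearW.
    rewrite (_ : fine \o _ = fun m => expR (- (ep m * \sum_i `|xi ord0 i|)) *
      sqn (fourierL1 u xi)); last by apply/funext => m; rewrite /= plexpE.
    rewrite -[X in _ --> X]mul1r; apply: cvgM; last exact: cvg_cst.
    pose S : R := \sum_i `|xi ord0 i|.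
    have hS : - (ep m * S) @[m --> \oo] --> - ((0 : R) * S).
      by apply: cvgN; apply: cvgM; [exact: cvg_invS|exact: cvg_cst].
    rewrite mul0r oppr0 in hS; rewrite -expR0.
    exact: (cvg_comp (fun m => - (ep m * S)) expR hS (@continuous_expR R 0)).
  apply: (cvg_monotone_convergence (mu := L) measurableT (g' := g)) => //.
  - move=> m; apply/measurable_EFinP; apply: measurable_funM; first exact: measurable_plexp.
    exact: measurable_sqn.
  - by move=> m x _; rewrite lee_fin mulr_ge0 ?plexp_ge0 ?sqn_ge0.
  - move=> x _ k l kl; rewrite lee_fin ler_wpM2r ?sqn_ge0// !plexpE ler_expR lerN2.
    by rewrite ler_wpM2r ?sumr_ge0// lef_pV2 ?posrE// ler_nat.
have : (I \+ D) @ \oo --> (L2sq L (fourierL1 u) + 0)%E.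
  by apply: cvgeD => //; exact: fin_num_adde_defl.
rewrite adde0.
rewrite (_ : I \+ D = cst (L2sq L u)); last by apply/funext => m; exact: ID.
by move=> h; exact: (cvg_unique (@ereal_hausdorff R) h (cvg_cst _)).
Qed.

End plancherel_bounded.

(** * Completeness of L^2 *)

Lemma geo_cvg {R : realType} (a : nat -> R) (C : R) : 0 <= C ->
  (forall j, `|a j.+1 - a j| <= C * 2^-1 ^+ j) -> cvg (a @ \oo).
Proof.
move=> C0 h.
have hs : cvgn (series (telescope a)).
  apply: normed_cvg; apply: (@series_le_cvg _ _ (geometric C 2^-1)).
  - by move=> j; exact: normr_ge0.
  - by move=> j; rewrite /geometric/= mulr_ge0// exprn_ge0.
  - by move=> j; exact: h.
  - by apply: is_cvg_geometric_series; rewrite ger0_norm//; lra.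
rewrite (_ : a = fun j => a 0%N + series (telescope a) j).
  by apply: is_cvgD => //; exact: is_cvg_cst.
by apply/funext => j; rewrite -eq_sum_telescope.
Qed.

Section complex_L2.
Context d (T : measurableType d) {R : realType} (mu : {measure set T -> \bar R}).
Implicit Types u v g : T -> R[i].

Lemma L2sq_ae u v : cmeas u -> cmeas v -> {ae mu, forall x, u x = v x} ->
  L2sq mu u = L2sq mu v.
Proof.
move=> mu' mv uv; apply: ge0_ae_eq_integral => //.
- by apply/measurable_EFinP; exact: measurable_sqn.
- by apply/measurable_EFinP; exact: measurable_sqn.
- by move=> x _; rewrite lee_fin sqn_ge0.
- by move=> x _; rewrite lee_fin sqn_ge0.
- by apply: filterS uv => x -> _.
Qed.

Lemma sqn_eq0 (z : R[i]) : sqn z = 0 -> z = 0.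
Proof.
case: z => a b; rewrite /sqn/= => h.
have a0 : a ^+ 2 = 0 by have := sqr_ge0 a; have := sqr_ge0 b; lra.
have b0 : b ^+ 2 = 0 by have := sqr_ge0 a; have := sqr_ge0 b; lra.
by move/eqP : a0; move/eqP : b0; rewrite !sqrf_eq0 => /eqP -> /eqP ->.
Qed.

Lemma L2sq_eq0 u : cmeas u -> L2sq mu u = 0%E -> {ae mu, forall x, u x = 0}.
Proof.
move=> mu' u0.
have ms : measurable_fun setT (fun x => (sqn (u x))%:E).
  by apply/measurable_EFinP; exact: measurable_sqn.
have : (\int[mu]_x `|(sqn (u x))%:E| = 0)%E.
  by under eq_integral do rewrite gee0_abs ?lee_fin ?sqn_ge0//.
move/(ae_eq_integral_abs mu measurableT ms); apply: filterS => x /(_ I) [].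
exact: sqn_eq0.
Qed.

Lemma L2sqB_sym u v : L2sq mu (fun x => u x - v x) = L2sq mu (fun x => v x - u x).
Proof. by rewrite -L2sqN; apply: eq_integral => x _; rewrite opprB. Qed.

Lemma L2sq_triangle u v w : cmeas u -> cmeas v -> cmeas w ->
  (L2sq mu (fun x => u x - w x)%R <=
   2%:E * L2sq mu (fun x => u x - v x)%R + 2%:E * L2sq mu (fun x => v x - w x)%R)%E.
Proof.
move=> mu' mv mw; rewrite (_ : (fun x => u x - w x) = fun x => (u x - v x) + (v x - w x)).
  by apply: L2sqD_le2; exact: cmeasB.
by apply/funext => x; rewrite addrA subrK.
Qed.

Lemma L2sq_fin_sub u v : cmeas u -> cmeas v -> (L2sq mu v < +oo)%E ->
  (L2sq mu (fun x => u x - v x)%R < +oo)%E -> (L2sq mu u < +oo)%E.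
Proof.
move=> mu' mv v2 uv2; rewrite (_ : u = fun x => (u x - v x) + v x); last first.
  by apply/funext => x; rewrite subrK.
apply: (le_lt_trans (L2sqD_le2 _ (cmeasB mu' mv) mv)).
by rewrite lte_add_pinfty// lte_mul_pinfty// ?lte_fin.
Qed.

(** [L2sqD_le] with parameter [t] bounds the error by [t] times the norm of [v]
    plus a multiple of the norm of the difference. *)
Lemma cvg_L2sq (u : nat -> T -> R[i]) v : (forall k, cmeas (u k)) -> cmeas v ->
  (L2sq mu v < +oo)%E ->
  L2sq mu (fun x => u k x - v x) @[k --> \oo] --> 0%E ->
  L2sq mu (u k) @[k --> \oo] --> L2sq mu v.
Proof.
move=> mu' mv v2 uv.
have vfin : L2sq mu v \is a fin_num by rewrite ge0_fin_numE ?L2sq_ge0.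
pose w k x := u k x - v x.
have mw k : cmeas (w k) by exact: cmeasB.
have key (eta : R) : 0 < eta ->
    \forall k \near \oo, (L2sq mu (u k) <= L2sq mu v + eta%:E)%E /\ (L2sq mu v <= L2sq mu (u k) + eta%:E)%E.
  move=> eta0.
  pose A := fine (L2sq mu v); have A0 : 0 <= A by rewrite fine_ge0 ?L2sq_ge0.
  pose t : R := Num.min 1 (eta / (4 * (A + 1))).
  have A1 : 0 < 4 * (A + 1) by rewrite mulr_gt0// ltr_wpDl.
  have t0 : 0 < t by rewrite lt_min ltr01 divr_gt0.
  have t1 : t <= 1 by rewrite ge_min lexx.
  have tA : t * (4 * (A + 1)) <= eta.
    by rewrite -ler_pdivlMr// ge_min lexx orbT.
  have b0 : 0 < eta / (4 * (1 + t^-1)).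
    by rewrite divr_gt0// mulr_gt0// addr_gt0// invr_gt0.
  have := (cvge0P (fun k => L2sq_ge0 mu (w k))).1 uv _ b0.
  apply: filterS => k hk.
  have wfin : L2sq mu (w k) \is a fin_num.
    by rewrite ge0_fin_numE ?L2sq_ge0// (le_lt_trans hk)// ltry.
  have h1 : (L2sq mu (u k) <= (1 + t)%:E * L2sq mu v + (1 + t^-1)%:E * L2sq mu (w k))%E.
    rewrite [X in (L2sq mu X <= _)%E](_ : u k = fun x => v x + w k x); first exact: L2sqD_le.
    by apply/funext => x; rewrite /w addrC subrK.
  have ufin : L2sq mu (u k) \is a fin_num.
    rewrite ge0_fin_numE ?L2sq_ge0// (le_lt_trans h1)//.
    by rewrite -(fineK vfin) -(fineK wfin) -!EFinM -EFinD ltry.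
  have h2 : (L2sq mu v <= (1 + t)%:E * L2sq mu (u k) + (1 + t^-1)%:E * L2sq mu (w k))%E.
    rewrite [X in (L2sq mu X <= _)%E](_ : v = fun x => u k x + - w k x); last first.
      by apply/funext => x; rewrite /w opprB addrC subrK.
    by rewrite -(L2sqN mu (w k)); apply: L2sqD_le => //; exact: cmeasN.
  move: h1 h2 hk; rewrite -(fineK vfin) -(fineK wfin) -(fineK ufin).
  rewrite -!EFinM -!EFinD !lee_fin -/A.
  have B0 : 0 <= fine (L2sq mu (w k)) by rewrite fine_ge0 ?L2sq_ge0.
  have C0 : 0 <= fine (L2sq mu (u k)) by rewrite fine_ge0 ?L2sq_ge0.
  move: (fine (L2sq mu (w k))) (fine (L2sq mu (u k))) B0 C0 => B C B0 C0 h1 h2 hk.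
  have ti0 : 0 < 1 + t^-1 by rewrite addr_gt0// invr_gt0.
  have hk' : (1 + t^-1) * B <= eta / 4.
    rewrite (le_trans (ler_wpM2l (ltW ti0) hk))//.
    rewrite [leLHS](_ : _ = eta / 4)//; field.
    by rewrite gt_eqF//= -[X in _ + X]invrK; apply/lt0r_neq0; rewrite invrK; rewrite addr_gt0.
  have tA' : t * A <= eta / 4 by nra.
  split; first by nra.
  have CA : C <= 2 * A + eta by nra.
  by nra.
by apply: cvge_near => // k; exact: L2sq_ge0.
Qed.

(** Along indices [phi j] at which the squared distances are at most 8^-j, the
    series [F] of the functions 4^j |h_(j+1) - h_j|^2 is integrable, hence
    finite almost everywhere, and where it is finite the increments of [h] are
    of order 2^-j. The pointwise limit is the L^2 limit by Fatou's lemma. *)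
Theorem L2_complete (f : nat -> T -> R[i]) : (forall k, cmeas (f k)) ->
  (forall eta : R, 0 < eta -> exists K, forall k l, (K <= k)%N -> (K <= l)%N ->
     (L2sq mu (fun x => f k x - f l x)%R <= eta%:E)%E) ->
  exists2 g, cmeas g & L2sq mu (fun x => f k x - g x) @[k --> \oo] --> 0%E.
Proof.
move=> mf cau.
have /choice[Kf hK] : forall j : nat, exists K, forall k l, (K <= k)%N -> (K <= l)%N ->
     (L2sq mu (fun x => f k x - f l x)%R <= ((8^-1) ^+ j)%:E)%E.
  by move=> j; apply: cau; rewrite exprn_gt0.
(* The partial sums make the indices increasing and larger than Kf j. *)
pose phi j := (\sum_(i < j.+1) (Kf i).+1)%N.
have phiS j : (phi j <= phi j.+1)%N by rewrite /phi [leqRHS]big_ord_recr leq_addr.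
have phiK j : (Kf j <= phi j)%N by rewrite /phi big_ord_recr/= (leq_trans (leqnSn _))// leq_addl.
have phij j : (j <= phi j)%N.
  by elim: j => // j IH; rewrite /phi big_ord_recr/= addnS ltnS (leq_trans IH)// leq_addr.
pose h j := f (phi j).
have mh j : cmeas (h j) by exact: mf.
pose dd j x : R := sqn (h j.+1 x - h j x).
have mdd j : measurable_fun setT (dd j) by apply: measurable_sqn; exact: cmeasB.
have hdd j : (\int[mu]_x (dd j x)%:E <= ((8^-1) ^+ j)%:E)%E.
  by apply: hK => //; rewrite (leq_trans (phiK j)).
pose F x : \bar R := (\sum_(0 <= j <oo) (4 ^+ j * dd j x)%:E)%E.
have t0 j x : (0 <= (4 ^+ j * dd j x)%:E)%E by rewrite lee_fin mulr_ge0 ?exprn_ge0 ?sqn_ge0.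
have mt j : measurable_fun setT (fun x => (4 ^+ j * dd j x)%:E).
  by apply/measurable_EFinP; exact: measurable_funM.
have F0 x : (0 <= F x)%E by apply: nneseries_ge0 => j _.
have mF : measurable_fun setT F by apply: ge0_emeasurable_sum => // j x _ _.
have IF : (\int[mu]_x F x < +oo)%E.
  rewrite /F integral_nneseries//.
  apply: (@le_lt_trans _ _ (\sum_(0 <= j <oo) (geometric 1 2^-1 j)%:E)%E).
    apply: lee_nneseries => [j _ _|j _]; first by apply: integral_ge0 => x _.
    rewrite integral_EFinZ ?exprn_ge0//; last by move=> x; exact: sqn_ge0.
    rewrite (le_trans (lee_wpmul2l _ (hdd j)))// ?lee_fin ?exprn_ge0//.
    rewrite -exprMn /geometric/= mul1r (_ : 4 / 8 = 2^-1 :> R)//.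
    by lra.
  have gc : series (geometric 1 2^-1) @ \oo --> (1 * (1 - 2^-1)^-1 : R).
    by apply: cvg_geometric_series; rewrite ger0_norm//; lra.
  have /cvg_lim -> // : (\sum_(0 <= i < n) (geometric 1 2^-1 i : R)%:E)%E @[n --> \oo] --> (1 * (1 - 2^-1)^-1)%:E.
    under eq_fun do rewrite sumEFin.
    by apply: cvg_EFin; [exact: nearW|exact: gc].
  exact: ltry.
have Fae : {ae mu, forall x, F x < +oo}%E.
  have : {ae mu, forall x, setT x -> F x \is a fin_num}.
    apply: integrable_ae => //; apply/integrableP; split => //.
    by under eq_integral do rewrite gee0_abs//.
  by apply: filterS => x /(_ I); rewrite ge0_fin_numE.
pose G := [set x | F x < +oo]%E.
have mG : measurable G.
  by rewrite -(setTI G); apply: measurable_lte.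
(* Set to 0 where F is infinite, so that the limit exists everywhere. *)
pose h' j x := (\1_G x)%:C * h j x.
have mh' j : cmeas (h' j).
  by apply: cmeasM => //; apply: cmeas_real; exact: measurable_indic.
have h'E x : G x -> forall j, h' j x = h j x.
  by move=> Gx j; rewrite /h' indicE mem_set// mul1r.
have h'0 x : ~ G x -> forall j, h' j x = 0.
  by move=> Gx j; rewrite /h' indicE memNset// mul0r.
have cvgh x : cvg ((fun j => complex.Re (h' j x)) @ \oo) /\ cvg ((fun j => complex.Im (h' j x)) @ \oo).
  case: (asboolP (G x)) => Gx; last first.
    by split; under eq_fun do rewrite h'0//; exact: is_cvg_cst.
  have Ffin : F x \is a fin_num by rewrite ge0_fin_numE.
  have hj j : 4 ^+ j * dd j x <= fine (F x).
    rewrite -lee_fin fineK// (le_trans _ (nneseries_lim_ge j.+1 _))//.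
    by rewrite big_nat_recr//= leeDr// sume_ge0.
  have A0 : 0 <= fine (F x) by rewrite fine_ge0.
  have hdiff j (a : R) : a ^+ 2 <= dd j x -> `|a| <= Num.sqrt (fine (F x)) * 2^-1 ^+ j.
    move=> adj; rewrite -(@ler_pXn2r _ 2)// ?nnegrE//.
    rewrite real_normK ?num_real// (le_trans adj)// exprMn sqr_sqrtr//.
    rewrite (_ : (2^-1 ^+ j) ^+ 2 = (4 ^+ j)^-1); last first.
      by rewrite -exprM mulnC exprM -exprVn; congr (_ ^+ _); field.
    by rewrite ler_pdivlMr ?exprn_gt0// mulrC.
  split; apply: (geo_cvg (sqrtr_ge0 (fine (F x)))) => j; rewrite !h'E//.
    apply: hdiff => //; rewrite /dd /sqn; case: (h j.+1 x) => a b; case: (h j x) => a' b' /=.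
    by rewrite lerDl sqr_ge0.
  apply: hdiff => //; rewrite /dd /sqn; case: (h j.+1 x) => a b; case: (h j x) => a' b' /=.
  by rewrite lerDr sqr_ge0.
pose g x := limn (fun j => complex.Re (h' j x)) +i* limn (fun j => complex.Im (h' j x)).
have mg : cmeas g.
  split => /=.
    by apply: (@measurable_fun_cvg _ _ _ _ (fun j x => complex.Re (h' j x))) => [j|x _];
      [exact: (mh' j).1|exact: (cvgh x).1].
  by apply: (@measurable_fun_cvg _ _ _ _ (fun j x => complex.Im (h' j x))) => [j|x _];
      [exact: (mh' j).2|exact: (cvgh x).2].
exists g => //; apply/cvge0P => [k|eta eta0]; first exact: L2sq_ge0.
have [K hK'] := cau _ eta0.
exists K => // k /= Kk.
have ms j : measurable_fun setT (fun x => (sqn (f k x - h' j x))%:E).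
  by apply/measurable_EFinP/measurable_sqn/cmeasB.
have s0 j x : setT x -> (0 <= (sqn (f k x - h' j x))%:E)%E by rewrite lee_fin sqn_ge0.
have := fatou mu measurableT ms s0.
rewrite [X in (X <= _)%E -> _](_ : _ = L2sq mu (fun x => f k x - g x)); last first.
  apply: eq_integral => x _; apply: (cvg_limn_einf_sup _).1.
  apply: cvg_EFin; first exact: nearW.
  have [cr ci] := cvgh x.
  rewrite (_ : fine \o _ = fun j => (complex.Re (f k x) - complex.Re (h' j x)) ^+ 2 +
     (complex.Im (f k x) - complex.Im (h' j x)) ^+ 2); last first.
    by apply/funext => j; rewrite /= /sqn; case: (f k x); case: (h' j x).
  rewrite /g /sqn; case: (f k x) => a b /=.
  by under eq_fun do rewrite !expr2; rewrite !expr2; apply: cvgD; apply: cvgM;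
     apply: cvgB => //; exact: cvg_cst.
move=> /le_trans; apply; rewrite limn_einf_lim; apply: lime_le; first exact: is_cvg_einfs.
exists K => // j /= Kj.
apply: (@le_trans _ _ (\int[mu]_x (sqn (f k x - h' j x))%:E)%E).
  by apply: ereal_inf_lbound; exists j => /=.
apply: (@le_trans _ _ (L2sq mu (fun x => f k x - h j x)%R)).
  rewrite le_eqVlt; apply/orP; left; apply/eqP; apply: L2sq_ae.
  - exact: cmeasB.
  - exact: cmeasB.
  - by apply: filterS Fae => x Gx; rewrite h'E.
by apply: hK' => //; rewrite (leq_trans Kj).
Qed.

End complex_L2.

(** * Euclidean norm, L^2 norm and complex integrals *)

Section euclid.
Context {R : realType} {n : nat}.
Local Notation E := 'rV[R]_n.
Implicit Types x y : E.

Lemma dotv_ge0 x : 0 <= dotv x x.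
Proof. by apply: sumr_ge0 => i _; rewrite -expr2 sqr_ge0. Qed.

Lemma enorm_ge0 x : 0 <= enorm x. Proof. exact: sqrtr_ge0. Qed.

Lemma enorm_sqr x : enorm x ^+ 2 = dotv x x.
Proof. by rewrite sqr_sqrtr// dotv_ge0. Qed.

Lemma le_coord_enorm x i : `|x ord0 i| <= enorm x.
Proof.
rewrite -(@ler_pXn2r _ 2)// ?nnegrE ?enorm_ge0// enorm_sqr real_normK ?num_real//.
rewrite /dotv (bigD1 i)//= -expr2 lerDl; apply: sumr_ge0 => j _.
by rewrite -expr2 sqr_ge0.
Qed.

Lemma enorm_le x (M : R) : 0 <= M -> (forall i, `|x ord0 i| <= M) ->
  enorm x <= n%:R * M.
Proof.
move=> M0 xM; rewrite -(@ler_pXn2r _ 2)// ?nnegrE ?enorm_ge0 ?mulr_ge0//.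
rewrite enorm_sqr /dotv (@le_trans _ _ (\sum_(i < n) M ^+ 2))//.
  apply: ler_sum => i _; rewrite -expr2 -(real_normK (num_real _)).
  by rewrite lerXn2r// nnegrE.
rewrite sumr_const card_ord exprMn -[leLHS]mulr_natl.
apply: ler_wpM2r; first exact: sqr_ge0.
by rewrite -natrX ler_nat; case: (n) => // k; rewrite leq_pmulr.
Qed.

Lemma measurable_enorm : measurable_fun setT (@enorm R n).
Proof.
apply: (@measurableT_comp _ _ _ _ _ _ (@Num.sqrt R)).
  by apply: continuous_measurable_fun; exact: sqrt_continuous.
by apply: measurable_sum => i; apply: measurable_funM; exact: measurable_coord.
Qed.

Lemma measurable_enorm_le (r : R) : measurable [set x : E | enorm x <= r].
Proof.
rewrite (_ : [set x | _] = setT `&` enorm @^-1` `]-oo, r]%classic).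
  by apply: measurable_enorm.
by rewrite setTI; apply/seteqP; split => x /=; rewrite in_itv.
Qed.

Lemma measurable_enorm_leb (r : R) : measurable_fun setT (fun x : E => (enorm x <= r)%R%:R : R).
Proof.
apply: (measurableT_comp (f := fun b : bool => b%:R : R)) => //.
by apply: measurable_fun_ler => //; exact: measurable_enorm.
Qed.

Lemma enorm_opp x : enorm (- x) = enorm x.
Proof.
by rewrite /enorm /dotv; congr Num.sqrt; apply: eq_bigr => i _; rewrite !mxE mulrNN.
Qed.

(** For nonzero [gamma] its value at 0 is 0, in agreement with the convention of
    [riesz_energy] on the diagonal. *)
Definition riesz_kernel (gamma : R) (z : E) : R := (enorm z `^ gamma)^-1.

Lemma riesz_kernel_ge0 gamma (z : E) : 0 <= riesz_kernel gamma z.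
Proof. by rewrite invr_ge0 powR_ge0. Qed.

Lemma riesz_kernel_sym gamma (x y : E) : riesz_kernel gamma (x - y) = riesz_kernel gamma (y - x).
Proof. by rewrite /riesz_kernel -opprB enorm_opp. Qed.

Lemma measurable_riesz_kernel gamma : measurable_fun setT (riesz_kernel gamma).
Proof.
rewrite (_ : riesz_kernel gamma = fun z : E => enorm z `^ (- gamma)).
  by apply: (@measurableT_comp _ _ _ _ _ _ (@powR R ^~ (- gamma))) => //; exact: measurable_enorm.
by apply/funext => z; rewrite powRN.
Qed.

End euclid.

Section L2norm_theory.
Context {R : realType} {n : nat}.
Local Notation E := 'rV[R]_n.
Local Notation L := (@leb R n).
Implicit Types u v : E -> R[i].

Lemma poweR2 (x : \bar R) : (0 <= x)%E -> (x `^ 2 = x ^+ 2)%E.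
Proof.
case: x => [r|_|//]; first by rewrite lee_fin => r0; rewrite poweR_EFin powR_mulrn// EFin_expe.
by rewrite poweRyr ?pnatr_eq0// expe2 mulyy.
Qed.

Lemma L2norm_ge0 u : (0 <= L2norm u)%E. Proof. exact: Lnorm_ge0. Qed.

Lemma L2norm_sqr u : (L2norm u ^+ 2)%E = L2sq L u.
Proof.
rewrite -poweR2 ?L2norm_ge0// /L2norm poweR_Lnorm//; apply: eq_integral => x _.
rewrite abse_EFin poweR_EFin; congr (_%:E).
by rewrite powR_mulrn// real_normK ?num_real// sqr_normc.
Qed.

Lemma L2norm_le u (eta : R) : 0 <= eta -> (L2norm u <= eta%:E)%E = (L2sq L u <= (eta ^+ 2)%:E)%E.
Proof.
move=> eta0; rewrite -L2norm_sqr; have := L2norm_ge0 u.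
case: (L2norm u) => [r|_|//]; last by rewrite expe2 mulyy.
rewrite lee_fin => r0; rewrite -EFin_expe !lee_fin.
by rewrite ler_pXn2r.
Qed.

Lemma L2norm_lty u : (L2norm u < +oo)%E = (L2sq L u < +oo)%E.
Proof.
rewrite -L2norm_sqr; have := L2norm_ge0 u.
case: (L2norm u) => [r|_|//]; last by rewrite expe2 mulyy.
by rewrite -EFin_expe !ltry.
Qed.

Lemma inL2E u : inL2 u <-> cmeas u /\ (L2sq L u < +oo)%E.
Proof. by rewrite /inL2 L2norm_lty. Qed.

Lemma cvg_L2norm (u : nat -> E -> R[i]) :
  L2norm (u k) @[k --> \oo] --> 0%E <-> L2sq L (u k) @[k --> \oo] --> 0%E.
Proof.
split.
  move=> /(cvge0P (fun k => L2norm_ge0 (u k))).1 h; apply/cvge0P => [k|eta eta0]; first exact: L2sq_ge0.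
  have s0 : 0 < Num.sqrt eta by rewrite sqrtr_gt0.
  have := h _ s0; apply: filterS => k.
  by rewrite L2norm_le ?(ltW s0)// [X in X%:E]sqr_sqrtr// ltW.
move=> /(cvge0P (fun k => L2sq_ge0 L (u k))).1 h; apply/cvge0P => [k|eta eta0]; first exact: L2norm_ge0.
have s0 : 0 < eta ^+ 2 by rewrite exprn_gt0.
by have := h _ s0; apply: filterS => k; rewrite (L2norm_le _ (ltW eta0)).
Qed.

End L2norm_theory.

Section Cintegral_theory.
Context {R : realType} {n : nat}.
Local Notation E := 'rV[R]_n.
Local Notation L := (@leb R n).
Implicit Types u v : E -> R[i].

Definition cintegrable u := L.-integrable setT (fun x => (complex.Re (u x))%:E) /\
  L.-integrable setT (fun x => (complex.Im (u x))%:E).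

Lemma cintegrable_cmeas u : cintegrable u -> cmeas u.
Proof. by case=> /integrable_measurable ? /integrable_measurable ?; split. Qed.

Lemma Cintegral_lin (a : R[i]) u v : cintegrable u -> cintegrable v ->
  Cintegral (fun x => a * u x + v x) = a * Cintegral u + Cintegral v.
Proof.
case: a => p q [ur ui] [vr vi]; rewrite /Cintegral.
rewrite (_ : _ * _ + _ =
  ((p * (\int[L]_x complex.Re (u x)) - q * (\int[L]_x complex.Im (u x))) + \int[L]_x complex.Re (v x)) +i*
  ((p * (\int[L]_x complex.Im (u x)) + q * (\int[L]_x complex.Re (u x))) + \int[L]_x complex.Im (v x)))//.
congr (_ +i* _).
- rewrite -!RintegralZl// -RintegralB ?rintegrableZl// -RintegralD//; last first.
    by apply: rintegrableB; exact: rintegrableZl.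
  by apply: eq_Rintegral => x _; case: (u x); case: (v x).
- rewrite -!RintegralZl// -RintegralD ?rintegrableZl// -RintegralD//; last first.
    by apply: rintegrableD; exact: rintegrableZl.
  by apply: eq_Rintegral => x _; case: (u x); case: (v x).
Qed.

Lemma cintegrable_bounded_mul (b : E -> R[i]) u : cmeas b -> (forall x, sqn (b x) <= 1) ->
  cintegrable u -> cintegrable (fun x => b x * u x).
Proof.
move=> mb b1 iu; have [ur ui] := iu; have mu := cintegrable_cmeas iu.
have [mr mi] := cmeasM mb mu.
have idom : L.-integrable setT (fun x => (`|complex.Re (u x)| + `|complex.Im (u x)|)%:E).
  by apply: rintegrableD; apply: integrable_norm.
have bb x : `|complex.Re (b x)| <= 1 /\ `|complex.Im (b x)| <= 1.
  have := b1 x; rewrite /sqn; move: (complex.Re (b x)) (complex.Im (b x)) => p q h.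
  by split; rewrite -(@ler_pXn2r _ 2)// ?nnegrE// expr1n real_normK ?num_real//;
    have := sqr_ge0 p; have := sqr_ge0 q; lra.
split; apply: (rintegrable_dominated _ idom) => // x; have [] := bb x;
    case: (b x) => p q; case: (u x) => c e /= p1 q1.
  by rewrite (le_trans (ler_normB _ _))// !normrM lerD// ler_piMl.
by rewrite addrC (le_trans (ler_normD _ _))// !normrM lerD// ler_piMl.
Qed.

Lemma expi_cmeas (xi : E) : cmeas (fun x => expi (- dotv x xi)).
Proof.
split => /=.
- apply: (measurableT_comp (@measurable_cos R)); apply: measurableT_comp => //.
  exact: measurable_dotv.
- apply: (measurableT_comp (@measurable_sin R)); apply: measurableT_comp => //.
  exact: measurable_dotv.
Qed.

Lemma sqn_expi (t : R) : sqn (expi t) = 1.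
Proof. by rewrite /sqn /= cos2Dsin2. Qed.

Lemma fourierL1_lin (a : R[i]) u v xi : cintegrable u -> cintegrable v ->
  fourierL1 (fun x => a * u x + v x) xi = a * fourierL1 u xi + fourierL1 v xi.
Proof.
move=> iu iv; rewrite /fourierL1.
have ex w : cintegrable w -> cintegrable (fun x => expi (- dotv x xi) * w x).
  move=> iw; apply: cintegrable_bounded_mul => //; first exact: expi_cmeas.
  by move=> x; rewrite sqn_expi.
rewrite (_ : (fun x => _) = fun x => a * (expi (- dotv x xi) * u x) + expi (- dotv x xi) * v x).
  by rewrite Cintegral_lin; [ring|exact: ex|exact: ex].
by apply/funext => x; ring.
Qed.

End Cintegral_theory.

(** * The Fourier transform on L^2 *)

Section fourier_L2.
Context {R : realType} {n : nat}.
Local Notation E := 'rV[R]_n.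
Local Notation L := (@leb R n).
Implicit Types u v w f g h : E -> R[i].

(** The functions that have both an integral transform and, by
    [plancherel_bounded], a Plancherel identity; every truncation of an L^2
    function is one of them. *)
Definition bsupp_L2 u := [/\ cmeas u, (L2sq L u < +oo)%E &
  exists2 rho : R, 0 <= rho & forall x, rho < enorm x -> u x = 0].

Lemma L2sq_lin_fin (a : R[i]) u v : cmeas u -> cmeas v ->
  (L2sq L u < +oo)%E -> (L2sq L v < +oo)%E -> (L2sq L (fun x => a * u x + v x)%R < +oo)%E.
Proof.
move=> mu mv u2 v2.
have mau : cmeas (fun x => a * u x) by apply: cmeasM => //; exact: cmeas_cst.
apply: (le_lt_trans (L2sqD_le2 _ mau mv)); rewrite L2sqZ//.
by rewrite lte_add_pinfty// ?lte_mul_pinfty ?lee_fin ?sqn_ge0 ?mule_ge0 ?lee_fin ?sqn_ge0 ?L2sq_ge0 ?ltry.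
Qed.

Lemma cmeas_lin (a : R[i]) u v : cmeas u -> cmeas v -> cmeas (fun x => a * u x + v x).
Proof. by move=> mu mv; apply: cmeasD => //; apply: cmeasM => //; exact: cmeas_cst. Qed.

Lemma bsupp_L2_lin (a : R[i]) u v : bsupp_L2 u -> bsupp_L2 v -> bsupp_L2 (fun x => a * u x + v x).
Proof.
move=> [mu u2 [p p0 up]] [mv v2 [q q0 vq]]; split.
- exact: cmeas_lin.
- exact: L2sq_lin_fin.
- exists (Num.max p q) => [|x]; first by rewrite le_max p0.
  by rewrite gt_max => /andP[px qx]; rewrite up// vq// mulr0 addr0.
Qed.

Lemma bsupp_L2_cint u : bsupp_L2 u -> cintegrable u.
Proof.
move=> [mu u2 [p p0 up]].
apply: (integrable_bounded_support mu (measurable_box 0 p)) => //.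
  by rewrite leb_box// ltry.
move=> x nx; apply: up; rewrite ltNge; apply/negP => xp; apply: nx => i.
by rewrite mxE subr0 (le_trans (le_coord_enorm _ _)).
Qed.

Lemma bsupp_L2_plancherel u : bsupp_L2 u -> L2sq L (fourierL1 u) = L2sq L u.
Proof.
move=> [mu u2 [p p0 up]]; apply: (plancherel_bounded (rho := p)) => //.
move=> x nx; apply: up; rewrite ltNge; apply/negP => xp; apply: nx => i.
by rewrite mxE subr0 (le_trans (le_coord_enorm _ _)).
Qed.

Lemma bsupp_L2_cmeas_fourier u : bsupp_L2 u -> cmeas (fourierL1 u).
Proof. by move=> /bsupp_L2_cint[? ?]; exact: measurable_fourierL1. Qed.

Lemma truncate_bsupp_L2 k u : cmeas u -> (L2sq L u < +oo)%E -> bsupp_L2 (truncate k u).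
Proof.
move=> mu u2.
have mt : cmeas (truncate k u).
  rewrite (_ : truncate k u = fun x => (\1_[set y | enorm y <= k%:R] x)%:C * u x).
    apply: cmeasM => //; apply: cmeas_real; apply: measurable_indic.
    exact: measurable_enorm_le.
  apply/funext => x; rewrite /truncate indicE.
  case: ifPn => h; first by rewrite mem_set// mul1r.
  by rewrite memNset ?mul0r//; exact/negP.
split => //.
  apply: (le_lt_trans _ u2); apply: L2sq_le => // x; rewrite /truncate.
  by case: ifP => // _; rewrite sqn0 sqn_ge0.
by exists k%:R => // x; rewrite /truncate ltNge; case: ifP.
Qed.

Lemma cvg_truncate u : cmeas u -> (L2sq L u < +oo)%E ->
  L2sq L (fun x => truncate k u x - u x) @[k --> \oo] --> 0%E.
Proof.
move=> mu u2; apply: (@dominated_cvg0 _ _ _ _ _ (fun x => sqn (u x))) => //.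
- by move=> k; apply/measurable_sqn/cmeasB => //; have [] := truncate_bsupp_L2 k mu u2.
- exact: measurable_sqn.
- by move=> k x; exact: sqn_ge0.
- move=> k x; rewrite /truncate; case: ifP => _; last by rewrite sub0r sqnN.
  by rewrite subrr sqn0 sqn_ge0.
- move=> x; apply: cvg_near_cst; exists (Num.truncn (enorm x)).+1 => // k /= xk.
  rewrite /truncate ifT ?subrr ?sqn0//.
  have := truncnS_gt (enorm x) => /ltW /le_trans; apply.
  by rewrite ler_nat.
Qed.

Lemma fourierL1B u v xi : cintegrable u -> cintegrable v ->
  fourierL1 u xi - fourierL1 v xi = fourierL1 (fun x => u x - v x) xi.
Proof.
move=> iu iv; rewrite addrC -[X in X + _]mulN1r -fourierL1_lin//.
rewrite (_ : (fun x => -1 * v x + u x) = fun x => u x - v x)//.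
by apply/funext => x; rewrite mulN1r addrC.
Qed.

Lemma is_fourierE u g : is_fourier u g <-> [/\ cmeas g, (L2sq L g < +oo)%E &
  L2sq L (fun xi => fourierL1 (truncate k u) xi - g xi) @[k --> \oo] --> 0%E].
Proof.
split; first by move=> [/inL2E[mg g2] /cvg_L2norm h].
by move=> [mg g2 h]; split; [exact/inL2E|exact/cvg_L2norm].
Qed.

(** The transforms of the truncations form a Cauchy sequence because, by
    Plancherel, they are at the same distances as the truncations themselves;
    [L2_complete] provides the limit that [fourier] selects. *)
Lemma fourierP u : inL2 u -> is_fourier u (fourier u).
Proof.
move=> /inL2E[mu u2].
pose t k := truncate k u.
have bt k : bsupp_L2 (t k) by exact: truncate_bsupp_L2.
pose f k := fourierL1 (t k).
have mf k : cmeas (f k) by exact: bsupp_L2_cmeas_fourier.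
have mt k : cmeas (t k) by have [] := bt k.
have fB k l : L2sq L (fun x => f k x - f l x) = L2sq L (fun x => t k x - t l x).
  rewrite (_ : (fun x => f k x - f l x) = fourierL1 (fun x => t k x - t l x)); last first.
    by apply/funext => xi; rewrite fourierL1B//; exact: bsupp_L2_cint.
  apply: bsupp_L2_plancherel.
  rewrite (_ : (fun x => t k x - t l x) = fun x => -1 * t l x + t k x).
    exact: bsupp_L2_lin.
  by apply/funext => x; rewrite mulN1r addrC.
have [|g mg fg] := L2_complete (mu := L) mf.
  move=> eta eta0.
  have e4 : 0 < eta / 4 by rewrite divr_gt0.
  have [K _ hK] := (cvge0P (fun k => L2sq_ge0 L (fun x => truncate k u x - u x))).1 (cvg_truncate mu u2) _ e4.
  exists K => k l Kk Kl; rewrite fB (le_trans (L2sq_triangle _ (mt k) mu (mt l)))//.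
  rewrite (L2sqB_sym L u) (_ : eta%:E = 2%:E * (eta / 4)%:E + 2%:E * (eta / 4)%:E)%E; last first.
    by rewrite -!EFinM -EFinD; congr (_%:E); field.
  apply: leeD; apply: lee_wpmul2l; rewrite ?lee_fin//.
  - exact: hK.
  - exact: hK.
rewrite /fourier; apply: (@xgetPex _ _ _ ).
exists g; apply/is_fourierE; split => //.
have [K _ /(_ _ (leqnn K)) hK] := (cvge0P (fun k => L2sq_ge0 L (fun x => f k x - g x))).1 fg _ ltr01.
apply: (L2sq_fin_sub (v := f K)) => //.
  by rewrite bsupp_L2_plancherel//; have [] := bt K.
by rewrite L2sqB_sym (le_lt_trans hK)// ltry.
Qed.

Lemma is_fourier_L2sq u g : inL2 u -> is_fourier u g -> L2sq L g = L2sq L u.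
Proof.
move=> /inL2E[mu u2] /is_fourierE[mg g2 fg].
have bt k := truncate_bsupp_L2 k mu u2.
have h1 := cvg_L2sq (fun k => bsupp_L2_cmeas_fourier (bt k)) mg g2 fg.
have h2 : L2sq L (truncate k u) @[k --> \oo] --> L2sq L u.
  by apply: cvg_L2sq => //; [move=> k; have [] := bt k|exact: cvg_truncate].
apply: (cvg_unique (@ereal_hausdorff R) h1).
rewrite /= (_ : (fun k => L2sq L (fourierL1 _)) = fun k => L2sq L (truncate k u))//.
by apply/funext => k; exact: bsupp_L2_plancherel.
Qed.

Lemma is_fourier_unique u g h : inL2 u -> is_fourier u g -> is_fourier u h ->
  {ae L, forall x, g x = h x}.
Proof.
move=> /inL2E[mu u2] /is_fourierE[mg g2 fg] /is_fourierE[mh h2 fh].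
have : {ae L, forall x, g x - h x = 0}.
  apply: L2sq_eq0; first exact: cmeasB.
  have bt k := truncate_bsupp_L2 k mu u2.
  have : L2sq L (fun x => g x - h x) @[k --> \oo] --> 0%E.
    apply: (cvge0_le _ _ (cvge0D (cvge0Z 2 fg) (cvge0Z 2 fh))).
      by move=> k; exact: L2sq_ge0.
    move=> k; rewrite (L2sqB_sym L _ g); apply: L2sq_triangle => //.
    exact: bsupp_L2_cmeas_fourier.
  by move=> h0; apply: (cvg_unique (@ereal_hausdorff R) _ h0); exact: cvg_cst.
by apply: filterS => x /eqP; rewrite subr_eq0 => /eqP.
Qed.

Lemma is_fourier_lin (a : R[i]) u w g h : inL2 u -> inL2 w ->
  is_fourier u g -> is_fourier w h ->
  is_fourier (fun x => a * u x + w x) (fun x => a * g x + h x).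
Proof.
move=> /inL2E[mu u2] /inL2E[mw w2] /is_fourierE[mg g2 fg] /is_fourierE[mh h2 fh].
apply/is_fourierE; split; [exact: cmeas_lin|exact: L2sq_lin_fin|].
have bu k := truncate_bsupp_L2 k mu u2.
have bw k := truncate_bsupp_L2 k mw w2.
apply: (cvge0_le _ _ (cvge0D (cvge0Z 2 (cvge0Z (sqn a) fg)) (cvge0Z 2 fh))).
  by move=> k; exact: L2sq_ge0.
move=> k.
have m1 : cmeas (fun xi => fourierL1 (truncate k u) xi - g xi).
  by apply: cmeasB => //; exact: bsupp_L2_cmeas_fourier.
have m2 : cmeas (fun xi => fourierL1 (truncate k w) xi - h xi).
  by apply: cmeasB => //; exact: bsupp_L2_cmeas_fourier.
rewrite -L2sqZ//; rewrite [X in (L2sq L X <= _)%E](_ : _ =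
  fun xi => a * (fourierL1 (truncate k u) xi - g xi) + (fourierL1 (truncate k w) xi - h xi)).
  by apply: L2sqD_le2 => //; apply: cmeasM => //; exact: cmeas_cst.
apply/funext => xi; rewrite (_ : truncate k _ = fun x => a * truncate k u x + truncate k w x).
  by rewrite fourierL1_lin//; [ring|exact: bsupp_L2_cint|exact: bsupp_L2_cint].
by apply/funext => x; rewrite /truncate; case: ifP => // _; rewrite mulr0 addr0.
Qed.

Lemma inL2_lin (a : R[i]) u w : inL2 u -> inL2 w -> inL2 (fun x => a * u x + w x).
Proof.
move=> /inL2E[mu u2] /inL2E[mw w2]; apply/inL2E; split; first exact: cmeas_lin.
exact: L2sq_lin_fin.
Qed.

Lemma fourier_inL2 u : inL2 u -> cmeas (fourier u) /\ (L2sq L (fourier u) < +oo)%E.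
Proof. by move=> /fourierP /is_fourierE[]. Qed.

Lemma L2sq_fourier u : inL2 u -> L2sq L (fourier u) = L2sq L u.
Proof. by move=> u2; apply: is_fourier_L2sq => //; exact: fourierP. Qed.

(** Only almost everywhere: [fourier] picks an arbitrary representative of the
    L^2 limit. *)
Lemma fourier_lin (a : R[i]) u w : inL2 u -> inL2 w ->
  {ae L, forall xi, fourier (fun x => a * u x + w x) xi = a * fourier u xi + fourier w xi}.
Proof.
move=> u2 w2; apply: (@is_fourier_unique (fun x => a * u x + w x)).
- exact: inL2_lin.
- by apply: fourierP; exact: inL2_lin.
- by apply: is_fourier_lin => //; exact: fourierP.
Qed.

Lemma bsupp_L2_inL2 u : bsupp_L2 u -> inL2 u.
Proof. by case=> mu u2 _; exact/inL2E. Qed.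

Lemma fourier_bsupp_L2 u : bsupp_L2 u -> {ae L, forall xi, fourier u xi = fourierL1 u xi}.
Proof.
move=> bu; have u2 := bsupp_L2_inL2 bu; apply: (is_fourier_unique u2); first exact: fourierP.
apply/is_fourierE; split; first exact: bsupp_L2_cmeas_fourier.
  by rewrite bsupp_L2_plancherel//; case: bu.
case: bu => mu _ [p p0 up]; apply: cvg_near_cst.
exists (Num.truncn p).+1 => // k /= pk.
rewrite (_ : truncate k u = u).
  by rewrite /L2sq; under eq_integral do rewrite subrr sqn0; rewrite integral0.
apply/funext => x; rewrite /truncate; case: ifPn => //; rewrite -ltNge => kx.
rewrite up// (le_lt_trans _ kx)// (le_trans (ltW (truncnS_gt p)))// ler_nat//.
Qed.

End fourier_L2.

(** * Cauchy-Schwarz on boxes and dyadic sums *)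

Section cauchy_schwarz.
Context {R : realType} {n : nat}.
Local Notation E := 'rV[R]_n.
Local Notation L := (@leb R n).

(** Integrate 2 t f <= f^2 + t^2 over [B] and take for [t] the mean of [f]. *)
Lemma cauchy_schwarz_set (f : E -> R) (B : set E) (b : R) : measurable B -> L B = b%:E ->
  0 < b -> L.-integrable setT (EFin \o f) -> (forall x, ~ B x -> f x = 0) ->
  (((\int[L]_x f x)%R ^+ 2)%:E <= b%:E * \int[L]_x (f x ^+ 2)%:E)%E.
Proof.
move=> mB LB b0 fi fB.
have mf := integrable_measurable fi.
have ff2 : measurable_fun setT (fun x => f x ^+ 2) by exact: measurable_funX.
set Q := (\int[L]_x (f x ^+ 2)%:E)%E.
have Q0 : (0 <= Q)%E by apply: integral_ge0 => x _; rewrite lee_fin sqr_ge0.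
have [Qfin|] := boolP (Q \is a fin_num); last first.
  rewrite ge0_fin_numE// ltey negbK => /eqP ->.
  by rewrite gt0_muley ?lte_fin// leey.
set A := (\int[L]_x f x)%R; pose t := A / b.
have iB : L.-integrable setT (fun x => (\1_B x)%:E).
  apply/integrableP; split; first by apply/measurable_EFinP; exact: measurable_indic.
  under eq_integral do rewrite /= ger0_norm//.
  by rewrite integral_indic// setIT [X in (X < _)%E]LB ltry.
have if2 : L.-integrable setT (fun x => (f x ^+ 2)%:E).
  apply/integrableP; split; first exact/measurable_EFinP.
  under eq_integral do rewrite /= ger0_norm ?sqr_ge0//.
  by rewrite -ge0_fin_numE.
have h : (2 * t) * A <= fine Q + t ^+ 2 * b.
  have -> : fine Q + t ^+ 2 * b = (\int[L]_x (f x ^+ 2 + t ^+ 2 * \1_B x))%R.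
    rewrite RintegralD//; last exact: rintegrableZl.
    rewrite RintegralZl//; congr (_ + _ * _).
    by rewrite /Rintegral integral_indic// setIT [X in fine X]LB.
  rewrite -RintegralZl//; apply: le_Rintegral => //.
  - exact: rintegrableZl.
  - by apply: rintegrableD => //; exact: rintegrableZl.
  move=> x _; rewrite indicE; have [xB|xB] := boolP (x \in B).
    by rewrite mulr1 -subr_ge0; have := sqr_ge0 (f x - t); nra.
  by rewrite fB ?mulr0 ?expr0n/= ?addr0//; move/negP : xB; rewrite inE.
rewrite -(fineK Qfin) -EFinM lee_fin.
move: h; rewrite /t => h.
have e : 2 * (A / b) * A - (A / b) ^+ 2 * b = A ^+ 2 / b by field; rewrite gt_eqF.
by rewrite mulrC -ler_pdivrMr// -e; lra.
Qed.

(** The quantitative form of the uncertainty principle used below: a function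
    concentrated in a small set has a flat transform. *)
Lemma sqn_fourierL1_le (u : E -> R[i]) (B : set E) (b : R) xi : cmeas u ->
  measurable B -> L B = b%:E -> 0 < b -> (L2sq L u < +oo)%E ->
  (forall x, ~ B x -> u x = 0) ->
  ((sqn (fourierL1 u xi))%:E <= (((2 * pi) ^+ n)^-1 * b)%:E * L2sq L u)%E.
Proof.
move=> mu mB LB b0 u2 uB.
have Lfin : (L B < +oo)%E by rewrite LB ltry.
have iu := integrable_bounded_support mu mB Lfin uB u2.
pose w x := expi (- dotv x xi) * u x.
have iw : cintegrable w.
  apply: cintegrable_bounded_mul => //; first exact: expi_cmeas.
  by move=> x; rewrite sqn_expi.
have mw := cintegrable_cmeas iw.
have wB x : ~ B x -> w x = 0 by move=> /uB; rewrite /w => ->; rewrite mulr0.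
have N2w : L2sq L w = L2sq L u.
  by apply: eq_integral => x _; rewrite sqnM sqn_expi mul1r.
have p0 : 0 <= 2 * pi :> R by rewrite mulr_ge0 ?pi_ge0.
rewrite /fourierL1 sqnM sqn_real powRN exprVn.
rewrite (_ : ((2 * pi) `^ (n%:R / 2)) ^+ 2 = (2 * pi) ^+ n); last first.
  by rewrite -powR_mulrn ?powR_ge0// -powRrM divfK// powR_mulrn.
rewrite EFinM EFinM -muleA lee_pmul2l ?lte_fin ?invr_gt0 ?exprn_gt0 ?mulr_gt0 ?pi_gt0//.
rewrite -N2w /sqn /= EFinD.
have e : L2sq L w = (\int[L]_x (complex.Re (w x) ^+ 2)%:E + \int[L]_x (complex.Im (w x) ^+ 2)%:E)%E.
  rewrite /L2sq /sqn integral_EFinD//; try by move=> x; exact: sqr_ge0.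
  - by apply: measurable_funX; exact: mw.1.
  - by apply: measurable_funX; exact: mw.2.
rewrite e ge0_muleDr; last 2 first.
- by apply: integral_ge0 => x _; rewrite lee_fin sqr_ge0.
- by apply: integral_ge0 => x _; rewrite lee_fin sqr_ge0.
apply: leeD.
- by apply: (cauchy_schwarz_set (f := fun x => complex.Re (w x)) mB) => //; [exact: iw.1|move=> x /wB ->].
- by apply: (cauchy_schwarz_set (f := fun x => complex.Im (w x)) mB) => //; [exact: iw.2|move=> x /wB ->].
Qed.

End cauchy_schwarz.

Section dyadic.
Context {R : realType}.

Lemma dyadic_scale (t r : R) : 0 < t -> t <= r ->
  exists j, r * 2^-1 ^+ j.+1 < t /\ t <= r * 2^-1 ^+ j.
Proof.
move=> t0 tr.
have [j hj] : exists j, r * 2^-1 ^+ j < t.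
  have r0 : 0 < r by exact: lt_le_trans tr.
  have := @cvg_geometric R r 2^-1; rewrite ger0_norm// => /(_ _)/cvgrPdist_lt.
  have l1 : 2^-1 < 1 :> R by lra.
  move=> /(_ l1 _ t0)[j _ /(_ _ (leqnn j))]; rewrite /geometric/= sub0r normrN.
  by rewrite ger0_norm ?mulr_ge0 ?exprn_ge0 ?ltW//; exists j.
elim: j hj => [|j IH]; first by rewrite expr0 mulr1 => /lt_le_trans/(_ tr); rewrite ltxx.
move=> h; have [/IH//|h'] := ltP (r * 2^-1 ^+ j) t.
by exists j.
Qed.

(** [2 `^ p] is the variation of the kernel over one dyadic shell; the other
    factor sums the geometric series of ratio 2^-(q - p). *)
Definition dyadic_const (p q : R) := 2 `^ p / (1 - 2^-1 `^ (q - p)).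

Lemma powRV2 (p : R) : 2^-1 `^ p = (2 `^ p)^-1.
Proof. by rewrite -powR_inv1// -powRrM mulN1r powRN. Qed.

Lemma half_powR_lt1 (p q : R) : p < q -> 2^-1 `^ (q - p) < 1 :> R.
Proof.
move=> pq; rewrite /powR gt_eqF// -[ltRHS]expR0 ltr_expR pmulr_rlt0 ?subr_gt0//.
by rewrite ln_lt0//; apply/andP; split; lra.
Qed.

Lemma dyadic_const_gt0 p q : p < q -> 0 < dyadic_const p q.
Proof.
move=> pq; rewrite /dyadic_const divr_gt0 ?powR_gt0// subr_gt0.
exact: half_powR_lt1.
Qed.

Context {n : nat}.
Local Notation E := 'rV[R]_n.
Local Notation L := (@leb R n).

Lemma measurable_subr (x : E) : measurable_fun setT (fun y : E => y - x).
Proof.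
apply: measurable_fun_rVP => i.
rewrite (_ : _ \o _ = fun y : E => y ord0 i - x ord0 i).
  by apply: measurable_funB => //; exact: measurable_coord.
by apply/funext => y; rewrite /= /rV_coord !mxE.
Qed.

Let rad (r : R) j := r * 2^-1 ^+ j.
Let wt (p r : R) (x0 : E) j (y : E) := ((rad r j.+1) `^ p)^-1 * \1_(box x0 (rad r j)) y.

Let wt_ge0 p r x0 j y : 0 <= wt p r x0 j y.
Proof. by rewrite mulr_ge0 ?invr_ge0 ?powR_ge0. Qed.

(** On the shell where [enorm (y - x0)] lies between [rad r j.+1] and [rad r j]
    the [j]-th term alone dominates. *)
Let kernel_le_wt p r x0 y : 0 < p ->
  (((enorm (y - x0) <= r)%R%:R * riesz_kernel p (y - x0))%:E <=
    \sum_(0 <= j <oo) (wt p r x0 j y)%:E)%E.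
Proof.
move=> p0; rewrite /riesz_kernel; set t := enorm (y - x0).
have S0 : (0 <= \sum_(0 <= j <oo) (wt p r x0 j y)%:E)%E.
  by apply: nneseries_ge0 => j _ _; rewrite lee_fin wt_ge0.
have [tr|tr] := leP t r; last by rewrite mul0r.
have [t0|] := ltP 0 t; last first.
  move=> t_le; have -> : t = 0 by apply/eqP; rewrite eq_le t_le enorm_ge0.
  by rewrite powR0 ?gt_eqF// invr0 mulr0.
have [j [h1 h2]] := dyadic_scale t0 tr.
have r0 : 0 < r by exact: lt_le_trans tr.
rewrite mul1r (@le_trans _ _ (wt p r x0 j y)%:E)//.
  rewrite lee_fin /wt indicE mem_set ?mulr1.
    rewrite lef_pV2 ?posrE ?powR_gt0 ?mulr_gt0 ?exprn_gt0//.
    by rewrite ge0_ler_powR ?nnegrE ?(ltW p0) ?(ltW h1) ?(ltW t0)// mulr_ge0 ?(ltW r0).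
  move=> i; have := le_coord_enorm (y - x0) i.
  by rewrite !mxE => /le_trans; apply.
have := @nneseries_lim_ge R (fun j => (wt p r x0 j y)%:E) xpredT 0 j.+1.
move=> /(_ _)/(le_trans _); apply; last by move=> k _ _; rewrite lee_fin wt_ge0.
rewrite big_nat_recr//= leeDr// sume_ge0// => k _.
by rewrite lee_fin wt_ge0.
Qed.

(** The kernel is dominated shell by shell by a multiple of the indicator of a
    box, and the masses of the boxes decay fast enough for the resulting
    series to be geometric. *)
Lemma dyadic_integral (f : E -> R) (x0 : E) (p q r a : R) :
  measurable_fun setT f -> (forall y, 0 <= f y) -> 0 < p -> p < q -> 0 < r -> 0 <= a ->
  (forall rho, 0 < rho -> rho <= r ->
     (\int[L]_y (f y * \1_(box x0 rho) y)%:E <= (a * rho `^ q)%:E)%E) ->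
  (\int[L]_y (f y * ((enorm (y - x0) <= r)%R%:R * riesz_kernel p (y - x0)))%:E
    <= (a * r `^ (q - p) * dyadic_const p q)%:E)%E.
Proof.
move=> mf f0 p0 pq r0 a0 hf.
have mB j : measurable (box x0 (rad r j)) by exact: measurable_box.
have mwt j : measurable_fun setT (wt p r x0 j).
  by apply: measurable_funM => //; exact: measurable_indic.
have mfwt j : measurable_fun setT (fun y => (f y * wt p r x0 j y)%:E).
  by apply/measurable_EFinP; exact: measurable_funM.
have fwt0 j y : (0 <= (f y * wt p r x0 j y)%:E)%E by rewrite lee_fin mulr_ge0 ?wt_ge0.
apply: (@le_trans _ _ (\int[L]_y (\sum_(0 <= j <oo) (f y * wt p r x0 j y)%:E))%E).
  apply: ge0_le_integral => //.
  - by move=> y _; rewrite lee_fin !mulr_ge0// invr_ge0 powR_ge0.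
  - apply/measurable_EFinP; apply: measurable_funM => //; apply: measurable_funM.
      exact: (measurableT_comp (measurable_enorm_leb r) (measurable_subr x0)).
    exact: (measurableT_comp (measurable_riesz_kernel p) (measurable_subr x0)).
  - by apply: ge0_emeasurable_sum => // j y _ _.
  move=> y _; rewrite EFinM (le_trans (lee_wpmul2l _ (kernel_le_wt _ _ _ p0)))// ?lee_fin//.
  by rewrite -nneseriesZl// => j _; rewrite lee_fin wt_ge0.
rewrite integral_nneseries//.
pose b := 2^-1 `^ (q - p) : R.
apply: (@le_trans _ _ (\sum_(0 <= j <oo) (geometric (a * 2 `^ p * r `^ (q - p)) b j)%:E)%E).
  apply: lee_nneseries => [j _ _|j _]; first by apply: integral_ge0 => y _.
  have rj : 0 < rad r j by rewrite mulr_gt0 ?exprn_gt0.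
  under eq_integral do rewrite mulrCA.
  rewrite integral_EFinZ ?invr_ge0 ?powR_ge0//; last 2 first.
  - by apply: measurable_funM => //; exact: measurable_indic.
  - by move=> y; rewrite mulr_ge0.
  rewrite (le_trans (lee_wpmul2l _ (hf _ rj _)))//.
  - by rewrite lee_fin invr_ge0 powR_ge0.
  - by rewrite /rad ler_piMr ?(ltW r0)// exprn_ile1//; lra.
  have e1 : rad r j.+1 = rad r j * 2^-1 by rewrite /rad exprSr mulrA.
  rewrite -EFinM lee_fin e1 powRM ?(ltW rj)// powRV2 invfM invrK /geometric/=.
  rewrite [leLHS](_ : _ = a * 2 `^ p * (rad r j `^ q / rad r j `^ p)); last by ring.
  rewrite -powRB ?(gt_eqF rj) ?implybT// /rad powRM ?exprn_ge0 ?(ltW r0)//.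
  by rewrite -powR_mulrn// powRAC powR_mulrn ?powR_ge0// /b !mulrA.
have b1 : `|b| < 1 by rewrite ger0_norm ?powR_ge0// half_powR_lt1.
have gc := @cvg_geometric_series R (a * 2 `^ p * r `^ (q - p)) b b1.
have /cvg_lim -> // : (\sum_(0 <= i < n) (geometric (a * 2 `^ p * r `^ (q - p)) b i)%:E)%E
    @[n --> \oo] --> (a * 2 `^ p * r `^ (q - p) * (1 - b)^-1)%:E.
  under eq_fun do rewrite sumEFin.
  by apply: cvg_EFin; [exact: nearW|exact: gc].
by rewrite /dyadic_const -/b lee_fin le_eqVlt; apply/orP; left; apply/eqP; ring.
Qed.

End dyadic.

(** * Mass of a function of finite kinetic energy in small boxes *)

Section local_bound.
Context {R : realType} {n : nat}.
Local Notation E := 'rV[R]_n.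
Local Notation L := (@leb R n).
Implicit Types (u v f : E -> R[i]) (m s : R).

Definition kinetic_symbol m s (xi : E) : R := (enorm xi ^+ 2 + m ^+ 2) `^ s.

Lemma kinetic_symbol_ge0 m s xi : 0 <= kinetic_symbol m s xi. Proof. exact: powR_ge0. Qed.

Lemma measurable_kinetic_symbol m s : measurable_fun setT (kinetic_symbol m s).
Proof.
apply: (@measurableT_comp _ _ _ _ _ _ (@powR R ^~ s)) => //.
by apply: measurable_funD => //; apply: measurable_funX; exact: measurable_enorm.
Qed.

Lemma kinetic_symbol_ge m s xi : 0 <= s -> enorm xi `^ (2 * s) <= kinetic_symbol m s xi.
Proof.
move=> s0; rewrite powRrM (powR_mulrn 2) ?enorm_ge0// /kinetic_symbol.
by rewrite ge0_ler_powR// ?nnegrE ?addr_ge0 ?sqr_ge0// lerDl sqr_ge0.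
Qed.

Lemma kineticE m s v : kinetic m s v = (\int[L]_xi (kinetic_symbol m s xi * sqn (fourier v xi))%:E)%E.
Proof. by apply: eq_integral => xi _; rewrite sqr_normc. Qed.

Lemma potentialE (V : E -> R) v : potential V v = (\int[L]_x (V x * sqn (v x))%:E)%E.
Proof. by apply: eq_integral => xi _; rewrite sqr_normc. Qed.

Lemma kinetic_ge0 m s v : (0 <= kinetic m s v)%E.
Proof. by rewrite kineticE; apply: integral_ge0 => x _; rewrite lee_fin mulr_ge0 ?kinetic_symbol_ge0 ?sqn_ge0. Qed.

Lemma ae_neq0 : (0 < n)%N -> {ae L, forall xi : E, xi != 0}.
Proof.
move=> n0; exists (box 0 0); split; first exact: measurable_box.
  by rewrite leb_box// mulr0 expr0n gtn_eqF.
move=> x /=; have [->|//] := eqVneq x 0 => _ i; rewrite subrr normr0 //.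
Qed.

Lemma enorm_eq0 (x : E) : enorm x = 0 -> x = 0.
Proof.
move=> x0; apply/rowP => i; rewrite mxE; apply/eqP; rewrite -normr_le0 -x0.
exact: le_coord_enorm.
Qed.

(** Comes out of the choice of [th] in [local_bound]. *)
Definition local_const s : R := 2 + 2 * ((2 * pi) ^+ n)^-1 * 4 ^+ n * dyadic_const (2 * s) n%:R.

Lemma local_const_ge0 s : s < n%:R / 2 -> 0 <= local_const s.
Proof.
move=> sn; have D0 : 0 < dyadic_const (2 * s) n%:R by apply: dyadic_const_gt0; lra.
apply: addr_ge0 => //; apply: mulr_ge0; last exact: ltW.
by rewrite !mulr_ge0 ?exprn_ge0// invr_ge0 exprn_ge0// mulr_ge0// pi_ge0.
Qed.

(** Completes the square in |a|^2 + |b|^2 = |b - a|^2 + 2 Re (conj a b). *)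
Lemma young_complex (a b : R[i]) (t : R) : 0 < t ->
  sqn a + sqn b <= sqn (b - a) + (t * sqn a + t^-1 * sqn b).
Proof.
move=> t0; case: a => a1 a2; case: b => b1 b2; rewrite /sqn /=.
rewrite -subr_ge0 (_ : _ - _ = t^-1 * ((t * a1 - b1) ^+ 2 + (t * a2 - b2) ^+ 2)).
  by rewrite mulr_ge0 ?invr_ge0 ?(ltW t0)// addr_ge0 ?sqr_ge0.
by field; rewrite gt_eqF.
Qed.

Lemma L2sq_fourier_sub v f : inL2 v -> bsupp_L2 f ->
  L2sq L (fun x => fourier v x - fourierL1 f x) = L2sq L (fun x => v x - f x).
Proof.
move=> v2 bf; have f2 := bsupp_L2_inL2 bf.
have [mh h2] := fourier_inL2 v2.
have mF := bsupp_L2_cmeas_fourier bf.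
have l2 := inL2_lin (-1) f2 v2.
rewrite (_ : (fun x => v x - f x) = fun x => -1 * f x + v x); last first.
  by apply/funext => x; rewrite mulN1r addrC.
rewrite -(L2sq_fourier l2); apply: L2sq_ae; first exact: cmeasB.
  by have [] := fourier_inL2 l2.
have := fourier_lin (-1) f2 v2; have := fourier_bsupp_L2 bf.
apply: filterS2 => xi e1 e2.
by rewrite e2 e1 mulN1r addrC.
Qed.

(** Let [f] be [v] restricted to the box, and [h], [F] the transforms of [v] and
    [f]. By Pythagoras and Plancherel |h|^2 + |F|^2 - |h - F|^2 integrates to
    twice the mass of [f]. This integrand is estimated by [young_complex], with
    the weight 2 at frequencies above 1/r and with a multiple of the kinetic
    symbol below; there |F|^2 is bounded by [sqn_fourierL1_le], and the inverse
    of the symbol is integrable by [dyadic_integral] since 2s < n. The constants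
    are such that half of the mass of [f] is absorbed in each range. *)
Lemma local_bound m s (v : E -> R[i]) (x0 : E) (r k : R) : (0 < n)%N ->
  0 < s -> s < n%:R / 2 -> 0 < r -> inL2 v -> kinetic m s v = k%:E ->
  (\int[L]_x (sqn (v x) * \1_(box x0 r) x)%:E <= (local_const s * k * r `^ (2 * s))%:E)%E.
Proof.
move=> n0 s0 sn r0 v2 kv.
have [mv vfin] := (inL2E v).1 v2.
have [mh hfin] := fourier_inL2 v2.
set B := box x0 r; have mB : measurable B by exact: measurable_box.
have LB : L B = ((2 * r) ^+ n)%:E by rewrite leb_box// ltW.
have LB0 : 0 < (2 * r) ^+ n by rewrite exprn_gt0// mulr_gt0.
pose f x := (\1_B x)%:C * v x.
have sf x : sqn (f x) = sqn (v x) * \1_B x.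
  rewrite /f sqnM sqn_real indicE; case: (x \in B); first by rewrite expr1n mulrC.
  by rewrite expr0n /= mulr0 mul0r.
have mf : cmeas f.
  by apply: cmeasM => //; apply: cmeas_real; exact: measurable_indic.
have fB x : ~ B x -> f x = 0 by move=> xB; rewrite /f indicE memNset// mul0r.
have bf : bsupp_L2 f.
  split => //.
    apply: (le_lt_trans _ vfin); apply: L2sq_le => // x; rewrite sf indicE.
    by rewrite ler_piMr ?sqn_ge0//; case: (x \in B).
  exists (n%:R * (r + enorm x0)) => [|x hx].
    by rewrite mulr_ge0// addr_ge0 ?enorm_ge0 ?(ltW r0).
  apply: fB => Bx; move: hx; apply/negP; rewrite -leNgt; apply: enorm_le => [|i].
    by rewrite addr_ge0 ?enorm_ge0 ?(ltW r0).
  rewrite -[x ord0 i](subrK (x0 ord0 i)) (le_trans (ler_normD _ _))// lerD//.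
  exact: le_coord_enorm.
have ffin : (L2sq L f < +oo)%E by case: bf.
have [nf nfE] : exists nf, L2sq L f = nf%:E.
  by exists (fine (L2sq L f)); rewrite fineK// ge0_fin_numE ?L2sq_ge0.
have nf0 : 0 <= nf by rewrite -lee_fin -nfE L2sq_ge0.
pose F := fourierL1 f; pose h := fourier v.
have mF : cmeas F by exact: bsupp_L2_cmeas_fourier.
have md : cmeas (fun x => v x - f x) by exact: cmeasB.
have split_v : L2sq L v = (L2sq L f + L2sq L (fun x => v x - f x)%R)%E.
  rewrite /L2sq -integral_EFinD; try (by move=> x; exact: sqn_ge0); try exact: measurable_sqn.
  apply: eq_integral => x _; congr (_%:E); rewrite /f indicE.
  by case: (x \in B); rewrite ?mul1r ?subrr ?sqn0 ?addr0// mul0r subr0 sqn0 add0r.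
have [nd ndE] : exists nd, L2sq L (fun x => v x - f x) = nd%:E.
  exists (fine (L2sq L (fun x => v x - f x))); rewrite fineK// ge0_fin_numE ?L2sq_ge0//.
  by apply: (le_lt_trans _ vfin); rewrite split_v leeDr// L2sq_ge0.
(* The frequency threshold, dual to the size of the box. *)
pose Rr := r^-1; have R0 : 0 < Rr by rewrite invr_gt0.
pose c : R := ((2 * pi) ^+ n)^-1.
have c0 : 0 < c by rewrite invr_gt0 exprn_gt0// mulr_gt0// pi_gt0.
have [P PE] : exists x, x = c * (2 * r) ^+ n * nf by exists (c * (2 * r) ^+ n * nf).
have FP xi : sqn (F xi) <= P.
  have := sqn_fourierL1_le xi mf mB LB LB0 ffin fB.
  by rewrite nfE -EFinM lee_fin PE.
pose w (xi : E) : R := 1 * ((enorm (xi - 0) <= Rr)%R%:R * riesz_kernel (2 * s) (xi - 0)).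
pose I : R := 2 ^+ n * Rr `^ (n%:R - 2 * s) * dyadic_const (2 * s) n%:R.
have Iw : (\int[L]_xi (w xi)%:E <= I%:E)%E.
  apply: (@dyadic_integral _ _ (cst 1)) => //; rewrite ?mulr_gt0// ?exprn_ge0//; first lra.
  move=> rho rho0 _; under eq_integral do rewrite mul1r.
  rewrite integral_indic//; last exact: measurable_box.
  rewrite setIT [X in (X <= _)%E](leb_box _ (ltW rho0)).
  by rewrite powR_mulrn ?(ltW rho0)// exprMn.
have D0 : 0 < dyadic_const (2 * s) n%:R by apply: dyadic_const_gt0; lra.
have I0 : 0 < I by apply: mulr_gt0 D0; rewrite mulr_gt0 ?exprn_gt0 ?powR_gt0.
(* With this th the low frequencies of F contribute half of the mass of f;
   high frequencies, weighted by 1/2, contribute the other half. *)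
have [th thE] : exists x, x = 2 * (c * (2 * r) ^+ n) * I by exists (2 * (c * (2 * r) ^+ n) * I).
have th0 : 0 < th by rewrite thE; apply: mulr_gt0 I0; apply: mulr_gt0 => //; exact: mulr_gt0.
have [Cc CcE] : exists x, x = th + 2 * (Rr `^ (2 * s))^-1 by exists (th + 2 * (Rr `^ (2 * s))^-1).
have Cc0 : 0 <= Cc by rewrite CcE addr_ge0 ?(ltW th0)// mulr_ge0 ?invr_ge0 ?powR_ge0.
have P0 : 0 <= P by rewrite PE; apply: mulr_ge0 => //; apply: mulr_ge0; exact: ltW.
have tP0 : 0 <= th^-1 * P by apply: mulr_ge0 => //; rewrite invr_ge0 ltW.
have w0 xi : 0 <= w xi by rewrite /w !mulr_ge0// riesz_kernel_ge0.
have mw : measurable_fun setT w.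
  apply: measurable_funM => //; apply: measurable_funM.
    exact: (measurableT_comp (measurable_enorm_leb Rr) (measurable_subr 0)).
  exact: (measurableT_comp (measurable_riesz_kernel (2 * s)) (measurable_subr 0)).
(* At xi = 0 the symbol may vanish; this point is negligible. *)
have pw xi : xi != 0 -> sqn (h xi) + sqn (F xi) <= sqn (h xi - F xi) +
    (Cc * (kinetic_symbol m s xi * sqn (h xi)) + (th^-1 * P * w xi + 2^-1 * sqn (F xi))).
  move=> xi0; have e0 : 0 < enorm xi.
    by rewrite lt_neqAle enorm_ge0 andbT eq_sym; apply: contra_neq xi0; exact: enorm_eq0.
  have k0 := kinetic_symbol_ge0 m s xi; have ks := kinetic_symbol_ge m xi (ltW s0).
  have es : 0 < enorm xi `^ (2 * s) by exact: powR_gt0.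
  have kk : 0 < kinetic_symbol m s xi by exact: lt_le_trans ks.
  have h0 := sqn_ge0 (h xi); have F0 := sqn_ge0 (F xi); have Fp := FP xi.
  have sym : sqn (F xi - h xi) = sqn (h xi - F xi) by rewrite -sqnN opprB.
  rewrite /w /riesz_kernel subr0 mul1r; have [low|high] := leP (enorm xi) Rr.
    have := young_complex (h xi) (F xi) (mulr_gt0 th0 kk).
    move=> /le_trans; apply; rewrite sym lerD2l mul1r; apply: lerD.
      by rewrite -mulrA ler_wpM2r ?mulr_ge0// CcE lerDl mulr_ge0// invr_ge0 powR_ge0.
    apply: (@le_trans _ _ (th^-1 * P * (enorm xi `^ (2 * s))^-1)).
      rewrite invfM -!mulrA ler_wpM2l ?invr_ge0 ?(ltW th0)// mulrC ler_pM ?invr_ge0//.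
      by rewrite lef_pV2 ?posrE.
    by rewrite lerDl mulr_ge0.
  have := young_complex (h xi) (F xi) (ltr0n R 2); rewrite /= => /le_trans; apply.
  rewrite sym lerD2l mul0r mulr0 add0r; apply: lerD => //.
  have kR : Rr `^ (2 * s) <= kinetic_symbol m s xi.
    apply: le_trans ks; rewrite ge0_ler_powR ?nnegrE ?enorm_ge0 ?(ltW R0) ?(ltW high)//.
    by rewrite mulr_ge0// ltW.
  have Rp : 0 < Rr `^ (2 * s) by exact: powR_gt0.
  rewrite mulrA ler_wpM2r// CcE mulrDl -[leLHS]add0r lerD//.
    by rewrite mulr_ge0 ?(ltW th0).
  by rewrite -mulrA ler_peMr// ler_pdivlMl// mulr1.
have mk : measurable_fun setT (fun xi => kinetic_symbol m s xi * sqn (h xi)).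
  by apply: measurable_funM; [exact: measurable_kinetic_symbol|exact: measurable_sqn].
have mhF : cmeas (fun xi => h xi - F xi) by exact: cmeasB.
have sh := measurable_sqn mh; have sF := measurable_sqn mF; have shF := measurable_sqn mhF.
have ks0 xi : 0 <= kinetic_symbol m s xi * sqn (h xi) by rewrite mulr_ge0 ?kinetic_symbol_ge0 ?sqn_ge0.
have m1 : measurable_fun setT (fun xi => Cc * (kinetic_symbol m s xi * sqn (h xi))).
  exact: measurable_funM.
have m2 : measurable_fun setT (fun xi => th^-1 * P * w xi) by exact: measurable_funM.
have m3 : measurable_fun setT (fun xi => 2^-1 * sqn (F xi)) by exact: measurable_funM.
have p1 xi : 0 <= Cc * (kinetic_symbol m s xi * sqn (h xi)) by rewrite mulr_ge0.
have p2 xi : 0 <= th^-1 * P * w xi by exact: mulr_ge0.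
have p3 xi : 0 <= 2^-1 * sqn (F xi) by rewrite mulr_ge0 ?sqn_ge0.
have m23 : measurable_fun setT (fun xi => th^-1 * P * w xi + 2^-1 * sqn (F xi)).
  exact: measurable_funD.
have m123 : measurable_fun setT (fun xi => Cc * (kinetic_symbol m s xi * sqn (h xi)) +
   (th^-1 * P * w xi + 2^-1 * sqn (F xi))) by exact: measurable_funD.
have p23 xi : 0 <= th^-1 * P * w xi + 2^-1 * sqn (F xi) by rewrite addr_ge0.
have p123 xi : 0 <= Cc * (kinetic_symbol m s xi * sqn (h xi)) + (th^-1 * P * w xi + 2^-1 * sqn (F xi)).
  by rewrite addr_ge0.
have shF0 xi : 0 <= sqn (h xi - F xi) by exact: sqn_ge0.
have : (L2sq L h + L2sq L F <= L2sq L (fun xi => h xi - F xi)%R + (Cc%:E * k%:E +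
    ((th^-1 * P)%:E * \int[L]_xi (w xi)%:E + 2^-1%:E * L2sq L F)))%E.
  rewrite -kv kineticE -!integral_EFinZ//; try (by move=> xi; exact: sqn_ge0);
    try exact: tP0.
  rewrite /L2sq -!integral_EFinD//; try (by move=> xi; exact: sqn_ge0).
  apply: ae_ge0_le_integral => //.
  - by move=> xi _; rewrite lee_fin addr_ge0// sqn_ge0.
  - by apply/measurable_EFinP; exact: measurable_funD.
  - by move=> xi _; rewrite lee_fin addr_ge0.
  - by apply/measurable_EFinP; exact: measurable_funD.
  by apply: filterS (ae_neq0 n0) => xi xi0 _; rewrite lee_fin; exact: pw.
rewrite L2sq_fourier// bsupp_L2_plancherel// L2sq_fourier_sub// split_v nfE ndE => hh.
have : (nf%:E + nd%:E + nf%:E <= nd%:E + (Cc%:E * k%:E +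
    ((th^-1 * P)%:E * I%:E + 2^-1%:E * nf%:E)))%E.
  apply: (le_trans hh); apply: leeD => //; apply: leeD => //; apply: leeD => //.
  by rewrite lee_wpmul2l// lee_fin.
rewrite -!EFinM -!EFinD lee_fin.
have -> : th^-1 * P * I = 2^-1 * nf.
  rewrite thE PE; field.
  by rewrite (gt_eqF I0) (gt_eqF c0) (gt_eqF LB0).
move=> fin_ineq.
rewrite (_ : (\int[L]_x _)%E = L2sq L f); last by apply: eq_integral => x _; rewrite sf.
rewrite nfE lee_fin.
rewrite (_ : local_const s * k * r `^ (2 * s) = Cc * k); first by lra.
rewrite CcE thE /I /local_const -/c /Rr -powR_inv1 ?(ltW r0)// -!powRrM !mulN1r.
rewrite opprB powRN invrK powRB ?(gt_eqF r0) ?implybT// powR_mulrn ?(ltW r0)//.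
rewrite exprMn (_ : 4 = 2 * 2 :> R) ?exprMn; last by ring.
move: (r `^ (2 * s)) (dyadic_const _ _) => rs D.
by field; rewrite expf_neq0// gt_eqF.
Qed.

End local_bound.
Arguments local_const {R} n s.

(** * Coulomb potentials and the Riesz energy *)

Section coulomb.
Context {R : realType} {n : nat}.
Local Notation E := 'rV[R]_n.
Local Notation L := (@leb R n).
Implicit Types (u v : E -> R[i]) (m s gamma : R).

(** Off the unit ball the kernel is at most 1. Inside, the mass of the box of
    radius rho is of order rho^(2s) by [local_bound], and gamma < 2s is the
    condition of [dyadic_integral]. *)
Lemma coulomb_bound m s gamma v (k : R) (x : E) : (0 < n)%N ->
  0 < s -> s < n%:R / 2 -> 0 < gamma -> gamma < 2 * s -> inL2 v -> kinetic m s v = k%:E ->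
  (\int[L]_y (sqn (v y) * riesz_kernel gamma (y - x))%:E <=
    L2sq L v + (local_const n s * k * dyadic_const gamma (2 * s))%:E)%E.
Proof.
move=> n0 s0 sn g0 gs v2 kv.
have [mv vfin] := (inL2E v).1 v2.
have k0 : 0 <= k by rewrite -lee_fin -kv kinetic_ge0.
have ms := measurable_sqn mv.
have msub := measurable_subr x.
have mr : measurable_fun setT (fun y : E => riesz_kernel gamma (y - x)).
  exact: (measurableT_comp (measurable_riesz_kernel gamma)).
pose w (y : E) := (enorm (y - x) <= 1)%R%:R * riesz_kernel gamma (y - x).
have mw : measurable_fun setT w.
  apply: measurable_funM => //.
  exact: (measurableT_comp (measurable_enorm_leb 1) msub).
have w0 y : 0 <= w y by rewrite mulr_ge0// riesz_kernel_ge0.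
have h := @dyadic_integral R n (fun y => sqn (v y)) x gamma (2 * s) 1 (local_const n s * k).
apply: (@le_trans _ _ (L2sq L v + \int[L]_y (sqn (v y) * w y)%:E)%E); last first.
  apply: leeD => //; apply: (le_trans (h _ _ _ _ _ _ _)) => //.
  - by move=> y; exact: sqn_ge0.
  - by rewrite mulr_ge0// local_const_ge0.
  - by move=> rho rho0 _; exact: (local_bound x n0 s0 sn rho0 v2 kv).
  - by rewrite powR1 mulr1.
rewrite /L2sq -integral_EFinD//; last 3 first.
- exact: measurable_funM.
- by move=> y; exact: sqn_ge0.
- by move=> y; rewrite mulr_ge0 ?sqn_ge0.
apply: le_integral_EFin.
- exact: measurable_funM.
- by apply: measurable_funD => //; exact: measurable_funM.
- by move=> y; rewrite mulr_ge0 ?sqn_ge0 ?riesz_kernel_ge0.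
move=> y; rewrite -[X in _ <= X + _]mulr1 -mulrDr ler_wpM2l ?sqn_ge0// /w.
have [le1|gt1] := leP (enorm (y - x)) 1; first by rewrite mul1r lerDr.
rewrite mul0r addr0 /riesz_kernel invf_le1; last by rewrite powR_gt0// (lt_trans _ gt1).
have e1 : 1 = 1 `^ gamma :> R by rewrite powR1.
by rewrite [leLHS]e1 ge0_ler_powR ?nnegrE ?(ltW g0) ?enorm_ge0 ?(ltW gt1).
Qed.

Lemma riesz_energyE gamma v : riesz_energy gamma v =
  (\int[L]_x \int[L]_y (sqn (v x) * sqn (v y) * riesz_kernel gamma (x - y))%:E)%E.
Proof.
by apply: eq_integral => x _; apply: eq_integral => y _; rewrite !sqr_normc.
Qed.

Lemma measurable_riesz_kernel_sub gamma : measurable_fun setT (fun z : E * E => riesz_kernel gamma (z.1 - z.2)).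
Proof. exact: (measurableT_comp (measurable_riesz_kernel gamma) measurable_sub2). Qed.

Lemma sqn_diff_le (a b : R[i]) (t : R) : 0 < t ->
  `|sqn a - sqn b| <= (1 + t^-1) * sqn (a - b) + t * sqn b.
Proof.
move=> t0; case: a => a1 a2; case: b => b1 b2; rewrite /sqn /=.
have ti : 0 < t^-1 by rewrite invr_gt0.
rewrite ler_norml; apply/andP; split; rewrite -subr_ge0.
- rewrite (_ : _ - _ = 2 * ((a1 - b1) ^+ 2 + (a2 - b2) ^+ 2) +
     t^-1 * ((t * b1 + (a1 - b1)) ^+ 2 + (t * b2 + (a2 - b2)) ^+ 2)).
    by rewrite addr_ge0// mulr_ge0 ?(ltW ti)// addr_ge0 ?sqr_ge0.
  by field; rewrite gt_eqF.
- rewrite (_ : _ - _ = t^-1 * ((t * b1 - (a1 - b1)) ^+ 2 + (t * b2 - (a2 - b2)) ^+ 2)).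
    by rewrite mulr_ge0 ?(ltW ti)// addr_ge0 ?sqr_ge0.
  by field; rewrite gt_eqF.
Qed.

(** By [sqn_diff_le], whose parameter makes the term that does not vanish as
    small as desired. *)
Lemma cvg_L1_sqn (v : nat -> E -> R[i]) (U : E -> R[i]) : (forall k, cmeas (v k)) -> cmeas U ->
  (L2sq L U < +oo)%E -> L2sq L (fun x => v k x - U x) @[k --> \oo] --> 0%E ->
  (\int[L]_x (`|sqn (v k x) - sqn (U x)|)%:E)%E @[k --> \oo] --> 0%E.
Proof.
move=> mv mU U2 h.
have [A AE] : exists A, L2sq L U = A%:E.
  by exists (fine (L2sq L U)); rewrite fineK// ge0_fin_numE ?L2sq_ge0.
have A0 : 0 <= A by rewrite -lee_fin -AE L2sq_ge0.
apply: cvge0_approx => [k|eta eta0].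
  by apply: integral_ge0 => x _; rewrite lee_fin.
pose t := eta / (A + 1).
have t0 : 0 < t by rewrite divr_gt0// ltr_wpDl.
exists (fun k => (1 + t^-1)%:E * L2sq L (fun x => v k x - U x)%R)%E; first exact: cvge0Z.
move=> k.
have mw : cmeas (fun x => v k x - U x) by exact: cmeasB.
have tA : t * A <= eta.
  by rewrite /t mulrAC ler_pdivrMr ?ltr_wpDl// ler_pM2l// lerDl.
apply: (@le_trans _ _ ((1 + t^-1)%:E * L2sq L (fun x => v k x - U x)%R + t%:E * L2sq L U)%E); last first.
  by rewrite leeD2l// AE -EFinM lee_fin.
have ti : 0 <= 1 + t^-1 by rewrite addr_ge0// invr_ge0 ltW.
have sw := measurable_sqn mw; have sU := measurable_sqn mU; have sv := measurable_sqn (mv k).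
rewrite /L2sq -!integral_EFinZ// ?(ltW t0)//; try by move=> x; exact: sqn_ge0.
rewrite -integral_EFinD//; try (by move=> x; rewrite mulr_ge0 ?sqn_ge0 ?(ltW t0));
  try exact: measurable_funM.
apply: le_integral_EFin => //.
- by apply: measurableT_comp => //; exact: measurable_funB.
- by apply: measurable_funD; exact: measurable_funM.
by move=> x; exact: sqn_diff_le.
Qed.

(** With d = | |u|^2 - |v|^2 |, the product |u(x)|^2 |u(y)|^2 is at most
    |v(x)|^2 |v(y)|^2 + d(x) |u(y)|^2 + |v(x)|^2 d(y). Integrating the last two
    terms first in the variable that does not enter [d] produces potentials,
    which [S] bounds. *)
Lemma riesz_energy_le gamma (u v : E -> R[i]) (S : R) : cmeas u -> cmeas v -> 0 <= S ->
  (forall x, (\int[L]_y (sqn (u y) * riesz_kernel gamma (y - x))%:E <= S%:E)%E) ->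
  (forall x, (\int[L]_y (sqn (v y) * riesz_kernel gamma (y - x))%:E <= S%:E)%E) ->
  (riesz_energy gamma u <= riesz_energy gamma v +
     (2 * S)%:E * \int[L]_x (`|sqn (u x) - sqn (v x)|)%:E)%E.
Proof.
move=> mu mv S0 Su Sv; rewrite !riesz_energyE.
pose d x := `|sqn (u x) - sqn (v x)|.
have su := measurable_sqn mu; have sv := measurable_sqn mv.
have md : measurable_fun setT d.
  by apply: measurableT_comp => //; exact: measurable_funB.
have d0 x : 0 <= d x by exact: normr_ge0.
pose K (f g : E -> R) (z : E * E) := f z.1 * g z.2 * riesz_kernel gamma (z.1 - z.2).
have mK (f g : E -> R) : measurable_fun setT f -> measurable_fun setT g -> measurable_fun setT (K f g).
  move=> mf mg; apply: measurable_funM; last exact: measurable_riesz_kernel_sub.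
  by apply: measurable_funM; apply: measurableT_comp.
have K0 (f g : E -> R) : (forall x, 0 <= f x) -> (forall x, 0 <= g x) -> forall z, 0 <= K f g z.
  by move=> f0 g0 z; rewrite !mulr_ge0// riesz_kernel_ge0.
have tonelli (f g : E -> R) : measurable_fun setT f -> measurable_fun setT g ->
    (forall x, 0 <= f x) -> (forall x, 0 <= g x) ->
    (\int[L]_x \int[L]_y (f x * g y * riesz_kernel gamma (x - y))%:E = \int[(L \x L)]_z (K f g z)%:E)%E.
  move=> mf mg f0 g0; rewrite fubini_tonelli1//.
    by apply/measurable_EFinP; exact: mK.
  by move=> z; rewrite lee_fin K0.
pose U x := sqn (u x); pose W x := sqn (v x).
have U0 x : 0 <= U x by exact: sqn_ge0.
have W0 x : 0 <= W x by exact: sqn_ge0.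
have bound (f g : E -> R) : measurable_fun setT f -> measurable_fun setT g ->
    (forall x, 0 <= f x) -> (forall x, 0 <= g x) ->
    (forall x, (\int[L]_y (g y * riesz_kernel gamma (y - x))%:E <= S%:E)%E) ->
    (\int[L]_x \int[L]_y (f x * g y * riesz_kernel gamma (x - y))%:E <= S%:E * \int[L]_x (f x)%:E)%E.
  move=> mf mg f0 g0 gS; rewrite -integral_EFinZ//.
  apply: ge0_le_integral => //.
  - by move=> x _; apply: integral_ge0 => y _; rewrite lee_fin !mulr_ge0// riesz_kernel_ge0.
  - apply: (@measurable_fun_fubini_tonelli_F _ _ E E R L (fun z : E * E => (K f g z)%:E)) => //.
      by apply/measurable_EFinP; exact: mK.
    by move=> z; rewrite lee_fin K0.
  - by apply/measurable_EFinP; exact: measurable_funM.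
  move=> x _; under eq_integral do rewrite -mulrA riesz_kernel_sym.
  have mg' : measurable_fun setT (fun y => g y * riesz_kernel gamma (y - x)).
    apply: measurable_funM => //.
    exact: (measurableT_comp (measurable_riesz_kernel gamma) (measurable_subr x)).
  rewrite integral_EFinZ//; last by move=> y; rewrite mulr_ge0 ?riesz_kernel_ge0.
  by rewrite mulrC EFinM lee_wpmul2l// lee_fin.
have b1 := bound d U md su d0 U0 Su.
have mUU := mK U U su su; have mWW := mK W W sv sv.
have mdU := mK d U md su; have mWd := mK W d sv md.
have UU0 := K0 U U U0 U0; have WW0 := K0 W W W0 W0.
have dU0 := K0 d U d0 U0; have Wd0 := K0 W d W0 d0.
have b2 : (\int[L]_x \int[L]_y (W x * d y * riesz_kernel gamma (x - y))%:E <= S%:E * \int[L]_x (d x)%:E)%E.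
  apply: le_trans (bound d W md sv d0 W0 Sv).
  rewrite (tonelli W d)// (tonelli d W)// le_eqVlt; apply/orP; left; apply/eqP.
  transitivity (\int[(L \x L)%E]_z (K d W (z.2, z.1))%:E)%E.
    by apply: eq_integral => z _; rewrite /K /= riesz_kernel_sym [W _ * _]mulrC.
  by apply: integral_prod_swap; [exact: mK|exact: K0].
apply: (@le_trans _ _ (\int[L]_x \int[L]_y (W x * W y * riesz_kernel gamma (x - y))%:E +
  (\int[L]_x \int[L]_y (d x * U y * riesz_kernel gamma (x - y))%:E +
   \int[L]_x \int[L]_y (W x * d y * riesz_kernel gamma (x - y))%:E))%E); last first.
  rewrite leeD2l// mulr_natl mulr2n EFinD ge0_muleDl ?lee_fin//.
  exact: leeD b1 b2.
rewrite (tonelli U U)// (tonelli W W)// (tonelli d U)// (tonelli W d)//.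
rewrite -!integral_EFinD//; try exact: measurable_funD; try by move=> z; rewrite addr_ge0.
apply: le_integral_EFin => //.
  by apply: measurable_funD => //; exact: measurable_funD.
move=> [x y]; rewrite /K /= -!mulrDl ler_wpM2r ?riesz_kernel_ge0//.
have := U0 x; have := U0 y; have := W0 x; have := W0 y; have := d0 x; have := d0 y.
have : U x <= W x + d x by rewrite -lerBlDl ler_norm.
have : U y <= W y + d y by rewrite -lerBlDl ler_norm.
move: (U x) (U y) (W x) (W y) (d x) (d y) => *; nra.
Qed.

End coulomb.

(** * Continuous functions are Borel; the L^2 inner product *)

Section borel.
Context {R : realType} {n : nat}.
Local Notation E := 'rV[R]_n.

(** An open set is the union of the boxes it contains among those of radius
    1 / (k + 1) centred at the grid of step 1 / (k + 1), and these are
    countably many. *)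
Lemma open_measurable_rV (A : set E) : open A -> measurable A.
Proof.
move=> oA.
pose c (kz : nat * 'rV[int]_n) : E := \row_i ((kz.2 ord0 i)%:~R / kz.1.+1%:R).
pose F kz := if `[< box (c kz) (kz.1.+1%:R^-1) `<=` A >] then box (c kz) (kz.1.+1%:R^-1) else set0.
rewrite (_ : A = \bigcup_kz F kz).
  apply: countable_bigcupT_measurable => [|kz]; first exact: countableP.
  by rewrite /F; case: ifP => _; [exact: measurable_box|exact: measurable0].
apply/seteqP; split => [x Ax|x [kz _]]; last first.
  by rewrite /F; case: ifPn => // /asboolP h /h.
have /nbhs_ballP[e /= e0 xe] : nbhs x A by move: oA; rewrite openE => /(_ _ Ax).
have [k hk] : exists k : nat, 2 * k.+1%:R^-1 < e.
  exists (Num.truncn (2 / e)); rewrite ltr_pdivrMr// mulrC -ltr_pdivrMr//.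
  exact: truncnS_gt.
pose z : 'rV[int]_n := \row_i Num.floor (x ord0 i * k.+1%:R).
have k0 : 0 < k.+1%:R :> R by [].
have xc : box (c (k, z)) (k.+1%:R^-1) x.
  move=> i; rewrite /c /= !mxE.
  have := real_floor_itv (num_real (x ord0 i * k.+1%:R)).
  set f := Num.floor _; rewrite intrD => /andP[f1 f2].
  rewrite (_ : x ord0 i - _ = (x ord0 i * k.+1%:R - f%:~R) / k.+1%:R); last by field.
  rewrite normrM normfV (ger0_norm (ltW k0)) ler_piMl ?invr_ge0 ?(ltW k0)//.
  by rewrite ler_norml; apply/andP; split; lra.
have bA : box (c (k, z)) (k.+1%:R^-1) `<=` A.
  move=> y yc; apply: xe; split=> // i j; rewrite /ball /= (ord1 i).
  apply: le_lt_trans hk.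
  rewrite -(subrK (c (k, z) ord0 j) (x ord0 j)) -addrA (le_trans (ler_normD _ _))//.
  rewrite -[2]/(1 + 1) mulrDl !mul1r; apply: lerD; first exact: xc.
  by rewrite distrC; exact: yc.
by exists (k, z) => //; rewrite /F asboolT.
Qed.

Lemma continuous_measurable_rV (f : E -> R) : continuous f -> measurable_fun setT f.
Proof.
move=> /continuousP cf; apply: (measurability _ (RGenOpens.measurableE R)).
move=> _ [_ [a [b ->] <-]]; rewrite setTI; apply: open_measurable_rV.
exact/cf/interval_open.
Qed.

End borel.

(** For positive [a] and [b] the optimal [t] is [sqrt b / sqrt a]; both roots
    are shifted by a small [e] so that they may vanish. *)
Lemma young_bound {R : realType} (X a b : R) : 0 <= a -> 0 <= b ->
  (forall t, 0 < t -> 2 * X <= t * a + t^-1 * b) -> X <= Num.sqrt a * Num.sqrt b.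
Proof.
move=> a0 b0 h; rewrite leNgt; apply/negP => hX.
have X0 : 0 < X by apply: le_lt_trans hX; rewrite mulr_ge0 ?sqrtr_ge0.
move: h hX; rewrite -{1}(sqr_sqrtr a0) -{1}(sqr_sqrtr b0).
move: (sqrtr_ge0 a) (sqrtr_ge0 b); move: (Num.sqrt a) (Num.sqrt b) => p q p0 q0 h hX.
have D0 : 0 < 1 + p + q by lra.
have [e [e0 eE]] : exists e, 0 < e /\ e * (1 + p + q) = X - p * q.
  by exists ((X - p * q) / (1 + p + q)); split; [rewrite divr_gt0// subr_gt0|field; rewrite gt_eqF].
have qe : 0 < q + e by lra.
have pe : 0 < p + e by lra.
have := h _ (divr_gt0 qe pe); rewrite invf_div.
have l1 : (q + e) / (p + e) * p ^+ 2 <= (q + e) * p.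
  rewrite -mulrA ler_wpM2l ?(ltW qe)// mulrC ler_pdivrMr// expr2 ler_wpM2l//; lra.
have l2 : (p + e) / (q + e) * q ^+ 2 <= (p + e) * q.
  rewrite -mulrA ler_wpM2l ?(ltW pe)// mulrC ler_pdivrMr// expr2 ler_wpM2l//; lra.
by nra.
Qed.

Section inner_product.
Context {R : realType} {n : nat}.
Local Notation E := 'rV[R]_n.
Local Notation L := (@leb R n).
Implicit Types f g h : E -> R[i].

Definition L2ip f g : R[i] := Cintegral (fun x => f x * (g x)^*).

Let L2 f := cmeas f /\ (L2sq L f < +oo)%E.

Lemma cmeas_conjc g : cmeas g -> cmeas (fun x => (g x)^*).
Proof.
case=> mr mi; split.
- by rewrite (_ : (fun x => _) = fun x => complex.Re (g x))//; apply/funext => x; case: (g x).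
- rewrite (_ : (fun x => _) = fun x => - complex.Im (g x)); first exact: measurable_funN.
  by apply/funext => x; case: (g x).
Qed.

Lemma abs_prod_le (z w : R[i]) (t : R) : 0 < t ->
  2 * `|complex.Re (z * w^*)| <= t * sqn z + t^-1 * sqn w /\
  2 * `|complex.Im (z * w^*)| <= t * sqn z + t^-1 * sqn w.
Proof.
move=> t0; have ti : 0 < t^-1 by rewrite invr_gt0.
case: z => a b; case: w => c e; rewrite /sqn /=.
have h (X a' b' : R) : a' ^+ 2 + b' ^+ 2 = a ^+ 2 + b ^+ 2 -> X = a' * c + b' * e ->
    2 * `|X| <= t * (a ^+ 2 + b ^+ 2) + t^-1 * (c ^+ 2 + e ^+ 2).
  move=> <- ->; rewrite -[X in X * _](@ger0_norm R 2)// -normrM ler_norml.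
  apply/andP; split; rewrite -subr_ge0.
  - rewrite (_ : _ - _ = t^-1 * ((t * a' + c) ^+ 2 + (t * b' + e) ^+ 2)).
      by rewrite mulr_ge0 ?(ltW ti)// addr_ge0 ?sqr_ge0.
    by field; rewrite gt_eqF.
  - rewrite (_ : _ - _ = t^-1 * ((t * a' - c) ^+ 2 + (t * b' - e) ^+ 2)).
      by rewrite mulr_ge0 ?(ltW ti)// addr_ge0 ?sqr_ge0.
    by field; rewrite gt_eqF.
split; first by apply: (h _ a b) => //; ring.
by apply: (h _ b (- a)); ring.
Qed.

Lemma sqn_integrable f : L2 f -> L.-integrable setT (fun x => (sqn (f x))%:E).
Proof.
move=> [mf f2]; apply/integrableP; split.
  by apply/measurable_EFinP; exact: measurable_sqn.
by under eq_integral do rewrite /= ger0_norm ?sqn_ge0//.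
Qed.

Lemma L2ip_integrable f g : L2 f -> L2 g -> cintegrable (fun x => f x * (g x)^*).
Proof.
move=> f2 g2; have [mr mi] := cmeasM f2.1 (cmeas_conjc g2.1).
have idom := rintegrableD (sqn_integrable f2) (sqn_integrable g2).
split; apply: (rintegrable_dominated _ idom) => // x;
  have [] := abs_prod_le (f x) (g x) (@ltr01 R); rewrite invr1 !mul1r;
  have := normr_ge0 (complex.Re (f x * (g x)^*)); have := normr_ge0 (complex.Im (f x * (g x)^*));
  lra.
Qed.

Lemma L2ip_lin (a : R[i]) f g h : L2 f -> L2 g -> L2 h ->
  L2ip (fun x => a * f x + g x) h = a * L2ip f h + L2ip g h.
Proof.
move=> f2 g2 h2; rewrite -Cintegral_lin; [|exact: L2ip_integrable..].
by congr Cintegral; apply/funext => x; rewrite mulrDl mulrA.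
Qed.

Lemma L2ip_ae f f' g : cmeas f -> cmeas f' -> cmeas g ->
  {ae L, forall x, f x = f' x} -> L2ip f g = L2ip f' g.
Proof.
move=> mf mf' mg h.
have [mr mi] := cmeasM mf (cmeas_conjc mg).
have [mr' mi'] := cmeasM mf' (cmeas_conjc mg).
rewrite /L2ip /Cintegral /Rintegral; congr (fine _ +i* fine _); apply: ae_eq_integral => //.
- exact/measurable_EFinP.
- exact/measurable_EFinP.
- by apply: filterS h => x -> _.
- exact/measurable_EFinP.
- exact/measurable_EFinP.
- by apply: filterS h => x -> _.
Qed.

Lemma L2ip_self f : L2ip f f = (fine (L2sq L f))%:C.
Proof.
rewrite /L2ip /Cintegral /L2sq; congr (_ +i* _).
  by apply: eq_Rintegral => x _; case: (f x) => a b; rewrite /sqn /=; ring.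
rewrite (_ : (fun x => _) = cst 0); first by rewrite Rintegral_cst// mul0r.
by apply/funext => x; case: (f x) => a b /=; ring.
Qed.

Lemma L2ip_young f g t : L2 f -> L2 g -> 0 < t ->
  2 * `|complex.Re (L2ip f g)| <= t * fine (L2sq L f) + t^-1 * fine (L2sq L g) /\
  2 * `|complex.Im (L2ip f g)| <= t * fine (L2sq L f) + t^-1 * fine (L2sq L g).
Proof.
move=> f2 g2 t0; have [ir ii] := L2ip_integrable f2 g2.
have isf := sqn_integrable f2; have isg := sqn_integrable g2.
have -> : t * fine (L2sq L f) + t^-1 * fine (L2sq L g) =
    \int[L]_x (t * sqn (f x) + t^-1 * sqn (g x)).
  by rewrite RintegralD ?rintegrableZl// !RintegralZl.
split.
- rewrite /L2ip /=.
  apply: (@le_trans _ _ (2 * \int[L]_x `|complex.Re (f x * (g x)^*)|)).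
    by rewrite ler_pM2l//; exact: le_normr_Rintegral.
  rewrite -RintegralZl//; last exact: integrable_norm.
  apply: le_Rintegral => //.
  + by apply: rintegrableZl; exact: integrable_norm.
  + by apply: rintegrableD; exact: rintegrableZl.
  + by move=> x _; have [] := abs_prod_le (f x) (g x) t0.
- rewrite /L2ip /=.
  apply: (@le_trans _ _ (2 * \int[L]_x `|complex.Im (f x * (g x)^*)|)).
    by rewrite ler_pM2l//; exact: le_normr_Rintegral.
  rewrite -RintegralZl//; last exact: integrable_norm.
  apply: le_Rintegral => //.
  + by apply: rintegrableZl; exact: integrable_norm.
  + by apply: rintegrableD; exact: rintegrableZl.
  + by move=> x _; have [] := abs_prod_le (f x) (g x) t0.
Qed.

Lemma L2ip_ae_lin (a : R[i]) f f1 f2 g : cmeas f -> L2 f1 -> L2 f2 -> L2 g ->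
  {ae L, forall x, f x = a * f1 x + f2 x} -> L2ip f g = a * L2ip f1 g + L2ip f2 g.
Proof.
move=> mf f1_2 f2_2 g2 h; rewrite -L2ip_lin//; apply: L2ip_ae => //; last exact: g2.1.
apply: cmeasD; last exact: f2_2.1.
by apply: cmeasM; [exact: cmeas_cst|exact: f1_2.1].
Qed.

Lemma L2ip_pair_bound f1 g1 f2 g2 : L2 f1 -> L2 g1 -> L2 f2 -> L2 g2 ->
  let b := Num.sqrt (fine (L2sq L f1) + fine (L2sq L f2)) *
           Num.sqrt (fine (L2sq L g1) + fine (L2sq L g2)) in
  `|complex.Re (L2ip f1 g1 + L2ip f2 g2)| <= b /\ `|complex.Im (L2ip f1 g1 + L2ip f2 g2)| <= b.
Proof.
move=> f12 g12 f22 g22 b; rewrite {}/b.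
have nn f : 0 <= fine (L2sq L f) by rewrite fine_ge0 ?L2sq_ge0.
have := fun t => @L2ip_young _ _ t f22 g22; have := fun t => @L2ip_young _ _ t f12 g12.
move: (nn f1) (nn g1) (nn f2) (nn g2).
move: (fine (L2sq L f1)) (fine (L2sq L g1)) (fine (L2sq L f2)) (fine (L2sq L g2)).
move: (L2ip f1 g1) (L2ip f2 g2) => [a b] [a' b'] A1 A2 A3 A4 h1 h2 h3 h4 y1 y2 /=.
by split; apply: young_bound => [||t t0]; rewrite ?addr_ge0//;
  have [] := y1 t t0; have [] := y2 t t0; have := ler_normD a a'; have := ler_normD b b'; lra.
Qed.

End inner_product.

(** * The energy space and its dual *)

Section sigma_space.
Context {R : realType} {n : nat} (m s : R) (V : 'rV[R]_n -> R) (c1 : R).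
Context (c0 : 0 < c1) (Vc : forall x, c1 <= V x) (mV : measurable_fun setT V).
Local Notation E := 'rV[R]_n.
Local Notation L := (@leb R n).
Local Notation Sg := (Sigma m s V).
Local Notation dual := (Sigma_dual m s V).
Local Notation p := (Sigma_norm m s V).
Implicit Types (u v w : E -> R[i]) (l : (E -> R[i]) -> R[i]).

Let V0 x : 0 <= V x. Proof. exact: le_trans (ltW c0) (Vc x). Qed.

(** [v |-> (kin_part v, pot_part v)] is an isometric embedding of the energy
    space into L^2 x L^2, from which the inner product is pulled back. *)
Definition kin_part v (xi : E) : R[i] := (Num.sqrt (kinetic_symbol m s xi))%:C * fourier v xi.
Definition pot_part v (x : E) : R[i] := (Num.sqrt (V x))%:C * v x.

Lemma kinetic_L2sq v : kinetic m s v = L2sq L (kin_part v).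
Proof.
rewrite kineticE; apply: eq_integral => xi _.
by rewrite /kin_part sqnM sqn_real sqr_sqrtr// kinetic_symbol_ge0.
Qed.

Lemma potential_L2sq v : potential V v = L2sq L (pot_part v).
Proof.
rewrite potentialE; apply: eq_integral => xi _.
by rewrite /pot_part sqnM sqn_real sqr_sqrtr.
Qed.

Let msqrt (f : E -> R) : measurable_fun setT f -> measurable_fun setT (fun x => Num.sqrt (f x)).
Proof.
apply: (@measurableT_comp _ _ _ _ _ _ (@Num.sqrt R)).
by apply: continuous_measurable_fun; exact: sqrt_continuous.
Qed.

Lemma kin_part_cmeas v : inL2 v -> cmeas (kin_part v).
Proof.
move=> /fourier_inL2[mh _]; apply: cmeasM => //.
by apply: cmeas_real; apply: msqrt; exact: measurable_kinetic_symbol.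
Qed.

Lemma pot_part_cmeas v : cmeas v -> cmeas (pot_part v).
Proof. by move=> mv; apply: cmeasM => //; apply: cmeas_real; exact: msqrt. Qed.

Lemma SigmaE v : Sg v <->
  [/\ inL2 v, (L2sq L (kin_part v) < +oo)%E & (L2sq L (pot_part v) < +oo)%E].
Proof.
rewrite /Sigma /= kinetic_L2sq potential_L2sq; split=> [[v2 h]|[v2 h1 h2]].
  split => //; apply: le_lt_trans h; first by rewrite leeDl ?L2sq_ge0.
  by rewrite leeDr ?L2sq_ge0.
by split => //; rewrite lte_add_pinfty.
Qed.

Let kL2 v : Sg v -> cmeas (kin_part v) /\ (L2sq L (kin_part v) < +oo)%E.
Proof. by move=> /SigmaE[v2 ? _]; split => //; exact: kin_part_cmeas. Qed.

Let pL2 v : Sg v -> cmeas (pot_part v) /\ (L2sq L (pot_part v) < +oo)%E.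
Proof. by move=> /SigmaE[v2 _ ?]; split => //; apply: pot_part_cmeas; case/inL2E: v2. Qed.

Lemma kin_part_lin (a : R[i]) v w : inL2 v -> inL2 w ->
  {ae L, forall xi, kin_part (fun x => a * v x + w x) xi = a * kin_part v xi + kin_part w xi}.
Proof.
move=> v2 w2; have := fourier_lin a v2 w2; apply: filterS => xi.
by rewrite /kin_part => ->; rewrite mulrDr mulrCA.
Qed.

Lemma pot_part_lin (a : R[i]) v w :
  pot_part (fun x => a * v x + w x) = fun x => a * pot_part v x + pot_part w x.
Proof. by apply/funext => x; rewrite /pot_part mulrDr mulrCA. Qed.

Lemma Sigma_lin (a : R[i]) v w : Sg v -> Sg w -> Sg (fun x => a * v x + w x).
Proof.
move=> Sv Sw; have [mkv kv] := kL2 Sv; have [mkw kw] := kL2 Sw.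
have [mpv pv] := pL2 Sv; have [mpw pw] := pL2 Sw.
have v2 := Sv.1; have w2 := Sw.1.
have l2 := inL2_lin a v2 w2.
apply/SigmaE; split; [exact: l2| |].
  have -> := L2sq_ae (kin_part_cmeas l2) (cmeas_lin a mkv mkw) (kin_part_lin a v2 w2).
  exact: L2sq_lin_fin.
by rewrite pot_part_lin; exact: L2sq_lin_fin.
Qed.

Lemma Sigma_norm_sqr v : Sg v ->
  (p v) ^+ 2 = fine (L2sq L (kin_part v)) + fine (L2sq L (pot_part v)).
Proof.
move=> Sv; have [_ kv] := kL2 Sv; have [_ pv] := pL2 Sv.
rewrite /Sigma_norm kinetic_L2sq potential_L2sq fineD ?ge0_fin_numE ?L2sq_ge0//.
by rewrite sqr_sqrtr// addr_ge0// fine_ge0 ?L2sq_ge0.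
Qed.

Lemma Sigma_norm_ge0 v : 0 <= p v. Proof. exact: sqrtr_ge0. Qed.

Lemma Sigma_L2sq_le v : Sg v -> (L2sq L v <= (c1^-1 * p v ^+ 2)%:E)%E.
Proof.
move=> Sv; have [mk kv] := kL2 Sv; have [mp pv] := pL2 Sv.
have [mv v2] := (inL2E v).1 Sv.1.
apply: (@le_trans _ _ (c1^-1%:E * L2sq L (pot_part v))%E).
  rewrite -integral_EFinZ ?invr_ge0 ?(ltW c0)//; last 2 first.
  - exact: measurable_sqn.
  - by move=> x; exact: sqn_ge0.
  apply: le_integral_EFin.
  - exact: measurable_sqn.
  - by apply: measurable_funM => //; exact: measurable_sqn.
  - by move=> x; exact: sqn_ge0.
  move=> x; rewrite /pot_part sqnM sqn_real sqr_sqrtr// mulrA ler_peMl ?sqn_ge0//.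
  by rewrite ler_pdivlMl// mulr1.
rewrite EFinM lee_wpmul2l ?lee_fin ?invr_ge0 ?(ltW c0)// Sigma_norm_sqr//.
rewrite EFinD !fineK ?ge0_fin_numE ?L2sq_ge0//.
by rewrite leeDr// L2sq_ge0.
Qed.

Lemma kinetic_le_norm v : Sg v -> exists2 k, kinetic m s v = k%:E & k <= p v ^+ 2.
Proof.
move=> Sv; have [mk kv] := kL2 Sv; have [mp pv] := pL2 Sv.
exists (fine (L2sq L (kin_part v))); first by rewrite fineK ?kinetic_L2sq// ge0_fin_numE ?L2sq_ge0.
by rewrite Sigma_norm_sqr// lerDl fine_ge0 ?L2sq_ge0.
Qed.

Definition Sigma_ip v w : R[i] := L2ip (kin_part v) (kin_part w) + L2ip (pot_part v) (pot_part w).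

Lemma Sigma_ip_lin (a : R[i]) u v w : Sg u -> Sg v -> Sg w ->
  Sigma_ip (fun x => a * u x + v x) w = a * Sigma_ip u w + Sigma_ip v w.
Proof.
move=> Su Sv Sw; rewrite /Sigma_ip.
have u2 := Su.1; have v2 := Sv.1.
have [mku _] := kL2 Su; have [mkv _] := kL2 Sv; have [mkw _] := kL2 Sw.
rewrite pot_part_lin (L2ip_lin a (pL2 Su) (pL2 Sv) (pL2 Sw)).
rewrite mulrDr [RHS]addrACA; apply: f_equal2; last by [].
exact: (L2ip_ae_lin (kin_part_cmeas (inL2_lin a u2 v2)) (kL2 Su) (kL2 Sv) (kL2 Sw)
  (kin_part_lin a u2 v2)).
Qed.

Lemma Sigma_ip_self v : Sg v -> complex.Re (Sigma_ip v v) = p v ^+ 2.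
Proof. by move=> Sv; rewrite /Sigma_ip !L2ip_self Sigma_norm_sqr. Qed.

Lemma Sigma_ip_bound v w : Sg v -> Sg w ->
  `|complex.Re (Sigma_ip v w)| <= p v * p w /\ `|complex.Im (Sigma_ip v w)| <= p v * p w.
Proof.
move=> Sv Sw.
have pE u : Sg u -> p u = Num.sqrt (fine (L2sq L (kin_part u)) + fine (L2sq L (pot_part u))).
  by move=> Su; rewrite -Sigma_norm_sqr// sqrtr_sqr ger0_norm// Sigma_norm_ge0.
rewrite (pE v Sv) (pE w Sw).
exact: (L2ip_pair_bound (kL2 Sv) (kL2 Sw) (pL2 Sv) (pL2 Sw)).
Qed.

Lemma Sigma_dualE l : dual l <->
  (forall (a : R[i]) v w, Sg v -> Sg w -> l (fun x => a * v x + w x) = a * l v + l w) /\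
  (exists K : R, forall v, Sg v -> `|complex.Re (l v)| <= K * p v /\ `|complex.Im (l v)| <= K * p v).
Proof.
split=> [[ll [K hK]]|[ll [K hK]]]; split => //.
  exists K => v Sv; have h := hK v Sv.
  by split; [apply: le_trans (abs_Re_le_normc _) h|apply: le_trans (abs_Im_le_normc _) h].
exists (2 * K) => v Sv; have [h1 h2] := hK v Sv.
have K0 : 0 <= K * p v by exact: le_trans h1.
have n0 := normc_ge0 (l v).
have K2 : 0 <= 2 * (K * p v) by exact: mulr_ge0.
rewrite -mulrA -(@ler_pXn2r _ 2)//.
rewrite sqr_normc /sqn -(real_normK (num_real (complex.Re _))) -(real_normK (num_real (complex.Im _))).
have := normr_ge0 (complex.Re (l v)); have := normr_ge0 (complex.Im (l v)).
move: h1 h2; move: `|_| `|_| (K * p v) K0 => a b c *; nra.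
Qed.

(** Represents [w] divided by its norm: a functional of norm at most one which
    takes the value [Sigma_norm m s V w] at [w] ([norming_self]). *)
Definition norming w v : R[i] := ((p w)^-1)%:C * Sigma_ip v w.

Lemma norming_bound v w : Sg v -> Sg w ->
  `|complex.Re (norming w v)| <= p v /\ `|complex.Im (norming w v)| <= p v.
Proof.
move=> Sv Sw; have [h1 h2] := Sigma_ip_bound Sv Sw; rewrite /norming.
have h (X : R) : `|X| <= p v * p w -> `|(p w)^-1 * X| <= p v.
  have [->|w0] := eqVneq (p w) 0; first by rewrite invr0 mul0r normr0 Sigma_norm_ge0.
  have w1 : 0 < p w by rewrite lt_neqAle eq_sym w0 Sigma_norm_ge0.
  by move=> hX; rewrite normrM normfV (ger0_norm (ltW w1)) mulrC ler_pdivrMr.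
by move: h1 h2; case: (Sigma_ip v w) => a b /= /h + /h; rewrite !mul0r subr0 addr0.
Qed.

Lemma norming_lin (a : R[i]) u v w : Sg u -> Sg v -> Sg w ->
  norming w (fun x => a * u x + v x) = a * norming w u + norming w v.
Proof. by move=> Su Sv Sw; rewrite /norming Sigma_ip_lin// mulrDr mulrCA. Qed.

Lemma norming_self w : Sg w -> complex.Re (norming w w) = p w.
Proof.
move=> Sw; have := Sigma_ip_self Sw; rewrite /norming.
case: (Sigma_ip w w) => a b /= ->; rewrite mul0r subr0.
have [->|w0] := eqVneq (p w) 0; first by rewrite invr0 mul0r.
by rewrite expr2 mulKf.
Qed.

Lemma dual_add_norming l w (c : R) : dual l -> Sg w ->
  dual (fun v => l v + c%:C * norming w v).
Proof.
move=> /Sigma_dualE[ll [K hK]] Sw; apply/Sigma_dualE; split.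
  move=> a u v Su Sv; rewrite ll// norming_lin// mulrDr mulrDr addrACA.
  by rewrite [a * (_ * _)]mulrCA.
exists (K + `|c|) => v Sv; have [h1 h2] := hK v Sv; have [h3 h4] := norming_bound Sv Sw.
move: h1 h2 h3 h4; case: (l v) => a b; case: (norming w v) => a' b' /=.
rewrite !mul0r subr0 addr0 mulrDl => h1 h2 h3 h4.
by split; rewrite (le_trans (ler_normD _ _))// lerD// normrM ler_wpM2l.
Qed.

Let third_ge0 k : 0 <= 3^-1 ^+ k :> R. Proof. by rewrite exprn_ge0. Qed.

(** Gliding hump. If the norms are unbounded, choose indices inductively, the
    next one, [nxt (k, F k)], so large that the functional [F k] built so far is
    at most 1 there while the norm exceeds 6 * 3^k, and add 3^-k times its
    norming functional. At the chosen element the new term contributes 3^-k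
    times the norm, the earlier ones at most 1, and the later ones at most half
    of the new one. So the limit [l] exceeds 1 in modulus along the chosen
    indices, although it belongs to the dual. *)
Lemma weakly_null_bounded (w : nat -> E -> R[i]) : (forall k, Sg (w k)) ->
  (forall l, dual l -> Normc.normc (l (w k)) @[k --> \oo] --> (0 : R)) ->
  exists C : R, forall k, p (w k) <= C.
Proof.
move=> Sw wk; apply/not_existsP => unb.
(* The first K norms are dominated by their sum. *)
have unb_after (C : R) K : exists2 k, (K <= k)%N & C < p (w k).
  have /existsNP[k] := unb (`|C| + \sum_(i < K) p (w i)).
  move=> /negP; rewrite -ltNge => hk; exists k; last first.
    apply: le_lt_trans hk; rewrite (le_trans (ler_norm C))// lerDl sumr_ge0// => i _.
    exact: Sigma_norm_ge0.
  rewrite leqNgt; apply/negP => kK; move: hk; rewrite ltNge => /negP; apply.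
  rewrite (bigD1 (Ordinal kK))//= addrCA lerDl addr_ge0// sumr_ge0// => i _.
  exact: Sigma_norm_ge0.
have /choice[nxt hnxt] : forall kf : nat * ((E -> R[i]) -> R[i]), exists k, dual kf.2 ->
    [/\ (kf.1 <= k)%N, 6 * 3 ^+ kf.1 < p (w k) & `|complex.Re (kf.2 (w k))| <= 1].
  move=> [k f] /=; have [df|ndf] := pselect (dual f); last by exists 0%N.
  have := wk f df => /cvgrPdist_le /(_ _ ltr01)[K _ hK].
  have [j Kj hj] := unb_after (6 * 3 ^+ k) (maxn K k).
  exists j => _; split => //; first by rewrite (leq_trans _ Kj)// leq_maxr.
  have := hK j (leq_trans (leq_maxl _ _) Kj).
  rewrite sub0r normrN ger0_norm ?normc_ge0//.
  by apply: le_trans; exact: abs_Re_le_normc.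
pose step k (f : (E -> R[i]) -> R[i]) v := f v + (3^-1 ^+ k)%:C * norming (w (nxt (k, f))) v.
pose F := fix F k := if k is j.+1 then step j (F j) else fun=> 0.
pose W k := w (nxt (k, F k)).
have SW k : Sg (W k) by exact: Sw.
have FS k v : F k.+1 v = F k v + (3^-1 ^+ k)%:C * norming (W k) v by [].
have dF k : dual (F k).
  elim: k => [|k IH]; last exact: dual_add_norming.
  apply/Sigma_dualE; split; first by move=> a u v _ _; rewrite mulr0 addr0.
  by exists 0 => v _; rewrite mul0r normr0.
have hW k := hnxt (k, F k) (dF k).
have ReS k v : complex.Re (F k.+1 v) = complex.Re (F k v) + 3^-1 ^+ k * complex.Re (norming (W k) v).
  by rewrite FS; case: (F k v) => a b; case: (norming _ _) => a' b' /=; rewrite mul0r subr0.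
have ImS k v : complex.Im (F k.+1 v) = complex.Im (F k v) + 3^-1 ^+ k * complex.Im (norming (W k) v).
  by rewrite FS; case: (F k v) => a b; case: (norming _ _) => a' b' /=; rewrite mul0r addr0.
(* 3/2 is the sum of the powers of 1/3. *)
have geo (a : nat -> R) (P : R) : 0 <= P -> (forall j, `|a j.+1 - a j| <= 3^-1 ^+ j * P) ->
    cvg (a @ \oo) /\ forall k, `|limn a - a k| <= 3 / 2 * 3^-1 ^+ k * P.
  move=> P0 ha.
  have ca : cvg (a @ \oo).
    apply: (geo_cvg P0) => j; rewrite (le_trans (ha j))// mulrC ler_wpM2l//.
    by rewrite lerXn2r ?nnegrE ?invr_ge0// lef_pV2 ?posrE// ler_nat.
  split => // k.
  have dist j : `|a (k + j)%N - a k| <= 3 / 2 * (3^-1 ^+ k - 3^-1 ^+ (k + j)) * P.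
    elim: j => [|j IH]; first by rewrite addn0 !subrr normr0 mulr0 mul0r.
    rewrite addnS -[a _](subrK (a (k + j)%N)) -addrA (le_trans (ler_normD _ _))//.
    rewrite [leRHS](_ : _ = 3^-1 ^+ (k + j) * P + 3 / 2 * (3^-1 ^+ k - 3^-1 ^+ (k + j)) * P).
      exact: lerD.
    by rewrite exprS; move: (3^-1 ^+ (k + j)) (3^-1 ^+ k) => x y; field.
  have hc : `|a (k + j)%N - a k| @[j --> \oo] --> `|limn a - a k|.
    apply: cvg_norm; apply: cvgB; last exact: cvg_cst.
    rewrite (_ : (fun j => a (k + j)%N) = fun j => a (j + k)%N); last first.
      by apply/funext => j; rewrite addnC.
    exact: (cvg_comp _ _ (cvg_addnr k) ca).
  apply: (cvgr_to_le hc).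
  apply: nearW => j; rewrite (le_trans (dist j))// ler_wpM2r// ler_wpM2l ?divr_ge0//.
  by rewrite lerBlDr lerDl third_ge0.
have cRe v : Sg v -> cvg ((fun k => complex.Re (F k v)) @ \oo) /\
    forall k, `|limn (fun k => complex.Re (F k v)) - complex.Re (F k v)| <= 3 / 2 * 3^-1 ^+ k * p v.
  move=> Sv; apply: geo; first exact: Sigma_norm_ge0.
  move=> j; rewrite ReS addrAC subrr add0r normrM ger0_norm ?third_ge0//.
  by rewrite ler_wpM2l ?third_ge0//; have [] := norming_bound Sv (SW j).
have cIm v : Sg v -> cvg ((fun k => complex.Im (F k v)) @ \oo) /\
    forall k, `|limn (fun k => complex.Im (F k v)) - complex.Im (F k v)| <= 3 / 2 * 3^-1 ^+ k * p v.
  move=> Sv; apply: geo; first exact: Sigma_norm_ge0.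
  move=> j; rewrite ImS addrAC subrr add0r normrM ger0_norm ?third_ge0//.
  by rewrite ler_wpM2l ?third_ge0//; have [] := norming_bound Sv (SW j).
pose l v := limn (fun k => complex.Re (F k v)) +i* limn (fun k => complex.Im (F k v)).
have dl : dual l.
  apply/Sigma_dualE; split.
    move=> a u v Su Sv; have [ru _] := cRe u Su; have [iu _] := cIm u Su.
    have [rv _] := cRe v Sv; have [iv _] := cIm v Sv.
    have linF k : F k (fun x => a * u x + v x) = a * F k u + F k v.
      by have /Sigma_dualE[h _] := dF k; exact: h.
    rewrite /l; case: a linF => a1 a2 linF.
    rewrite (_ : _ * _ + _ =
      (a1 * limn (fun k => complex.Re (F k u)) - a2 * limn (fun k => complex.Im (F k u))
         + limn (fun k => complex.Re (F k v))) +i*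
      (a1 * limn (fun k => complex.Im (F k u)) + a2 * limn (fun k => complex.Re (F k u))
         + limn (fun k => complex.Im (F k v))))//.
    congr (_ +i* _); apply/cvg_lim => //.
    - rewrite (_ : (fun k => _) = fun k => a1 * complex.Re (F k u) - a2 * complex.Im (F k u) + complex.Re (F k v)).
        by apply: cvgD => //; apply: cvgB; apply: cvgM => //; exact: cvg_cst.
      by apply/funext => k; rewrite linF; case: (F k u); case: (F k v).
    - rewrite (_ : (fun k => _) = fun k => a1 * complex.Im (F k u) + a2 * complex.Re (F k u) + complex.Im (F k v)).
        by apply: cvgD => //; apply: cvgD; apply: cvgM => //; exact: cvg_cst.
      by apply/funext => k; rewrite linF; case: (F k u); case: (F k v).
  exists (3 / 2) => v Sv; have [_ /(_ 0%N)] := cRe v Sv; have [_ /(_ 0%N)] := cIm v Sv.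
  by rewrite /= expr0 mulr1 !subr0.
have := wk l dl => /cvgrPdist_le /(_ _ ltr01)[K _ hK].
have [Kn big small] := hW K.
have := hK _ Kn; rewrite sub0r normrN ger0_norm ?normc_ge0//.
apply/negP; rewrite -ltNge; apply: lt_le_trans (abs_Re_le_normc _).
have [_ /(_ K.+1)] := cRe _ (SW K).
have := small; rewrite -/(W K) ReS norming_self// exprS /=.
have : 3 ^+ K * 3^-1 ^+ K = 1 :> R by rewrite -exprMn divff ?expr1n.
move: big; rewrite -/(W K).
move: (limn _) (complex.Re (F K (W K))) (p (W K)) (3 ^+ K : R) (3^-1 ^+ K : R) (third_ge0 K).
move=> x y z c e e0 hc ce; rewrite !ler_norml ltr_normr => /andP[y1 y2] /andP[h1 h2].
have e1 : 0 < e.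
  rewrite lt_neqAle e0 andbT; apply/eqP => e'; move: ce; rewrite -e' mulr0.
  by move/eqP; rewrite eq_sym oner_eq0.
have : 6 * c * e < z * e by rewrite ltr_pM2r.
by rewrite -mulrA ce mulr1 => ez; apply/orP; left; nra.
Qed.

End sigma_space.

(** * Compactness of the embedding into L^2 *)

Lemma cvge_dist {R : realType} (a d : nat -> \bar R) (A : \bar R) : A \is a fin_num ->
  (forall k, (0 <= a k)%E) -> (forall k, (0 <= d k)%E) -> d k @[k --> \oo] --> 0%E ->
  (forall k, (a k <= A + d k)%E) -> (forall k, (A <= a k + d k)%E) ->
  a k @[k --> \oo] --> A.
Proof.
move=> Afin a0 d0 dk up lo.
apply: cvge_near => // eta eta0; have := (cvge0P d0).1 dk _ eta0.
apply: filterS => k dke; split.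
  exact: (le_trans (up k) (leeD (le_refl A) dke)).
exact: (le_trans (lo k) (leeD (le_refl (a k)) dke)).
Qed.

Section compactness.
Context {R : realType} {n : nat} (m s : R) (V : 'rV[R]_n -> R) (c1 : R).
Context (c0 : 0 < c1) (Vc : forall x, c1 <= V x) (mV : measurable_fun setT V).
Context (hVinf : forall M : R, exists r : R, forall x, r <= enorm x -> M <= V x).
Context (s0 : 0 < s).
Local Notation E := 'rV[R]_n.
Local Notation L := (@leb R n).
Local Notation Sg := (Sigma m s V).
Local Notation dual := (Sigma_dual m s V).
Local Notation p := (Sigma_norm m s V).
Implicit Types (u v w : E -> R[i]).

Let V0 x : 0 <= V x. Proof. exact: le_trans (ltW c0) (Vc x). Qed.

Let L2sq_truncate_le k v : cmeas v -> (L2sq L v < +oo)%E -> (L2sq L (truncate k v) <= L2sq L v)%E.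
Proof.
move=> mv v2; apply: L2sq_le => //; first by have [] := truncate_bsupp_L2 k mv v2.
by move=> x; rewrite /truncate; case: ifP => // _; rewrite sqn0 sqn_ge0.
Qed.

Let trunc_const (k : nat) : R := ((2 * pi) ^+ n)^-1 * (2 * k%:R) ^+ n.

Let trunc_const_ge0 k : 0 <= trunc_const k.
Proof. by rewrite mulr_ge0 ?invr_ge0 ?exprn_ge0 ?mulr_ge0 ?pi_ge0. Qed.

(** [sqn_fourierL1_le] on the ball of truncation, enlarged to a box of known
    volume. *)
Lemma sqn_fourier_truncate (k : nat) v xi : (0 < k)%N -> cmeas v -> (L2sq L v < +oo)%E ->
  ((sqn (fourierL1 (truncate k v) xi))%:E <= (trunc_const k)%:E * L2sq L v)%E.
Proof.
move=> k0 mv v2; have [mt t2 _] := truncate_bsupp_L2 k mv v2.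
have k1 : 0 < k%:R :> R by rewrite ltr0n.
have LB : L (box 0 k%:R) = ((2 * k%:R) ^+ n)%:E by rewrite leb_box.
have LB0 : 0 < (2 * k%:R) ^+ n :> R by rewrite exprn_gt0// mulr_gt0.
have tB x : ~ box 0 k%:R x -> truncate k v x = 0.
  move=> xB; rewrite /truncate; case: ifP => // xk; exfalso; apply: xB => i.
  by rewrite mxE subr0 (le_trans (le_coord_enorm x i)).
have := sqn_fourierL1_le xi mt (measurable_box 0 k%:R) LB LB0 t2 tB.
move=> /le_trans; apply; apply: lee_wpmul2l; first by rewrite lee_fin trunc_const_ge0.
exact: L2sq_truncate_le.
Qed.

(** The functional through which weak convergence is used: it is bounded on
    the energy space because V >= c1 controls the L^2 norm. *)
Lemma fourier_truncate_dual (k : nat) xi : (0 < k)%N ->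
  dual (fun v => fourierL1 (truncate k v) xi).
Proof.
move=> k0; split.
  move=> a u v [/inL2E[mu u2] _] [/inL2E[mv v2] _].
  rewrite (_ : truncate k _ = fun x => a * truncate k u x + truncate k v x).
    by apply: fourierL1_lin; apply: bsupp_L2_cint; exact: truncate_bsupp_L2.
  by apply/funext => x; rewrite /truncate; case: ifP => // _; rewrite mulr0 addr0.
exists (Num.sqrt (trunc_const k * c1^-1)) => v Sv.
have [mv v2] := (inL2E v).1 Sv.1.
have A0 : 0 <= trunc_const k * c1^-1 by rewrite mulr_ge0 ?trunc_const_ge0 ?invr_ge0 ?(ltW c0).
have p0 : 0 <= p v by exact: Sigma_norm_ge0.
have nn := normc_ge0 (fourierL1 (truncate k v) xi).
rewrite -(@ler_pXn2r _ 2) ?nnegrE ?mulr_ge0 ?sqrtr_ge0// sqr_normc exprMn sqr_sqrtr//.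
rewrite -lee_fin (le_trans (sqn_fourier_truncate xi k0 mv v2))// -mulrA (EFinM (trunc_const k)).
apply: lee_wpmul2l; first by rewrite lee_fin trunc_const_ge0.
exact: Sigma_L2sq_le.
Qed.

(** Outside a large ball the potential is at least [M], so the mass there is at
    most 1/M times the potential energy. *)
Lemma tail_small (M : R) : 0 < M -> exists2 k : nat, (0 < k)%N &
  forall v, Sg v -> (L2sq L (fun x => v x - truncate k v x)%R <= (M^-1 * p v ^+ 2)%:E)%E.
Proof.
move=> M0; have [r hr] := hVinf M.
exists (Num.truncn r).+1 => // v Sv; set k := (Num.truncn r).+1.
have [mv v2] := (inL2E v).1 Sv.1; have [mt _ _] := truncate_bsupp_L2 k mv v2.
have Mi : 0 <= M^-1 by rewrite invr_ge0 ltW.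
apply: (@le_trans _ _ (M^-1%:E * L2sq L (pot_part V v))%E); last first.
  rewrite EFinM lee_wpmul2l ?lee_fin// (Sigma_norm_sqr c0 Vc mV Sv).
  have /(SigmaE m s c0 Vc)[_ h1 h2] := Sv.
  rewrite EFinD !fineK ?ge0_fin_numE ?L2sq_ge0//.
  by rewrite leeDr// L2sq_ge0.
have mp : cmeas (pot_part V v) by exact: pot_part_cmeas.
rewrite -integral_EFinZ//; last 2 first.
- exact: measurable_sqn.
- by move=> x; exact: sqn_ge0.
apply: le_integral_EFin.
- by apply: measurable_sqn; exact: cmeasB.
- by apply: measurable_funM => //; exact: measurable_sqn.
- by move=> x; exact: sqn_ge0.
move=> x; rewrite /pot_part sqnM sqn_real sqr_sqrtr// /truncate; case: ifPn => xk.
  by rewrite subrr sqn0 !mulr_ge0// sqn_ge0.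
rewrite subr0 mulrA ler_peMl ?sqn_ge0// ler_pdivlMl// mulr1; apply: hr.
move: xk; rewrite -ltNge => /ltW; apply: le_trans.
by rewrite ltW// /k truncnS_gt.
Qed.

(** [v] is its truncation plus a tail, and the norm of the truncation is computed
    on its transform. Below [Rr] this transform is kept; above, it differs from
    that of [v] by the transform of the tail, and the symbol is at least
    [Rr `^ (2 * s)]. *)
Lemma frequency_split (k : nat) (Rr : R) v : 0 < Rr -> Sg v ->
  (L2sq L v <= \int[L]_xi ((enorm xi <= Rr)%R%:R * sqn (fourierL1 (truncate k v) xi))%:E +
     ((2 * (Rr `^ (2 * s))^-1 * p v ^+ 2)%:E + 3%:E * L2sq L (fun x => v x - truncate k v x)%R))%E.
Proof.
move=> R0 Sv; have [mv v2] := (inL2E v).1 Sv.1.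
have bt := truncate_bsupp_L2 k mv v2; have [mt t2 _] := bt.
set t := truncate k v in bt mt t2 *.
have mF := bsupp_L2_cmeas_fourier bt.
have [mh h2] := fourier_inL2 Sv.1.
have Rp : 0 < Rr `^ (2 * s) by exact: powR_gt0.
pose low xi := (enorm xi <= Rr)%R%:R * sqn (fourierL1 t xi).
pose mid xi := 2 * (Rr `^ (2 * s))^-1 * (kinetic_symbol m s xi * sqn (fourier v xi)).
pose hi xi := 2 * sqn (fourier v xi - fourierL1 t xi).
have mlow : measurable_fun setT low.
  apply: measurable_funM; last exact: measurable_sqn.
  exact: measurable_enorm_leb.
have mmid0 : measurable_fun setT (fun xi => kinetic_symbol m s xi * sqn (fourier v xi)).
  by apply: measurable_funM; [exact: measurable_kinetic_symbol|exact: measurable_sqn].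
have mmid : measurable_fun setT mid by exact: measurable_funM.
have mhF : cmeas (fun xi => fourier v xi - fourierL1 t xi) by exact: cmeasB.
have mhi : measurable_fun setT hi by apply: measurable_funM => //; exact: measurable_sqn.
have low0 xi : 0 <= low xi by rewrite mulr_ge0 ?sqn_ge0.
have mid00 xi : 0 <= kinetic_symbol m s xi * sqn (fourier v xi) by rewrite mulr_ge0 ?kinetic_symbol_ge0 ?sqn_ge0.
have cc : 0 <= 2 * (Rr `^ (2 * s))^-1 by rewrite mulr_ge0 ?invr_ge0 ?(ltW Rp).
have mid0 xi : 0 <= mid xi by exact: mulr_ge0.
have hi0 xi : 0 <= hi xi by rewrite mulr_ge0 ?sqn_ge0.
have point xi : sqn (fourierL1 t xi) <= low xi + (mid xi + hi xi).
  have [le|gt] := leP (enorm xi) Rr; first by rewrite /low le mul1r lerDl addr_ge0.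
  rewrite -[leLHS]add0r; apply: lerD => //.
  rewrite (_ : fourierL1 t xi = fourier v xi - (fourier v xi - fourierL1 t xi)).
    rewrite (le_trans (sqnB_le2 _ _))// lerD2r /mid -mulrA ler_pM2l// mulrA ler_peMl ?sqn_ge0//.
    rewrite ler_pdivlMl// mulr1 (le_trans _ (kinetic_symbol_ge m xi (ltW s0)))//.
    by rewrite ge0_ler_powR ?nnegrE ?enorm_ge0 ?(ltW R0) ?(ltW gt)// mulr_ge0// ltW.
  by rewrite opprB addrC subrK.
have int_t : (L2sq L t <= \int[L]_xi (low xi)%:E + ((2 * (Rr `^ (2 * s))^-1 * p v ^+ 2)%:E +
    2%:E * L2sq L (fun x => v x - t x)%R))%E.
  rewrite -(bsupp_L2_plancherel bt) -(L2sq_fourier_sub Sv.1 bt).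
  apply: (@le_trans _ _ (\int[L]_xi (low xi + (mid xi + hi xi))%:E)%E).
    apply: le_integral_EFin => //.
    - exact: measurable_sqn.
    - by apply: measurable_funD => //; exact: measurable_funD.
    - by move=> xi; exact: sqn_ge0.
  rewrite integral_EFinD//; [|exact: measurable_funD|by move=> xi; rewrite addr_ge0].
  rewrite leeD2l// integral_EFinD//; apply: leeD.
    rewrite integral_EFinZ// -kineticE.
    have [kk -> hk] := kinetic_le_norm c0 Vc mV Sv.
    by rewrite -EFinM lee_fin ler_wpM2l.
  rewrite integral_EFinZ//; first exact: measurable_sqn.
  by move=> xi; exact: sqn_ge0.
apply: (@le_trans _ _ (L2sq L t + L2sq L (fun x => v x - t x)%R)%E).
  have md : cmeas (fun x => v x - t x) by exact: cmeasB.
  rewrite /L2sq -integral_EFinD; try (by move=> x; exact: sqn_ge0); try exact: measurable_sqn.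
  apply: le_integral_EFin; try exact: measurable_sqn.
  - by apply: measurable_funD; exact: measurable_sqn.
  - by move=> x; exact: sqn_ge0.
  move=> x; rewrite /t /truncate; case: ifP => _; first by rewrite subrr sqn0 addr0.
  by rewrite sqn0 subr0 add0r.
apply: (le_trans (leeD int_t (le_refl _))).
have e3 : 3%:E = (2%:E + 1 :> \bar R)%E by rewrite -EFinD; congr (_%:E); ring.
by rewrite e3 ge0_muleDl ?lee_fin// mul1e -!addeA.
Qed.

(** In [frequency_split] the radius of truncation and the frequency are chosen so
    that the last two terms add up to at most [eta] for all indices. The first term
    tends to 0 by dominated convergence, each of its values being an element of
    the dual applied to [w j]. *)
Theorem Sigma_compact (w : nat -> E -> R[i]) : (forall k, Sg (w k)) ->
  (forall l, dual l -> Normc.normc (l (w k)) @[k --> \oo] --> (0 : R)) ->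
  L2sq L (w k) @[k --> \oo] --> 0%E.
Proof.
move=> Sw wk; have [C hC] := weakly_null_bounded c0 Vc mV Sw wk.
have C0 : 0 <= C by apply: le_trans (hC 0%N); exact: Sigma_norm_ge0.
have pC k : p (w k) ^+ 2 <= C ^+ 2 by rewrite lerXn2r ?nnegrE ?Sigma_norm_ge0.
apply: cvge0_approx => [k|eta eta0]; first exact: L2sq_ge0.
have C1 : 0 < C ^+ 2 + 1 by rewrite ltr_wpDl// sqr_ge0.
(* M and Rr give eta/2 each in the bound of frequency_split; the 1 added to
   C ^+ 2 keeps them positive. *)
pose M := 6 * (C ^+ 2 + 1) / eta.
have M0 : 0 < M by rewrite divr_gt0// mulr_gt0.
pose Rr := (4 * (C ^+ 2 + 1) / eta) `^ ((2 * s)^-1).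
have RR : Rr `^ (2 * s) = 4 * (C ^+ 2 + 1) / eta.
  rewrite /Rr -powRrM mulVf ?powRr1 ?mulf_neq0 ?(gt_eqF s0)//.
  by rewrite divr_ge0 ?(ltW eta0)// mulr_ge0// ltW.
have R0 : 0 < Rr by rewrite powR_gt0// divr_gt0// mulr_gt0.
have [k k0 tail] := tail_small M0.
pose f j xi := (enorm xi <= Rr)%R%:R * sqn (fourierL1 (truncate k (w j)) xi).
have bt j : bsupp_L2 (truncate k (w j)).
  by have [mv v2] := (inL2E (w j)).1 (Sw j).1; exact: truncate_bsupp_L2.
exists (fun j => \int[L]_xi (f j xi)%:E)%E.
  apply: (@dominated_cvg0 _ _ _ _ _ (fun xi => trunc_const k * (c1^-1 * C ^+ 2) * \1_(box 0 Rr) xi)).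
  - move=> j; apply: measurable_funM; last by apply: measurable_sqn; exact: bsupp_L2_cmeas_fourier.
    exact: measurable_enorm_leb.
  - by apply: measurable_funM => //; apply: measurable_indic; exact: measurable_box.
  - by move=> j xi; rewrite mulr_ge0 ?sqn_ge0.
  - move=> j xi; rewrite /f.
    have K0 : 0 <= trunc_const k * (c1^-1 * C ^+ 2).
      by rewrite mulr_ge0 ?trunc_const_ge0// mulr_ge0 ?sqr_ge0// invr_ge0 ltW.
    have [le|gt] := leP (enorm xi) Rr; last by rewrite mul0r mulr_ge0.
    rewrite mul1r indicE mem_set ?mulr1; last first.
      by move=> i; rewrite mxE subr0 (le_trans (le_coord_enorm xi i)).
    have [mv v2] := (inL2E (w j)).1 (Sw j).1.
    rewrite -lee_fin (le_trans (sqn_fourier_truncate xi k0 mv v2))// (EFinM (trunc_const k)).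
    apply: lee_wpmul2l; first by rewrite lee_fin trunc_const_ge0.
    apply: (le_trans (Sigma_L2sq_le c0 Vc mV (Sw j))).
    by rewrite lee_fin ler_wpM2l// invr_ge0 ltW.
  - rewrite integral_EFinZ//; last 2 first.
    + by apply: measurable_indic; exact: measurable_box.
    + by rewrite mulr_ge0 ?trunc_const_ge0// mulr_ge0 ?sqr_ge0// invr_ge0 ltW.
    rewrite integral_indic//; last exact: measurable_box.
    by rewrite setIT [X in (_ * X)%E](leb_box _ (ltW R0)) -EFinM ltry.
  - move=> xi; have h := wk _ (fourier_truncate_dual xi k0).
    rewrite /f -[X in _ --> X](mulr0 ((enorm xi <= Rr)%R%:R)).
    apply: cvgM; first exact: cvg_cst.
    rewrite (_ : (fun j => _) = fun j => Normc.normc (fourierL1 (truncate k (w j)) xi) *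
      Normc.normc (fourierL1 (truncate k (w j)) xi)); last first.
      by apply/funext => j; rewrite -expr2 sqr_normc.
    by rewrite -[X in _ --> X](mulr0 0); exact: cvgM.
move=> j; apply: (le_trans (frequency_split k R0 (Sw j))); rewrite leeD2l//.
apply: (@le_trans _ _ ((2 * (Rr `^ (2 * s))^-1 * p (w j) ^+ 2)%:E + 3%:E * (M^-1 * p (w j) ^+ 2)%:E)%E).
  by apply: leeD => //; apply: lee_wpmul2l; [rewrite lee_fin|exact: tail].
rewrite -EFinM -EFinD lee_fin RR /M !invf_div.
have := pC j; move: (p (w j) ^+ 2) (C ^+ 2) C1 => q D D1 qD.
rewrite [leLHS](_ : _ = eta * (q / (D + 1))); last by field; rewrite gt_eqF.
by rewrite ler_piMr ?(ltW eta0)// ler_pdivrMr// mul1r; lra.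
Qed.

End compactness.

(** * Convergence of the norm and of the energy *)

Lemma Sigma_norm_lin {R : realType} {n : nat} (m s : R) (V : 'rV[R]_n -> R) (c1 : R)
  (c0 : 0 < c1) (Vc : forall x, c1 <= V x) (mV : measurable_fun setT V)
  (a : R[i]) (u v : 'rV[R]_n -> R[i]) : Sigma m s V u -> Sigma m s V v ->
  Sigma_norm m s V (fun x => a * u x + v x) ^+ 2 <=
    2 * sqn a * Sigma_norm m s V u ^+ 2 + 2 * Sigma_norm m s V v ^+ 2.
Proof.
move=> Su Sv; have Sl := Sigma_lin c0 Vc mV a Su Sv.
have nsq w : Sigma m s V w ->
    (Sigma_norm m s V w ^+ 2)%:E = (L2sq (leb n) (kin_part m s w) + L2sq (leb n) (pot_part V w))%E.
  move=> Sw; rewrite (Sigma_norm_sqr c0 Vc mV Sw).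
  have /(SigmaE m s c0 Vc)[_ h1 h2] := Sw.
  by rewrite EFinD !fineK// ge0_fin_numE ?L2sq_ge0.
have step (f g h : 'rV[R]_n -> R[i]) : cmeas f -> cmeas g -> cmeas h ->
    {ae leb n, forall x, f x = a * g x + h x} ->
    (L2sq (leb n) f <= (2 * sqn a)%:E * L2sq (leb n) g + 2%:E * L2sq (leb n) h)%E.
  move=> mf mg mh fgh; have mag : cmeas (fun x => a * g x).
    by apply: cmeasM => //; exact: cmeas_cst.
  rewrite (L2sq_ae mf (cmeas_lin a mg mh) fgh) (le_trans (L2sqD_le2 _ mag mh))//.
  by rewrite L2sqZ// muleA.
have u2 := Su.1; have v2 := Sv.1.
have [mu _] := (inL2E u).1 u2; have [mv _] := (inL2E v).1 v2.
have hk := step _ _ _ (kin_part_cmeas m s (inL2_lin a u2 v2)) (kin_part_cmeas m s u2)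
  (kin_part_cmeas m s v2) (kin_part_lin m s a u2 v2).
have hp := step _ _ _ (pot_part_cmeas mV (cmeas_lin a mu mv)) (pot_part_cmeas mV mu)
  (pot_part_cmeas mV mv) (aeW _ (fun x => congr1 (fun f => f x) (pot_part_lin V a u v))).
rewrite -lee_fin EFinD (EFinM (2 * sqn a)) (EFinM 2 (_ ^+ 2)) (nsq _ Sl) (nsq _ Su) (nsq _ Sv).
have a0 : (0 <= (2 * sqn a)%:E)%E by rewrite lee_fin mulr_ge0 ?sqn_ge0.
rewrite ge0_muleDr ?L2sq_ge0// [X in (_ <= _ + X)%E]ge0_muleDr ?L2sq_ge0//.
by apply: (le_trans (leeD hk hp)); rewrite addeACA.
Qed.

Theorem lemma3p2 (R : realType) (N : nat) (m s gamma : R)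
    (V : 'rV[R]_N -> R) (v : nat -> 'rV[R]_N -> R[i]) (U : 'rV[R]_N -> R[i])
    (hN : (1 <= N)%N) (hm : 0 <= m)
    (hs0 : 0 < s) (hsN : s < N%:R / 2)
    (hg0 : 0 < gamma) (hg : gamma < 2 * s)
    (hVsmooth : smooth V)
    (hVlow : exists2 c1 : R, 0 < c1 & forall x, c1 <= V x)
    (hVinf : forall M : R, exists r : R, forall x, r <= enorm x -> M <= V x)
    (hv : forall n, Sigma m s V (v n))
    (hU : Sigma m s V U)
    (hw : weakly_cvg m s V v U) :
  exists2 phi : nat -> nat, {homo phi : i j / (i < j)%N} &
    (L2norm (v (phi n)) ^+ 2)%E @[n --> \oo] --> (L2norm U ^+ 2)%E /\
    riesz_energy gamma (v (phi n)) @[n --> \oo] --> riesz_energy gamma U.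
Proof.
have [c1 c0 Vc] := hVlow.
have mV : measurable_fun setT V.
  by apply: continuous_measurable_rV; have [] := hVsmooth [::].
pose w k x := -1 * U x + v k x.
have Sw k : Sigma m s V (w k) by exact: (Sigma_lin c0 Vc mV).
have wk l : Sigma_dual m s V l -> Normc.normc (l (w k)) @[k --> \oo] --> (0 : R).
  move=> dl; rewrite (_ : (fun k => _) = fun k => Normc.normc (l (v k) - l U)).
    exact: hw.
  by apply/funext => k; have [-> // _] := dl; rewrite mulN1r addrC.
have w0 := Sigma_compact c0 Vc mV hVinf hs0 Sw wk.
have [C hC] := weakly_null_bounded c0 Vc mV Sw wk.
have C0 : 0 <= C by apply: le_trans (hC 0%N); exact: Sigma_norm_ge0.
have [mU U2] := (inL2E U).1 hU.1.
have mv k : cmeas (v k) by have [] := (inL2E (v k)).1 (hv k).1.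
have wE k : (fun x => v k x - U x) = w k.
  by apply/funext => x; rewrite /w mulN1r addrC.
have vU : L2sq (leb N) (fun x => v k x - U x) @[k --> \oo] --> 0%E.
  by rewrite (_ : (fun k => _) = fun k => L2sq (leb N) (w k))//; apply/funext => k; rewrite wE.
exists id => //; split.
  rewrite L2norm_sqr (_ : (fun k => _) = fun k => L2sq (leb N) (v k)).
    exact: cvg_L2sq.
  by apply/funext => k; rewrite L2norm_sqr.
pose B := 2 * C ^+ 2 + 2 * Sigma_norm m s V U ^+ 2.
have B0 : 0 <= B by apply: addr_ge0; apply: mulr_ge0 => //; exact: sqr_ge0.
have UB : Sigma_norm m s V U ^+ 2 <= B.
  by rewrite /B; have := sqr_ge0 C; have := sqr_ge0 (Sigma_norm m s V U); lra.
have vB k : Sigma_norm m s V (v k) ^+ 2 <= B.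
  have -> : v k = fun x => 1 * w k x + U x.
    by apply/funext => x; rewrite /w mul1r mulN1r addrC addrA subrr add0r.
  apply: (le_trans (Sigma_norm_lin c0 Vc mV 1 (Sw k) hU)).
  rewrite /B lerD2r (_ : sqn 1 = 1 :> R); last by rewrite /sqn /= expr1n expr0n addr0.
  by rewrite mulr1 ler_pM2l// lerXn2r ?nnegrE ?Sigma_norm_ge0.
pose K := c1^-1 + local_const N s * dyadic_const gamma (2 * s).
have D0 : 0 <= dyadic_const gamma (2 * s) by rewrite ltW// dyadic_const_gt0.
have lc0 : 0 <= local_const N s by exact: local_const_ge0.
have K0 : 0 <= K by apply: addr_ge0; [rewrite invr_ge0 ltW|exact: mulr_ge0].
have coul u : Sigma m s V u -> Sigma_norm m s V u ^+ 2 <= B ->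
    forall x, (\int[leb N]_y (sqn (u y) * riesz_kernel gamma (y - x))%:E <= (K * B)%:E)%E.
  move=> Su uB x; have [k kE kp] := kinetic_le_norm c0 Vc mV Su.
  apply: (le_trans (coulomb_bound x hN hs0 hsN hg0 hg Su.1 kE)).
  have -> : ((K * B)%:E = (c1^-1 * B)%:E + (local_const N s * dyadic_const gamma (2 * s) * B)%:E)%E.
    by rewrite -EFinD -mulrDl.
  apply: leeD.
    apply: (le_trans (Sigma_L2sq_le c0 Vc mV Su)).
    by rewrite lee_fin ler_wpM2l// invr_ge0 ltW.
  rewrite lee_fin mulrAC; apply: ler_wpM2l; first exact: mulr_ge0.
  exact: le_trans uB.
have KB0 : 0 <= K * B by exact: mulr_ge0.
have cU := coul _ hU UB; have cv k := coul _ (hv k) (vB k).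
have E0 (u : 'rV[R]_N -> R[i]) : (0 <= riesz_energy gamma u)%E.
  rewrite riesz_energyE; apply: integral_ge0 => x _; apply: integral_ge0 => y _.
  by rewrite lee_fin !mulr_ge0 ?sqn_ge0 ?riesz_kernel_ge0.
have Efin : riesz_energy gamma U \is a fin_num.
  rewrite ge0_fin_numE//.
  have c0' : forall x : 'rV[R]_N, (\int[leb N]_y (sqn (0 : R[i]) * riesz_kernel gamma (y - x))%:E <= (K * B)%:E)%E.
    by move=> x; under eq_integral do rewrite sqn0 mul0r; rewrite integral0 lee_fin.
  have := @riesz_energy_le R N gamma U (fun=> 0) (K * B) mU (cmeas_cst _ 0) KB0 cU c0'.
  move=> /le_lt_trans; apply.
  rewrite riesz_energyE; under eq_integral do under eq_integral do rewrite sqn0 !mul0r.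
  under eq_integral do rewrite integral0.
  rewrite integral0 add0e lte_mul_pinfty ?lee_fin ?mulr_ge0//.
  by under eq_integral do rewrite sqn0 subr0 ger0_norm ?sqn_ge0//.
apply: (cvge_dist (d := fun k => ((2 * (K * B))%:E * \int[leb N]_x (`|sqn (v k x) - sqn (U x)|)%:E)%E)) => //.
- by move=> k; rewrite mule_ge0 ?lee_fin ?mulr_ge0//; apply: integral_ge0 => x _; rewrite lee_fin.
- by apply: cvge0Z; exact: cvg_L1_sqn.
- by move=> k; exact: riesz_energy_le.
- move=> k; under eq_integral do rewrite distrC.
  exact: riesz_energy_le.
Qed.
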